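(* Let $k\ge2$, $\Omega$ a finite non-empty set, $\Psi$ a finite set of functions $\Omega^k\to(0,\infty)$, $P$ a probability distribution on $\Psi$, and $d>0$. For any sequence $L=L(n)\to\infty$ there exist $\varepsilon=\varepsilon(n)\to0$ and $K=K(n)\to\infty$ such that, asymptotically almost surely, the random factor graph $\mathbb G=\mathbb G(n,\mathbf m,P)$ has the following property: there exist pairwise disjoint non-empty sets $S_1,\dots,S_l\subset\Omega^{V_n}$ with $1\le l\le L(n)$ such that (i) $\sum_{j=1}^l\mu_{\mathbb G}(S_j)\ge1-\varepsilon$; (ii) for each $j=1,\dots,l$, $S_j$ is an $(\varepsilon,\ell)$-Bethe state of $\mathbb G$ for each $\ell=1,\dots,K$.
   Context: An $\Omega$-factor graph $G=(V,F,(\partial a)_{a\in F},(\psi_a)_{a\in F})$ consists of finite sets $V$ (variable nodes) and $F$ (constraint nodes), for each $a\in F$ a tuple $\partial a=(\partial_1a,\dots,\partial_ka)\in V^k$ and a weight function $\psi_a:\Omega^k\to(0,\infty)$. Its Gibbs distribution is $\mu_G(\sigma)=\psi_G(\sigma)/Z(G)$ with $\psi_G(\sigma)=\prod_{a\in F}\psi_a(\sigma_{\partial_1a},\dots,\sigma_{\partial_ka})$, $Z(G)=\sum_\tau\psi_G(\tau)$; $\mu_{G,U}$ is the marginal on $U\subset V$, and for $\emptyset\ne S\subset\Omega^V$, $\mu_{G,U}[\cdot|S]$ is the marginal on $U$ of $\mu_G$ conditioned on $S$. $G$ induces a bipartite graph joining $a\in F$ to $\partial_1a,\dots,\partial_ka$;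 $\partial x$ is the set of constraint nodes adjacent to $x$, and $\partial a$ also denotes the set $\{\partial_1a,\dots,\partial_ka\}$. The random factor graph $\mathbb G(n,m,P)$ has $V=V_n=\{x_1,\dots,x_n\}$, $F=\{a_1,\dots,a_m\}$, with independently for each $i$: $\partial a_i$ uniform in $V^k$ and $\psi_{a_i}$ drawn from $P$; $\mathbb G=\mathbb G(n,\mathbf m,P)$ with $\mathbf m\sim\mathrm{Po}(dn/k)$. A property holds asymptotically almost surely if its probability tends to 1 as $n\to\infty$. A set $\emptyset\ne U\subset V$ is a cavity if (CAV1) the induced subgraph $G[U]$ (variable nodes $U$ and all $a\in F$ with $\partial a\subset U$) is acyclic; (CAV2) every $a\in F$ with $\partial a\not\subset U$ has $|\partial a\cap U|\le1$; (CAV3) for distinct $a,b\in F$ with $\partial a\cap U\ne\emptyset\ne\partial b\cap U$, $(\partial a\cap\partial b)\setminus U=\emptyset$. $\partial U$ is the set of $a\in F$ with $\partial a\cap U\ne\emptyset$ and $\partial a\setminus U\ne\emptyset$; for $a\in\partial U$, $x_{a\to U}$ is the unique variable node in $U\cap\partial a$. $\mathcal C(G,l,r)$ is the set of cavities $U$ with $|U|=l$ such that $G[U]$ has exactly $r$ connected components. For $\emptyset\ne S\subset\Omega^V$, $x\in V$, $a\in\partial x$, the standard message is $\mu_{G,a\to x}[\tau|S]\propto\sum_{\sigma\in S}\mathbf 1\{\sigma_x=\tau\}\prod_{b\in F\setminus(\partial x\setminus\{a\})}\psi_b(\sigma|_{\partial b})$ ($\tau\in\Omega$). Define $\mu_{G[U]}(\sigma)\propto\prod_{a\in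 F,\,\partial a\subset U}\psi_a(\sigma|_{\partial a})$ and $\bar\mu_{G,U}[\sigma|S]\propto\mu_{G[U]}(\sigma)\prod_{a\in\partial U}\mu_{G,a\to x_{a\to U}}[\sigma_{x_{a\to U}}|S]$ for $\sigma\in\Omega^U$. $S$ is an $(\varepsilon,\ell)$-Bethe state of $G$ if for all $1\le r\le l\le\ell$: $\sum_{U\in\mathcal C(G,l,r)}\sum_{\sigma\in\Omega^U}|\mu_{G,U}[\sigma|S]-\bar\mu_{G,U}[\sigma|S]|<\varepsilon|\mathcal C(G,l,r)|$.
   Formalization: In the definition of an (ε,ℓ)-Bethe state, the inequality is required only for those l, r with C(G,l,r) non-empty; read literally, an empty C(G,l,r) would demand 0<0, which makes the statement false (e.g. k=3, l=2, r=1). *)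

(* Defs.v *)
From Stdlib Require Import Reals ClassicalEpsilon.
From HB Require Import structures.
From mathcomp Require Import all_boot.
Delimit Scope R_scope with Re.
Set Implicit Arguments. Unset Strict Implicit. Unset Printing Implicit Defensive.

Definition pb (P : Prop) : bool :=
  if excluded_middle_informative P then true else false.

Definition tends_to_infty (L : nat -> nat) : Prop :=
  forall M, exists N, forall n, N <= n -> M <= L n.

Section FactorGraphs.
Variables (Omega : finType) (k : nat) (I : finType).
(* Psi is indexed by the finite type I: psi i : Omega^k -> (0,oo) *)
Variable psi : I -> k.-tuple Omega -> R.

(* an Omega-factor graph with variable nodes V_n = 'I_n and constraint nodes
   F = 'I_m: constraint a has neighbourhood tuple (G a).1 and weight
   function psi (G a).2 *)
Definition factor_graph (n m : nat) := {ffun 'I_m -> k.-tuple 'I_n * I}.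
Definition config (n : nat) := {ffun 'I_n -> Omega}.

Section Fixed.
Variables (n m : nat) (G : factor_graph n m).

Definition nbr (a : 'I_m) : {set 'I_n} := [set x | x \in (G a).1].

Definition evc (a : 'I_m) (s : 'I_n -> Omega) : R :=
  psi (G a).2 (map_tuple s (G a).1).

Definition psiG (s : config n) : R := \big[Rmult/R1]_(a < m) evc a s.
Definition Zpart : R := \big[Rplus/R0]_(s : config n) psiG s.
Definition muS (S : {set config n}) : R :=
  (\big[Rplus/R0]_(s in S) psiG s / Zpart)%Re.

Definition Usub (U : {set 'I_n}) := {x : 'I_n | x \in U}.
Definition restr (U : {set 'I_n}) (s : config n) : {ffun Usub U -> Omega} :=
  [ffun x => s (val x)].

Definition margU (U : {set 'I_n}) (S : {set config n})
    (tau : {ffun Usub U -> Omega}) : R :=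
  (\big[Rplus/R0]_(s in S | restr U s == tau) psiG s
    / \big[Rplus/R0]_(s in S) psiG s)%Re.

Definition msg_num (a : 'I_m) (x : 'I_n) (S : {set config n}) (t : Omega) : R :=
  \big[Rplus/R0]_(s in S | s x == t)
     \big[Rmult/R1]_(b < m | (b == a) || (x \notin nbr b)) evc b s.
Definition msg (a : 'I_m) (x : 'I_n) (S : {set config n}) (t : Omega) : R :=
  (msg_num a x S t / \big[Rplus/R0]_(t' : Omega) msg_num a x S t')%Re.

Section Cavity.
Variable U : {set 'I_n}.

Definition inner (a : 'I_m) : bool := nbr a \subset U.
Definition bdry (a : 'I_m) : bool := (nbr a :&: U != set0) && ~~ (nbr a \subset U).

(* a cycle in the bipartite graph of G[U]: distinct constraint nodes
   a_0..a_{r-1} of G[U] and distinct variable nodes x_0..x_{r-1} with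
   x_i adjacent to a_i and a_{i+1 mod r}, r >= 2 *)
Definition has_cycle : Prop :=
  exists r, 2 <= r /\ exists (a : 'I_r -> 'I_m) (x : 'I_r -> 'I_n),
    injective a /\ injective x /\
    forall i, inner (a i) /\ x i \in nbr (a i) /\ x i \in nbr (a (ordS i)).

Definition CAV1 : Prop := ~ has_cycle.
Definition CAV2 : Prop := forall a, ~~ (nbr a \subset U) -> #|nbr a :&: U| <= 1.
Definition CAV3 : Prop := forall a b, a != b -> nbr a :&: U != set0 ->
  nbr b :&: U != set0 -> (nbr a :&: nbr b) :\: U = set0.
Definition cavity : Prop := U != set0 /\ CAV1 /\ CAV2 /\ CAV3.

Definition inGU (v : 'I_n + 'I_m) : bool :=
  match v with inl x => x \in U | inr a => inner a end.
Definition adjGU : rel ('I_n + 'I_m) := fun v w =>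
  inGU v && inGU w &&
  match v, w with
  | inl x, inr a => x \in nbr a
  | inr a, inl x => x \in nbr a
  | _, _ => false
  end.
Definition ncomp : nat := n_comp adjGU inGU.

(* extension of tau in Omega^U to all of V (default w0 outside U; only
   ever evaluated on U) *)
Definition extU (w0 : Omega) (tau : {ffun Usub U -> Omega}) (x : 'I_n) : Omega :=
  match (insub x : option (Usub U)) with Some y => tau y | None => w0 end.

Definition wGU (w0 : Omega) (tau : {ffun Usub U -> Omega}) : R :=
  \big[Rmult/R1]_(a : 'I_m | inner a) evc a (extU w0 tau).
Definition muGU (w0 : Omega) (tau : {ffun Usub U -> Omega}) : R :=
  (wGU w0 tau / \big[Rplus/R0]_(t : {ffun Usub U -> Omega}) wGU w0 t)%Re.

(* bar mu_{G,U}[tau | S]; for a in \partial U the inner product ranges over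
   \partial a \cap U = {x_{a -> U}} *)
Definition barw (w0 : Omega) (S : {set config n}) (tau : {ffun Usub U -> Omega}) : R :=
  (muGU w0 tau *
   \big[Rmult/R1]_(a : 'I_m | bdry a)
     \big[Rmult/R1]_(x in nbr a :&: U) msg a x S (extU w0 tau x))%Re.
Definition barmu (w0 : Omega) (S : {set config n}) (tau : {ffun Usub U -> Omega}) : R :=
  (barw w0 S tau / \big[Rplus/R0]_(t : {ffun Usub U -> Omega}) barw w0 S t)%Re.
End Cavity.

Definition Cset (l r : nat) : {set {set 'I_n}} :=
  [set U : {set 'I_n} | pb (cavity U) && (#|U| == l) && (ncomp U == r)].

Definition bethe_state (w0 : Omega) (eps : R) (ell : nat) (S : {set config n}) : Prop :=
  forall l r, 1 <= r -> r <= l -> l <= ell -> Cset l r != set0 ->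
    (\big[Rplus/R0]_(U in Cset l r)
       \big[Rplus/R0]_(tau : {ffun Usub U -> Omega})
          Rabs (margU S tau - barmu w0 S tau)
     < eps * INR #|Cset l r|)%Re.
End Fixed.

Variable P : I -> R.
Definition graph_prob (n m : nat) (G : factor_graph n m) : R :=
  \big[Rmult/R1]_(a < m) (/ (INR n ^ k) * P (G a).2)%Re.
Definition prob_event (n m : nat) (E : factor_graph n m -> Prop) : R :=
  \big[Rplus/R0]_(G : factor_graph n m) (if pb (E G) then graph_prob G else 0%Re).
Definition poisson (lam : R) (m : nat) : R := (exp (- lam) * lam ^ m / INR (m`!))%Re.

Definition aas (d : R) (E : forall n m, factor_graph n m -> Prop) : Prop :=
  exists p : nat -> R,
    (forall n, infinite_sum
        (fun m => poisson (d * INR n / INR k) m * prob_event (E n m))%Re (p n))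
    /\ Un_cv p 1%Re.
End FactorGraphs.

(* Main.v *)
Require Import Defs.
From Stdlib Require Import Reals Lra.
From HB Require Import structures.
From mathcomp Require Import all_boot all_order all_algebra Rstruct zify ring lra.
Set Implicit Arguments. Unset Strict Implicit. Unset Printing Implicit Defensive.

(* Pinning. For a list T of vertices the configurations split into the cylinder
   sets pin T s on which the spins along T are fixed. There are at most
   |Omega|^|T| of them, so it suffices to find, for most graphs, a list T of
   bounded length such that for mu-most s the set pin T s is a Bethe state.

   For a cavity U the constraints touching U factorise, given pin T s, if the
   factors of the boundary constraints are nearly uncorrelated under the measure
   of the graph without these constraints; the marginal on U and the standard
   messages are then both ratios of products of the same conditional
   expectations. The required decorrelation holds on average: the outer vertices
   of the boundary constraints are exchangeable with uniformly random ones, and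
   for a random T pinning boundedly many further random vertices hardly changes a
   conditional expectation, since the corresponding energies are monotone and
   bounded and hence telescope. Summed over all U of size l that carry the number
   N = ceil((l - r)/(k - 1)) of constraints forced by r components, this bounds
   the expected total error by a small multiple of n^l / n^((k-1)N).

   Conversely, with high probability C(G, l, r) is either empty or has at least
   c n^l / n^((k-1)N) elements: the constraints with a repeated neighbour that a
   given cavity requires can be reused, and are completed by one of the linearly
   many isolated stars and by arbitrary isolated vertices. Averaging over T then
   produces the decomposition for fixed precision, uniformly in m = Theta(n), and
   Poisson tail bounds and a diagonal argument give the limit statement. *)

(** * Mixtures over a Poisson variable *)

(** The obstacle is the normalisation: the error is averaged over C(G, l, r), which may be far
    smaller than the family of all l-sets. If k - 1 does not divide l - r, every member contains a
    constraint with a repeated neighbour; a random graph has O(1) of these in expectation, so they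
    can be neither created nor ignored. This is why expectations are compared with [scale], and why
    the lower bound is conditional on the existence of one cavity.

    The constraints touching U are left out of the measure because the remaining weight is
    unaffected when their outer vertices are resampled; these vertices are then random and
    independent of it, so pinning them is pinning random vertices. If at most B constraints touch U,
    the Gibbs measure is dominated at the cost of a factor C^(2B), where the weights take values in
    [1/C, C]; the case of more than B is a Markov bound.

    The length bound Th of the lists, hence the number |Omega|^Th of pieces, is fixed before n; this
    is what lets L grow arbitrarily slowly. *)

Lemma factE_std m : Factorial.fact m = m`!.
Proof. by elim: m => // m IH; rewrite factS -IH. Qed.

Lemma exp_pow_nat (x : R) m : (exp x ^ m)%Re = exp (INR m * x)%Re.
Proof.
elim: m => [|m IH]; first by rewrite /= Rmult_0_l exp_0.
by rewrite S_INR /= IH -exp_plus; congr exp; Lra.lra.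
Qed.

Lemma poisson_ge0 lam m : (0 <= lam -> 0 <= poisson lam m)%Re.
Proof.
move=> l0; apply: Rmult_le_pos; last first.
  by apply/Rlt_le/Rinv_0_lt_compat; rewrite -factE_std; exact: INR_fact_lt_0.
by apply: Rmult_le_pos; [apply/Rlt_le/exp_pos | exact: pow_le].
Qed.

(** The power series of [exp] at [lam * y]. The values y = 1, e, 1/e supply the total mass and the
    exponential moments behind the tail bounds. *)
Lemma poisson_gf lam y :
  infinite_sum (fun m => (poisson lam m * y ^ m)%Re) (exp (- lam) * exp (lam * y))%Re.
Proof.
have h := proj2_sig (exist_exp (lam * y)).
have h2 : Un_cv (fun N => exp (- lam) * sum_f_R0 (fun i => / INR (Factorial.fact i) * (lam * y) ^ i) N)%Re
    (exp (- lam) * exp (lam * y)).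
  by apply: CV_mult => //; move=> e he; exists 0%N => n _; rewrite Rdist_eq.
move=> e he; have [N hN] := h2 e he; exists N => n hn; have := hN n hn.
rewrite scal_sum (@PartSum.sum_eq _ (fun m => (poisson lam m * y ^ m)%Re)) // => i _.
have rearr u v w z : (u * (v * w) * z = z * v * u * w)%Re by Lra.lra.
by rewrite /poisson factE_std Rpow_mult_distr; exact: rearr.
Qed.

Section Mixture.
Variables (lam a b eta : R) (q : nat -> R).
Hypothesis lam0 : (0 <= lam)%Re.
Hypothesis q01 : forall m, (0 <= q m <= 1)%Re.

Lemma poisson_mixture_ex : exists2 p : R,
  infinite_sum (fun m => poisson lam m * q m)%Re p & (p <= 1)%Re.
Proof.
have h1 : infinite_sum (fun m => (poisson lam m * 1 ^ m)%Re) 1%Re.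
  have := poisson_gf lam 1%Re; rewrite Rmult_1_r -exp_plus.
  have -> : (- lam + lam = 0)%Re by Lra.lra. rewrite exp_0; exact.
have hle m : (0 <= poisson lam m * q m <= poisson lam m * 1 ^ m)%Re.
  have p0 := poisson_ge0 m lam0; have [q0 q1] := q01 m; rewrite pow1; split.
    exact: Rmult_le_pos.
  by apply: Rmult_le_compat_l.
have [p hp] := Rseries_CV_comp _ _ hle (exist _ _ h1).
exists p => //; apply: Rle_cv_lim hp h1 => N; apply: sum_Rle => m _.
by case: (hle m).
Qed.

(** Chernoff bounds without splitting the series: 1 - eta - e^(m - b) - e^(a - m) <= q m holds
    termwise, by the hypothesis for m in [a, b] and because one of the exponentials is at least 1
    otherwise. Summing the exponentials against the Poisson weights gives the two tails, the lower
    one by 1/e <= 1/2. *)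
Lemma poisson_mixture_ge p : (0 <= eta)%Re ->
  infinite_sum (fun m => poisson lam m * q m)%Re p ->
  (forall m, a <= INR m <= b -> 1 - eta <= q m)%Re ->
  (1 - eta - exp (lam * (exp 1 - 1) - b) - exp (a - lam / 2) <= p)%Re.
Proof.
move=> eta0 hp hq.
set A := (exp a)%Re; set B := (exp (- b))%Re.
have h1 := poisson_gf lam 1%Re; have h2 := poisson_gf lam (exp 1)%Re.
have h3 := poisson_gf lam (exp (-1))%Re.
pose l := ((1 - eta) * (exp (- lam) * exp (lam * 1)) + (- B * (exp (- lam) * exp (lam * exp 1)) +
     - A * (exp (- lam) * exp (lam * exp (-1)))))%Re.
have hcv : Un_cv (fun N => (1 - eta) * sum_f_R0 (fun m => poisson lam m * 1 ^ m) N
     + (- B * sum_f_R0 (fun m => poisson lam m * exp 1 ^ m) N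
     + - A * sum_f_R0 (fun m => poisson lam m * exp (- 1) ^ m) N))%Re
   l.
  have cst c : Un_cv (fun=> c) c by move=> e he; exists 0%N => n _; rewrite Rdist_eq.
  by apply: CV_plus; [|apply: CV_plus]; apply: CV_mult.
apply: Rle_trans (_ : l <= p)%Re; last first.
  apply: Rle_cv_lim hcv hp => N; rewrite !scal_sum -!plus_sum; apply: sum_Rle => m _.
  have p0 := poisson_ge0 m lam0; have [q0 q1] := q01 m; rewrite !exp_pow_nat pow1.
  have -> : (poisson lam m * 1 * (1 - eta) + (poisson lam m * exp (INR m * 1) * - B +
      poisson lam m * exp (INR m * -1) * - A) = poisson lam m *
      ((1 - eta) - exp (INR m * 1 + - b) - exp (INR m * -1 + a)))%Re.
    by rewrite !exp_plus /A /B; Lra.lra.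
  apply: Rmult_le_compat_l => //.
  have e1 := exp_ineq1_le (INR m * 1 + - b)%Re; have e2 := exp_ineq1_le (INR m * -1 + a)%Re.
  have f1 := exp_pos (INR m * 1 + - b)%Re; have f2 := exp_pos (INR m * -1 + a)%Re.
  case: (Rle_dec a (INR m)) => ha; last by Lra.lra.
  case: (Rle_dec (INR m) b) => hb; last by Lra.lra.
  by have := hq m (conj ha hb); Lra.lra.
have e0 : (exp (- lam) * exp (lam * 1) = 1)%Re.
  rewrite -exp_plus; have -> : (- lam + lam * 1 = 0)%Re by Lra.lra. exact: exp_0.
have e1 : (exp (lam * (exp 1 - 1) - b) = B * (exp (- lam) * exp (lam * exp 1)))%Re.
  rewrite /B -!exp_plus; congr exp; Lra.lra.
have e2 : (A * (exp (- lam) * exp (lam * exp (-1))) <= exp (a - lam / 2))%Re.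
  rewrite /A -!exp_plus.
  have half : (exp (-1) <= / 2)%Re.
    have -> : (-1 = - (1))%Re by Lra.lra.
    rewrite exp_Ropp; apply: Rinv_le_contravar; first by Lra.lra.
    by have := exp_ineq1_le 1%Re; Lra.lra.
  have hh : (a + (- lam + lam * exp (-1)) <= a - lam / 2)%Re.
    have := Rmult_le_compat_l lam _ _ lam0 half; Lra.lra.
  by case: hh => [hh|->]; [apply/Rlt_le/exp_increasing | exact: Rle_refl].
by rewrite /l e0; Lra.lra.
Qed.
End Mixture.

Lemma exp_tail_cv0 c eta : (0 < c -> 0 < eta -> exists N : nat,
  forall n, (N <= n)%N -> exp (- (c * INR n)) <= eta)%Re.
Proof.
move=> c0 eta0; have ce := Rmult_lt_0_compat _ _ c0 eta0.
have [N hN] := INR_archimed (c * eta)%Re 1%Re ce.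
exists N => n hn; rewrite exp_Ropp; have hNn : (INR N <= INR n)%Re by apply: le_INR; apply/leP.
have h1 := exp_ineq1_le (c * INR n)%Re.
have h2 : (/ eta <= c * INR n)%Re.
  apply: (Rmult_le_reg_l eta) => //; rewrite Rinv_r; last by Lra.lra.
  have := Rmult_le_compat_l _ _ _ (Rlt_le _ _ ce) hNn; Lra.lra.
rewrite -[X in (_ <= X)%Re]Rinv_inv; apply: Rinv_le_contravar; last by Lra.lra.
exact: Rinv_0_lt_compat.
Qed.

(** [j n] is the largest [i <= n] with [N i <= n]. Any given J eventually competes in this maximum,
    and for [n >= N 0] the maximum is attained. *)
Lemma diagonal_index (N : nat -> nat) :
  exists j : nat -> nat, tends_to_infty j /\ forall n, (N 0 <= n)%N -> (N (j n) <= n)%N.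
Proof.
exists (fun n => \max_(i < n.+1 | (N i <= n)%N) i); split.
  move=> J; exists (maxn J (N J)) => n; rewrite geq_max => /andP[hJ hN].
  have lt : (J < n.+1)%N by [].
  exact: (@leq_bigmax_cond _ (fun i : 'I_n.+1 => (N i <= n)%N) (fun i => i : nat) (Ordinal lt)).
move=> n h0; have c0 : (0 < #|[pred i : 'I_n.+1 | (N i <= n)%N]|)%N.
  by apply/card_gt0P; exists ord0; rewrite inE.
by have [i hi ->] := eq_bigmax_cond (fun i : 'I_n.+1 => i : nat) c0.
Qed.

(** * Counting the components of a forest *)

Section Forest.
Variables (V F : finType) (U : {set V}) (nb : F -> {set V}).

(** The bipartite graph of G[U] with the set of constraints as a parameter, so that components can
    be counted while constraints are added one at a time. *)
Definition inA (A : {set F}) (v : V + F) : bool :=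
  match v with inl x => x \in U | inr a => a \in A end.
Definition adjA (A : {set F}) : rel (V + F) := fun v w =>
  inA A v && inA A w &&
  match v, w with
  | inl x, inr a => x \in nb a
  | inr a, inl x => x \in nb a
  | _, _ => false
  end.
Definition cyclic_in (A : {set F}) : Prop :=
  exists r, 2 <= r /\ exists (a : 'I_r -> F) (x : 'I_r -> V),
    injective a /\ injective x /\
    forall i, a i \in A /\ x i \in nb (a i) /\ x i \in nb (a (ordS i)).

Lemma adjA_sym A : symmetric (adjA A).
Proof. by move=> [x|a] [y|b]; rewrite /adjA; case: (inA _ _); case: (inA _ _). Qed.

Lemma connect_adjA_sym A : connect_sym (adjA A).
Proof. exact: sym_connect_sym (@adjA_sym A). Qed.

Lemma adjA_sub (A B : {set F}) : A \subset B -> subrel (adjA A) (adjA B).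
Proof.
by move=> /subsetP AB [x|a] [y|b] //=; rewrite /adjA /= => /andP[/andP[h1 h2] ->];
  rewrite ?h1 ?h2 ?(AB _ h1) ?(AB _ h2).
Qed.

Lemma connect_adjA_sub (A B : {set F}) v w : A \subset B -> connect (adjA A) v w -> connect (adjA B) v w.
Proof. by move=> AB; apply: connect_sub => x y /(adjA_sub AB); exact: connect1. Qed.

(** A component is represented by its variable nodes; [n_comp_cl] shows that nothing is lost when
    every constraint has a neighbour in U. *)
Definition cl A x : {set V} := [set y | connect (adjA A) (inl x) (inl y)].

Lemma cl_refl A x : x \in cl A x. Proof. by rewrite inE. Qed.

Lemma cl_eq A x y : y \in cl A x -> cl A x = cl A y.
Proof.
rewrite inE => c; apply/setP => z; rewrite !inE.
exact: (same_connect (@connect_adjA_sym A)).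
Qed.

Definition alt (bx : seq (F * V)) : seq (V + F) :=
  flatten [seq [:: inr p.1; inl p.2] | p <- bx].

(** The graph is bipartite, so a path between variable nodes is a list of pairs (constraint, next
    variable). The constraint [a] paired with the start is a dummy. *)
Lemma alt_path A x y p : path (adjA A) (inl x) p -> last (inl x) p = inl y ->
  exists bx : seq (F * V), p = alt bx /\
    forall a, path (fun u v : F * V => [&& v.1 \in A, u.2 \in nb v.1 & v.2 \in nb v.1]) (a, x) bx.
Proof.
have [k] := ubnP (size p); elim: k p x => // k IH [|[z|b] p] x //=.
- by move=> _ _ _; exists [::].
- by rewrite /adjA /= andbF.
case: p => [|[z|c] p] //= sz; last first.
  by rewrite {2}/adjA /= andbF /= andbF.
case/and3P => e1 e2 pth lst.
have [|bx [-> h]] := IH p z _ pth lst; first by lia.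
exists ((b, z) :: bx); split=> // a /=; rewrite (h b) andbT.
by move: e1 e2; rewrite /adjA /= => /andP[/andP[_ ->] ->] /andP[_ ->].
Qed.

Lemma alt_unzip2 bx : subseq (map inl (unzip2 bx)) (alt bx).
Proof.
elim: bx => // p bx IH; apply: (@subseq_trans _ (inl p.2 :: alt bx)).
  by rewrite /= eqxx.
exact: subseq_cons.
Qed.

Lemma alt_unzip1 bx : subseq (map inr (unzip1 bx)) (alt bx).
Proof.
elim: bx => // p bx IH; rewrite /alt /= eqxx.
exact: subseq_trans IH (subseq_cons _ _).
Qed.

(** A simple path from x to x' closes up through the new constraint. Appending [a] to its
    constraints and [x] to its variables makes the indices match the cyclic shift; as x and x'
    differ, the path contains a constraint, so the cycle has length at least 2. *)
Lemma connect_cycle (A : {set F}) a x x' : a \notin A -> x != x' -> x \in nb a -> x' \in nb a ->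
  connect (adjA A) (inl x) (inl x') -> cyclic_in (a |: A).
Proof.
move=> aA xx' xa x'a /connectP[p0 pth0].
case/shortenP: pth0 => p pth upx _ lst0.
have [bx [pE hp]] := alt_path pth (esym lst0); move: (hp a) => {}hp.
have u2 : uniq (rcons (unzip2 bx) x).
  move: upx; rewrite pE => /= /andP[xn uq]; rewrite rcons_uniq.
  have := alt_unzip2 bx => sb; apply/andP; split.
    apply: contra xn => h; apply: (mem_subseq sb).
    by rewrite (mem_map (fun u v : V => @inl_inj _ _ u v)).
  rewrite -(map_inj_uniq (fun u v : V => @inl_inj V F u v)); exact: subseq_uniq sb uq.
have bA b : b \in unzip1 bx -> b \in A.
  have gen (c : seq (F * V)) q : path (fun u v : F * V =>
     [&& v.1 \in A, u.2 \in nb v.1 & v.2 \in nb v.1]) q c -> b \in unzip1 c -> b \in A.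
    elim: c q => //= q' c IH q /andP[/and3P[qA _ _] h].
    by rewrite inE => /orP[/eqP->|hb] //; exact: IH h hb.
  exact: gen hp.
have u1 : uniq (rcons (unzip1 bx) a).
  rewrite rcons_uniq; apply/andP; split; first by apply: contra aA; exact: bA.
  move: upx; rewrite pE => /= /andP[_ uq].
  rewrite -(map_inj_uniq (fun u v : F => @inr_inj V F u v)).
  exact: subseq_uniq (alt_unzip1 bx) uq.
have lstE : last x (unzip2 bx) = x'.
  move: lst0; rewrite pE => /esym; clear; elim: bx x => [|q bx IH] x /=; first by case.
  exact: IH.
have sz0 : 0 < size bx.
  by case: bx lstE {pE u2 u1 bA hp} => //= e; rewrite e eqxx in xx'.
set t := size bx; have s1 : size (rcons (unzip1 bx) a) = t.+1 by rewrite size_rcons size_map.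
have s2 : size (rcons (unzip2 bx) x) = t.+1 by rewrite size_rcons size_map.
exists t.+1; split; first by rewrite ltnS.
exists (fun i : 'I_t.+1 => nth a (rcons (unzip1 bx) a) i).
exists (fun i : 'I_t.+1 => nth x (rcons (unzip2 bx) x) i).
split; [|split].
- by move=> i j /eqP; rewrite nth_uniq ?s1 // => /eqP/val_inj.
- by move=> i j /eqP; rewrite nth_uniq ?s2 // => /eqP/val_inj.
have step j : j < t -> [/\ nth a (unzip1 bx) j \in A,
    nth x (x :: unzip2 bx) j \in nb (nth a (unzip1 bx) j) &
    nth x (unzip2 bx) j \in nb (nth a (unzip1 bx) j)].
  move=> jt; move/(pathP (a, x)): hp => /(_ j jt) /and3P[h1 h2 h3].
  rewrite !(nth_map (a, x)) //; split=> //.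
  case: j jt h2 {h1 h3} => [|j] jt //=; rewrite (nth_map (a, x)) //; exact: ltnW.
move=> i; rewrite !nth_rcons !size_map -/t.
have [it|it] := ltnP i t; last first.
  have it' : i = t :> nat by apply/eqP; rewrite eqn_leq it -ltnS ltn_ord.
  rewrite it' eqxx setU11; split=> //; split=> //=; rewrite it' modnn sz0.
  by have [_ + _] := step 0 sz0.
have [h1 h2 h3] := step _ it; rewrite setU1r //; split=> //; split=> //.
rewrite /= modn_small //; have [it'|it'] := ltnP i.+1 t.
  by have [_ + _] := step _ it'.
have -> : i.+1 == t by rewrite eqn_leq it.
move: lstE; rewrite (last_nth x) size_map -/t.
have tE : t = i.+1 by apply/eqP; rewrite eqn_leq it it'.
by rewrite [nth _ _ t](congr1 (nth x (x :: unzip2 bx)) tE) /= => ->.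
Qed.

(** A path of the larger graph is followed edge by edge: the predicate [D], which extends the
    right-hand side to constraint nodes, is preserved by every edge, including those at [a]. *)
Lemma cl_setU1 (A : {set F}) a : nb a \subset U -> forall y z,
  (z \in cl (a |: A) y) = (z \in cl A y) ||
     [exists x in nb a, exists x' in nb a, (x \in cl A y) && (z \in cl A x')].
Proof.
move=> aU y z; have sub : A \subset a |: A by apply: subsetUr.
apply/idP/orP; last first.
  case; first by rewrite !inE; exact: connect_adjA_sub.
  case/exists_inP => x xa /exists_inP[x' xa' /andP[h h']].
  move: h h'; rewrite !inE => h h'.
  apply: connect_trans (connect_adjA_sub sub h) _.
  apply: connect_trans _ (connect_adjA_sub sub h').
  have e1 : adjA (a |: A) (inl x) (inr a) by rewrite /adjA /= setU11 (subsetP aU _ xa) xa.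
  have e2 : adjA (a |: A) (inr a) (inl x') by rewrite /adjA /= setU11 (subsetP aU _ xa') xa'.
  exact: connect_trans (connect1 e1) (connect1 e2).
pose Q z := (z \in cl A y) \/
     [exists x in nb a, exists x' in nb a, (x \in cl A y) && (z \in cl A x')].
pose D (v : V + F) := match v with inl z => Q z | inr b =>
   (exists x, [/\ x \in nb b, x \in U & Q x]) /\ b \in a |: A end.
have Dstep v w : adjA (a |: A) v w -> D v -> D w.
  case: v w => [x|b] [x'|b'] //=; rewrite /adjA /= ?andbF //.
    by case/andP => /andP[xU hb] hx q; split=> //; exists x; split.
  case/andP => /andP[_ x'U] x'b [[x [xb xU Qx]]].
  rewrite !inE => /orP[/eqP e|bA].
    rewrite e in xb x'b; right.
    case: Qx => [h|/exists_inP[u ua /exists_inP[u' u'a /andP[h _]]]];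
      [apply/exists_inP; exists x => //|apply/exists_inP; exists u => //];
      by apply/exists_inP; exists x' => //; rewrite h cl_refl.
  have c : x \in U -> connect (adjA A) (inl x) (inl x').
    move=> _; have e1 : adjA A (inl x) (inr b) by rewrite /adjA /= bA xU xb.
    have e2 : adjA A (inr b) (inl x') by rewrite /adjA /= bA x'U x'b.
    exact: connect_trans (connect1 e1) (connect1 e2).
  case: Qx => [h|/exists_inP[u ua /exists_inP[u' u'a /andP[h1 h2]]]].
    by left; move: h; rewrite !inE => /connect_trans; apply; exact: c.
  right; apply/exists_inP; exists u => //; apply/exists_inP; exists u' => //.
  by rewrite h1 /=; move: h2; rewrite !inE => /connect_trans; apply; exact: c.
rewrite inE => /connectP[p pth lst].
have : D (inl y) by left; rewrite cl_refl.
have: D (inl y) -> D (last (inl y) p).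
  elim: p (inl y : V + F) pth {lst} => //= w p IH v /andP[e pth] Dv.
  by apply: IH => //; exact: Dstep e Dv.
by rewrite -lst => h /h.
Qed.

Lemma cyclic_in_sub (A B : {set F}) : A \subset B -> cyclic_in A -> cyclic_in B.
Proof.
move=> /subsetP AB [r [r2 [a [x [ai [xi h]]]]]]; exists r; split=> //.
by exists a, x; do 2!split=> //; move=> i; have [/AB ? ?] := h i.
Qed.

(** By acyclicity the neighbours of [a] lie in distinct components, and [a] merges exactly these
    into one. *)
Lemma card_cl_setU1 (A : {set F}) a : nb a \subset U -> nb a != set0 -> a \notin A ->
  ~ cyclic_in (a |: A) ->
  #|cl (a |: A) @: U| + #|nb a| = #|cl A @: U| + 1.
Proof.
move=> aU a0 aA acyc; have /set0Pn[x0 x0a] := a0.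
have inj : {in nb a &, injective (cl A)}.
  move=> x x' xa x'a e; apply/eqP/negPn/negP => ne; apply: acyc.
  apply: (connect_cycle aA ne xa x'a); have := cl_refl A x'.
  by rewrite -e inE.
set B := cl (a |: A) x0.
have imU : cl A @: nb a \subset cl A @: U by apply: imsetS.
have P' : cl (a |: A) @: U = B |: ((cl A @: U) :\: (cl A @: nb a)).
  have hit y x : x \in nb a -> x \in cl A y -> cl (a |: A) y = B.
    move=> xa xy; apply: cl_eq; rewrite cl_setU1 //; apply/orP; right.
    apply/exists_inP; exists x => //; apply/exists_inP; exists x0 => //.
    by rewrite xy cl_refl.
  have miss y : (forall x, x \in nb a -> x \notin cl A y) -> cl (a |: A) y = cl A y.
    move=> h; apply/setP => z; rewrite cl_setU1 //; case: (z \in cl A y); rewrite ?orTb // orFb.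
    by apply/negbTE/negP => /exists_inP[x xa /exists_inP[x' _ /andP[]]]; rewrite (negbTE (h x xa)).
  apply/setP => S; apply/imsetP/idP.
    case=> y yU ->; have [/exists_inP[x xa xy]|] := boolP [exists x in nb a, x \in cl A y].
      by rewrite (hit y x) // setU11.
    rewrite negb_exists_in => /forall_inP h; rewrite miss //.
    apply/setU1P; right; rewrite in_setD (imset_f (cl A) yU) andbT.
    apply/imsetP => -[x xa e]; have := h x xa; rewrite e cl_refl //.
  rewrite inE => /orP[/set1P ->|]; first by exists x0 => //; exact: (subsetP aU).
  rewrite in_setD => /andP[nS /imsetP[y yU e]]; exists y => //.
  rewrite e miss // => x xa; apply: contra nS => xy.
  by rewrite e (cl_eq xy); apply: imset_f.
have Bn : B \notin (cl A @: U) :\: (cl A @: nb a).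
  rewrite in_setD negb_and negbK.
  have [/imsetP[y yU e]|h] := boolP (B \in cl A @: U); last by rewrite orbT.
  apply/orP; left; rewrite e (@cl_eq _ y x0) ?imset_f //.
  by rewrite -e cl_refl.
rewrite P' cardsU1 Bn -(cardsID (cl A @: nb a) (cl A @: U)) (setIidPr imU).
rewrite card_in_imset //; lia.
Qed.

(** Euler's formula for forests, by induction on the constraints: each one lowers the number of
    components by the size of its neighbourhood minus one. *)
Lemma forest (A : {set F}) :
  (forall a, a \in A -> nb a \subset U) -> (forall a, a \in A -> nb a != set0) ->
  ~ cyclic_in A -> #|cl A @: U| + \sum_(a in A) (#|nb a| - 1) = #|U|.
Proof.
have [k] := ubnP #|A|; elim: k A => // k IH A sz hU h0 acyc.
have [A0|/set0Pn[a aA]] := eqVneq A set0.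
  rewrite A0 big_set0 addn0 card_in_imset // => x y xU yU e.
  have := cl_refl set0 y; rewrite -e inE => /connectP[[|[z|b] p] /=].
  - by move=> _ [].
  - by rewrite /adjA /= andbF.
  - by rewrite /adjA /= inE !andbF.
have sub : A :\ a \subset A := subsetDl _ _.
have := IH (A :\ a); rewrite (cardsD1 a A) aA in sz; move/(_ sz).
move=> /(_ (fun b hb => hU b (subsetP sub b hb)) (fun b hb => h0 b (subsetP sub b hb))).
move=> /(_ (fun c => acyc (cyclic_in_sub sub c))) {}IH.
have := card_cl_setU1 (A := A :\ a) (hU a aA) (h0 a aA).
rewrite setD1K // setD11 => /(_ isT acyc) st.
rewrite (big_setD1 a aA) /=; have : 0 < #|nb a| by rewrite card_gt0 h0.
by move=> pos; rewrite -IH addnA addnBA // st addnK.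
Qed.

(** [n_comp] counts canonical roots, which may be constraint nodes; every component contains a
    variable node, so the roots correspond to the classes [cl]. *)
Lemma n_comp_cl (A : {set F}) :
  (forall a, a \in A -> nb a \subset U) -> (forall a, a \in A -> nb a != set0) ->
  n_comp (adjA A) (inA A) = #|cl A @: U|.
Proof.
move=> hU h0; have csym := connect_adjA_sym A.
pose g v := [set y | connect (adjA A) v (inl y)].
pose rts := [set v | (v \in roots (adjA A)) && inA A v].
have -> : n_comp (adjA A) (inA A) = #|rts|.
  by rewrite /n_comp_mem cardsE; apply: eq_card => v; rewrite !inE.
have inAc v w : connect (adjA A) v w -> inA A v -> inA A w.
  move=> /connectP[p + ->]; elim: p v => //= u p IH v /andP[e pth] hv.
  by apply: IH => //; case/andP: e => /andP[].
have hit v : inA A v -> exists2 y, y \in U & connect (adjA A) v (inl y).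
  case: v => [x|a] /= h; first by exists x.
  have /set0Pn[x xa] := h0 a h; have xU := subsetP (hU a h) x xa.
  by exists x => //; apply: connect1; rewrite /adjA /= h xU.
have -> : cl A @: U = g @: rts.
  apply/setP => S; apply/imsetP/imsetP.
    case=> x xU ->; exists (fingraph.root (adjA A) (inl x)).
      rewrite inE; apply/andP; split; first exact: roots_root.
      apply: (inAc (inl x)) => //; exact: connect_root.
    by apply/setP => z; rewrite !inE (same_connect csym (connect_root _ _)).
  case=> v; rewrite inE => /andP[rv /hit[y yU c]] ->; exists y => //.
  by apply/setP => z; rewrite !inE (same_connect csym c).
rewrite card_in_imset // => v w; rewrite !inE => /andP[/eqP rv hv] /andP[/eqP rw hw] e.
have [y yU c] := hit v hv; have : y \in g w by rewrite -e inE.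
rewrite inE => c'; rewrite -rv -rw; apply/eqP; rewrite root_connect //.
by apply: connect_trans c _; rewrite csym.
Qed.
End Forest.

Import Order.TTheory GRing.Theory Num.Theory.
Local Open Scope ring_scope.
Local Notation R := Rdefinitions.R.
Bind Scope ring_scope with R.

(** * Conditional expectations and pinning *)

Lemma eq_ler (R : numDomainType) (x y : R) : x = y -> x <= y. Proof. by move=> ->. Qed.

Section CondExp.
Variables (R : realFieldType) (C : finType) (nu : C -> R).
Hypothesis nu_gt0 : forall s, 0 < nu s.

(* Conditional expectation given ka, for the unnormalised weight nu. *)
Definition ce (K : eqType) (ka : C -> K) (f : C -> R) (s : C) : R :=
  (\sum_(s' | ka s' == ka s) nu s' * f s') / (\sum_(s' | ka s' == ka s) nu s').

Section OneMap.
Variables (K : eqType) (ka : C -> K).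

Lemma class_gt0 s : 0 < \sum_(s' | ka s' == ka s) nu s'.
Proof.
rewrite (bigD1 s) //= ltr_pwDl //; apply: sumr_ge0 => i _; exact: ltW.
Qed.

Lemma ce_meas f s s' : ka s = ka s' -> ce ka f s = ce ka f s'.
Proof. by move=> e; rewrite /ce e. Qed.

Lemma ceD f g s : ce ka (fun x => f x + g x) s = ce ka f s + ce ka g s.
Proof.
by rewrite /ce -mulrDl -big_split /=; congr (_ / _); apply: eq_bigr => i _; rewrite mulrDr.
Qed.

Lemma ceN f s : ce ka (fun x => - f x) s = - ce ka f s.
Proof.
by rewrite /ce -mulNr -sumrN; congr (_ / _); apply: eq_bigr => i _; rewrite mulrN.
Qed.

Lemma ce_mulr_meas f g s : (forall x, ka x = ka s -> g x = g s) ->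
  ce ka (fun x => f x * g x) s = ce ka f s * g s.
Proof.
move=> gs; rewrite /ce mulrAC; congr (_ / _); rewrite mulr_suml.
by apply: eq_bigr => i /eqP /gs ->; rewrite mulrA.
Qed.

Lemma ce_le f g s : (forall x, ka x = ka s -> f x <= g x) -> ce ka f s <= ce ka g s.
Proof.
move=> fg; rewrite /ce ler_pM2r ?invr_gt0 ?class_gt0 //.
by apply: ler_sum => i /eqP /fg h; rewrite ler_pM2l.
Qed.

Lemma ce_cst c s : ce ka (fun=> c) s = c.
Proof. by rewrite /ce -mulr_suml mulrAC divff ?mul1r // gt_eqF // class_gt0. Qed.

Lemma ce_eq f g s : (forall x, ka x = ka s -> f x = g x) -> ce ka f s = ce ka g s.
Proof. by move=> fg; rewrite /ce; congr (_ / _); apply: eq_bigr => i /eqP /fg ->. Qed.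

Lemma ce_norm f s : `|ce ka f s| <= ce ka (fun x => `|f x|) s.
Proof.
rewrite ler_norml -ceN; apply/andP; split; apply: ce_le => x _;
  by [rewrite lerNl ler_normr lexx orbT | rewrite ler_normr lexx].
Qed.

(** [ce ka] is the orthogonal projection onto the functions of [ka]: exchange the two sums over
    pairs in a common class. *)
Lemma ce_tower f g : (forall s s', ka s = ka s' -> g s = g s') ->
  \sum_s nu s * (ce ka f s * g s) = \sum_s nu s * (f s * g s).
Proof.
move=> gm.
transitivity (\sum_s \sum_(s' | ka s' == ka s) nu s' * f s' * (nu s * g s')
   / (\sum_(s'' | ka s'' == ka s') nu s'')).
  apply: eq_bigr => s _; rewrite /ce.
  transitivity (\sum_(s' | ka s' == ka s) nu s' * f s' * (nu s * g s)
     / (\sum_(s'' | ka s'' == ka s) nu s'')).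
    rewrite -2!mulr_suml; ring.
  by apply: eq_bigr => s' /eqP e; rewrite e (gm _ _ e).
rewrite (exchange_big_dep predT) //=; apply: eq_bigr => s' _.
rewrite -mulr_suml -mulr_sumr -mulr_suml.
under [X in _ * (X * _)]eq_bigl do rewrite eq_sym.
have := class_gt0 s'; set Z := \sum_(_ | _) _ => /lt0r_neq0 Z0.
by field.
Qed.

End OneMap.

(** The tower property within one class of [ka]: the indicator of this class is a function of the
    finer map and can be absorbed into [g]. *)
Lemma ce_tower_class (K K' : eqType) (ka : C -> K) (ka' : C -> K') f g s :
  (forall x y, ka' x = ka' y -> ka x = ka y) ->
  (forall x y, ka' x = ka' y -> g x = g y) ->
  ce ka (fun x => ce ka' f x * g x) s = ce ka (fun x => f x * g x) s.
Proof.
move=> ref gm; rewrite /ce; congr (_ / _).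
have := @ce_tower _ ka' f (fun x => (ka x == ka s)%:R * g x).
have gm' x y : ka' x = ka' y -> (ka x == ka s)%:R * g x = (ka y == ka s)%:R * g y.
  by move=> e; rewrite (gm _ _ e) (ref _ _ e).
move=> /(_ gm') h; rewrite big_mkcond [RHS]big_mkcond /=; etransitivity; last (etransitivity; first exact: h).
  apply: eq_bigr => x _; case: ifP; rewrite ?mul1r ?mul0r ?mulr0 //.
by apply: eq_bigr => x _; case: ifP; rewrite ?mul1r ?mul0r ?mulr0.
Qed.

(** A martingale increment is orthogonal to the coarser projection, so its mean square is a
    difference of energies. *)
Lemma pythagoras (K K' : eqType) (ka : C -> K) (ka' : C -> K') f :
  (forall x y, ka' x = ka' y -> ka x = ka y) ->
  \sum_s nu s * (ce ka' f s - ce ka f s) ^+ 2 =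
  \sum_s nu s * ce ka' f s ^+ 2 - \sum_s nu s * ce ka f s ^+ 2.
Proof.
move=> ref.
have h1 : \sum_s nu s * (ce ka' f s * ce ka f s) = \sum_s nu s * (f s * ce ka f s).
  by apply: ce_tower => x y /ref; exact: ce_meas.
have h2 : \sum_s nu s * (ce ka f s * ce ka f s) = \sum_s nu s * (f s * ce ka f s).
  by apply: ce_tower => x y; exact: ce_meas.
transitivity (\sum_s nu s * ce ka' f s ^+ 2 + \sum_s nu s * ce ka f s ^+ 2
   - (\sum_s nu s * (ce ka' f s * ce ka f s)) *+ 2).
  rewrite -sumrMnl -sumrN -!big_split /=; apply: eq_bigr => s _; ring.
rewrite h1 -h2; under [\sum_s _ * (ce ka f _ * _)]eq_bigr do rewrite -expr2.
ring.
Qed.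

Lemma ce_sum (K : eqType) (ka : C -> K) f :
  \sum_s nu s * ce ka f s = \sum_s nu s * f s.
Proof.
have := @ce_tower _ ka f (fun=> 1) (fun _ _ _ => erefl).
by under eq_bigr do rewrite mulr1; under [in RHS]eq_bigr do rewrite mulr1.
Qed.

(* |X| <= (eta + X^2/eta)/2 replaces Cauchy-Schwarz. *)
Lemma ce_l1 (K K' : eqType) (ka : C -> K) (ka' : C -> K') f (eta : R) : 0 < eta ->
  (forall x y, ka' x = ka' y -> ka x = ka y) ->
  \sum_s nu s * ce ka (fun x => `|ce ka' f x - ce ka f x|) s <=
  (\sum_s nu s) * eta +
  (\sum_s nu s * ce ka' f s ^+ 2 - \sum_s nu s * ce ka f s ^+ 2) / eta.
Proof.
move=> eta0 ref; rewrite ce_sum -(pythagoras f ref) !mulr_suml -big_split /=.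
apply: ler_sum => s _; rewrite -mulrA -mulrDr ler_pM2l //.
set X := _ - _; have [|h] := lerP `|X| eta.
  move/le_trans; apply; rewrite lerDl divr_ge0 ?sqr_ge0 //; exact: ltW.
rewrite -[`|X|]add0r lerD //; first exact: ltW.
by rewrite ler_pdivlMr // -real_normK ?num_real // expr2 ler_wpM2l // ltW.
Qed.

End CondExp.

(** * Averages over random lists of vertices *)

Section ListAverage.
Variables (R : realFieldType) (V : finType) (A : {set V}).
Hypothesis A0 : A != set0.

(* Average of Phi over the lists of length q with entries in A. *)
Fixpoint avgl (q : nat) (Phi : seq V -> R) : R :=
  if q is q'.+1 then #|A|%:R^-1 * \sum_(a in A) avgl q' (fun l => Phi (a :: l))
  else Phi [::].

Lemma eq_avgl q Phi Psi : (forall l, size l = q -> Phi l = Psi l) -> avgl q Phi = avgl q Psi.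
Proof.
elim: q Phi Psi => [|q IH] Phi Psi e /=; first exact: e.
by congr (_ * _); apply: eq_bigr => a _; apply: IH => l sl; apply: e; rewrite /= sl.
Qed.

Lemma cardA_gt0 : 0 < #|A|%:R :> R.
Proof. by rewrite ltr0n card_gt0. Qed.

Lemma avgl_le q Phi Psi :
  (forall l, size l = q -> all (mem A) l -> Phi l <= Psi l) -> avgl q Phi <= avgl q Psi.
Proof.
elim: q Phi Psi => [|q IH] Phi Psi e /=; first exact: e.
rewrite ler_pM2l ?invr_gt0 ?cardA_gt0 //; apply: ler_sum => a aA.
by apply: IH => l sl lA; apply: e; rewrite /= ?sl ?aA.
Qed.

Lemma avgl_cst q c : avgl q (fun=> c) = c.
Proof.
elim: q => //= q IH; under eq_bigr do rewrite IH.
by rewrite sumr_const -[c *+ _]mulr_natr mulrCA mulVf ?mulr1 // gt_eqF // cardA_gt0.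
Qed.

Lemma avglD q Phi Psi : avgl q (fun l => Phi l + Psi l) = avgl q Phi + avgl q Psi.
Proof.
elim: q Phi Psi => //= q IH Phi Psi.
by rewrite -mulrDr -big_split /=; congr (_ * _); apply: eq_bigr => a _; rewrite IH.
Qed.

Lemma avglZ q c Phi : avgl q (fun l => c * Phi l) = c * avgl q Phi.
Proof.
elim: q Phi => //= q IH Phi; rewrite mulrCA [c * _]mulr_sumr; congr (_ * _).
by apply: eq_bigr => a _; rewrite IH.
Qed.

Lemma avgl_sum (J : Type) (r : seq J) (P : pred J) q (Phi : J -> seq V -> R) :
  avgl q (fun l => \sum_(j <- r | P j) Phi j l) = \sum_(j <- r | P j) avgl q (Phi j).
Proof.
elim: q Phi => //= q IH Phi; rewrite -mulr_sumr exchange_big /=; congr (_ * _).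
by apply: eq_bigr => a _; rewrite IH.
Qed.

Lemma avgl_cat p q Phi :
  avgl (p + q) Phi = avgl p (fun l => avgl q (fun l' => Phi (l ++ l'))).
Proof. by elim: p Phi => //= p IH Phi; congr (_ * _); apply: eq_bigr => a _; rewrite IH. Qed.

Lemma avgl_ex q Phi c : avgl q Phi <= c -> exists2 l, size l = q & Phi l <= c.
Proof.
elim: q Phi => [|q IH] Phi /= h; first by exists [::].
have [a aA ha] : exists2 a, a \in A & avgl q (fun l => Phi (a :: l)) <= c.
  apply/exists_inP; apply: contraTT h; rewrite negb_exists_in => /forall_inP h.
  rewrite -ltNge mulrC ltr_pdivlMr ?cardA_gt0 // mulr_natr -sumr_const.
  case/set0Pn: A0 => a aA; rewrite (bigD1 a) //= [X in _ < X](bigD1 a) //=.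
  rewrite ltr_leD //; first by rewrite ltNge h.
  by apply: ler_sum => b /andP[bA _]; rewrite ltW // ltNge h.
by have [l <- hl] := IH _ ha; exists (a :: l).
Qed.

End ListAverage.

(** A union bound over the q entries: a list drawn from all of V meets U with probability at most q
    |U| / |V|, and then [Phi] is at most [c]. *)
Lemma avgl_avoid (R : realFieldType) (V : finType) (U : {set V}) (c : R) q (Phi : seq V -> R) :
  ~: U != set0 -> (forall l, 0 <= Phi l <= c) ->
  avgl [set: V] q Phi <= avgl (~: U) q Phi + q%:R * c * #|U|%:R / #|V|%:R.
Proof.
move=> U0; have V0 : 0 < #|V|%:R :> R.
  by case/set0Pn: U0 => x _; rewrite ltr0n; apply/card_gt0P; exists x.
have A0 := cardA_gt0 R U0.
elim: q Phi => [|q IH] Phi h /=; first by rewrite !mul0r addr0.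
have c0 : 0 <= c by have /andP[a b] := h [::]; apply: le_trans a b.
have Tn0 : [set: V] != set0.
  by case/set0Pn: U0 => x _; apply/set0Pn; exists x; rewrite inE.
have ge0 (B : {set V}) p (Psi : seq V -> R) : B != set0 -> (forall l, 0 <= Psi l) ->
    0 <= avgl B p Psi.
  by move=> B0 hp; rewrite -(avgl_cst B0 p (0 : R)); apply: avgl_le.
have lec (B : {set V}) p (Psi : seq V -> R) : B != set0 -> (forall l, Psi l <= c) ->
    avgl B p Psi <= c.
  by move=> B0 hp; rewrite -[leRHS](avgl_cst B0 p c); apply: avgl_le.
rewrite (bigID (mem U)) /= cardsT mulrDr addrC.
have -> : \sum_(i | (i \in [set: V]) && (i \notin U)) avgl [set: V] q (fun l => Phi (i :: l))
  = \sum_(i in ~: U) avgl [set: V] q (fun l => Phi (i :: l)).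
  by apply: eq_bigl => i; rewrite !inE.
have b1 : \sum_(i in ~: U) avgl [set: V] q (fun l => Phi (i :: l)) <=
   \sum_(i in ~: U) avgl (~: U) q (fun l => Phi (i :: l)) +
   #|V|%:R * (q%:R * c * #|U|%:R / #|V|%:R).
  apply: (@le_trans _ _ (\sum_(i in ~: U) (avgl (~: U) q (fun l => Phi (i :: l)) +
    q%:R * c * #|U|%:R / #|V|%:R))).
    by apply: ler_sum => i _; apply: IH.
  rewrite big_split /= lerD2l sumr_const -[leLHS]mulr_natl ler_wpM2r ?ler_nat ?max_card //.
  by rewrite divr_ge0 ?mulr_ge0 // ltW.
have b2 : \sum_(i | (i \in [set: V]) && (i \in U)) avgl [set: V] q (fun l => Phi (i :: l))
   <= #|U|%:R * c.
  rewrite (eq_bigl (mem U)); last by move=> i; rewrite !inE.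
  rewrite mulr_natl -sumr_const; apply: ler_sum => i _.
  by apply: lec => // l; case/andP: (h (i :: l)).
have Vi : 0 < #|V|%:R^-1 :> R by rewrite invr_gt0.
have s0 : 0 <= \sum_(i in ~: U) avgl (~: U) q (fun l => Phi (i :: l)).
  by apply: sumr_ge0 => i _; apply: ge0 => // l; case/andP: (h (i :: l)).
apply: (@le_trans _ _ (#|V|%:R^-1 * (\sum_(i in ~: U) avgl (~: U) q (fun l => Phi (i :: l)) +
   #|V|%:R * (q%:R * c * #|U|%:R / #|V|%:R)) + #|V|%:R^-1 * (#|U|%:R * c))).
  by rewrite lerD // ler_pM2l.
rewrite mulrDr mulKf ?gt_eqF // -addrA lerD //.
  by rewrite ler_wpM2r // lef_pV2 ?posrE // ler_nat max_card.
by rewrite -[q.+1]addn1 natrD; lra.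
Qed.

(** The lag-q difference is a sum of q lag-one differences, each of which telescopes over t. The
    bound does not grow with Th, so the average over t < Th is O(q / Th). *)
Lemma pinning_telescope (R : realFieldType) (H : nat -> R) (M : R) (Th q : nat) :
  (forall t, 0 <= H t <= M) -> \sum_(t < Th) (H (t + q)%N - H t) <= q%:R * M.
Proof.
move=> hH; elim: q => [|q IH].
  by rewrite mul0r big1 // => t _; rewrite addn0 subrr.
have -> : \sum_(t < Th) (H (t + q.+1)%N - H t) =
  \sum_(t < Th) (H (t + q)%N - H t) + \sum_(t < Th) (H (t.+1 + q)%N - H (t + q)%N).
  by rewrite -big_split /=; apply: eq_bigr => t _; rewrite addnS addSn; ring.
rewrite -[q.+1]addn1 natrD mulrDl mul1r lerD //.
rewrite -(big_mkord predT (fun t => H (t.+1 + q)%N - H (t + q)%N)).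
rewrite (telescope_sumr (fun t => H (t + q)%N)) //.
by have /andP[_ a] := hH (Th + q)%N; have /andP[b _] := hH (0 + q)%N; lra.
Qed.

(** Used as a conditioning map: [ce nu (mp T)] is the conditional expectation given the spins along
    [T]. *)
Definition mp (V Omega : finType) (T : seq V) (s : {ffun V -> Omega}) : seq Omega := map s T.

Lemma mp_catl (V Omega : finType) (T W : seq V) (s s' : {ffun V -> Omega}) :
  mp (T ++ W) s = mp (T ++ W) s' -> mp T s = mp T s'.
Proof.
by rewrite /mp !map_cat => /(congr1 (take (size T))); rewrite !take_size_cat ?size_map.
Qed.

(* The energies [\sum_s nu s * ce nu (mp T) f s ^+ 2] increase with the list of
   pinned vertices and are bounded, so on average over the length t of T they
   hardly change when T is extended by W. *)
Lemma pinning (R : realFieldType) (V Omega : finType) (A : {set V})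
    (nu : {ffun V -> Omega} -> R) f (M eta : R) (Th q : nat) :
  A != set0 -> (forall s, 0 < nu s) -> (forall s, `|f s| <= M) -> 0 < eta ->
  \sum_(t < Th) avgl A t (fun T => avgl A q (fun W => \sum_s nu s *
      ce nu (mp T) (fun x => `|ce nu (mp (T ++ W)) f x - ce nu (mp T) f x|) s)) <=
  (\sum_s nu s) * (Th%:R * eta + q%:R * M ^+ 2 / eta).
Proof.
move=> A0 nu0 fM eta0; set Z := \sum_s nu s.
pose S2 T := \sum_s nu s * ce nu (mp T) f s ^+ 2.
pose H t := avgl A t S2.
have S2b T : 0 <= S2 T <= Z * M ^+ 2.
  apply/andP; split; first by apply: sumr_ge0 => s _; rewrite mulr_ge0 ?sqr_ge0 // ltW.
  rewrite mulr_suml; apply: ler_sum => s _; rewrite ler_pM2l //.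
  rewrite -real_normK ?num_real // lerXn2r ?nnegrE //.
    by apply: le_trans (fM s).
  apply: le_trans (ce_norm _ _ _ _) _ => //.
  by rewrite -[leRHS](ce_cst nu0 (mp T) M s); apply: ce_le.
have Hb t : 0 <= H t <= Z * M ^+ 2.
  rewrite -{1}(avgl_cst A0 t (0 : R)) -(avgl_cst A0 t (Z * M ^+ 2)).
  by apply/andP; split; apply: avgl_le => // l _ _; case/andP: (S2b l).
apply: (@le_trans _ _ (\sum_(t < Th) (Z * eta + eta^-1 * (H (t + q)%N - H t)))).
  apply: ler_sum => t _.
  have -> : Z * eta + eta^-1 * (H (t + q)%N - H t) = avgl A t (fun T => avgl A q (fun W =>
      (Z * eta + - eta^-1 * S2 T) + eta^-1 * S2 (T ++ W))).
    under [RHS]eq_avgl do rewrite avglD // avglZ // avgl_cst //.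
    rewrite !avglD // !avglZ // avgl_cst // -avgl_cat /H; ring.
  apply: avgl_le => // T _ _; apply: avgl_le => // W _ _.
  apply: le_trans (ce_l1 nu0 f eta0 (@mp_catl _ _ T W)) _.
  by rewrite -/Z -/(S2 T) -/(S2 (T ++ W)) mulrC; lra.
rewrite big_split /= sumr_const card_ord -mulr_sumr.
have := pinning_telescope Th q Hb => h.
have : eta^-1 * \sum_(t < Th) (H (t + q)%N - H t) <= eta^-1 * (q%:R * (Z * M ^+ 2)).
  by rewrite ler_pM2l ?invr_gt0.
rewrite -[Z * eta *+ Th]mulr_natr; lra.
Qed.

(** * The random factor graph *)

Lemma pbP (Q : Prop) : reflect Q (pb Q).
Proof. by rewrite /pb; case: ClassicalEpsilon.excluded_middle_informative => h; constructor. Qed.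

Lemma sum_tuple_prod (T : finType) (k : nat) (g : 'I_k -> T -> R) :
  \sum_(t : k.-tuple T) \prod_(p < k) g p (tnth t p) = \prod_(p < k) \sum_x g p x.
Proof.
rewrite bigA_distr_bigA /= (reindex (fun f : {ffun 'I_k -> T} => [tuple f p | p < k])) /=.
  by apply: eq_bigr => f _; apply: eq_bigr => p _; rewrite tnth_mktuple.
exists (fun t : k.-tuple T => [ffun p => tnth t p]) => [f _|t _].
  by apply/ffunP => p; rewrite ffunE tnth_mktuple.
by apply: eq_from_tnth => p; rewrite tnth_mktuple ffunE.
Qed.

Lemma sum_indic (T : finType) (Q : pred T) : \sum_x (Q x)%:R = #|Q|%:R :> R.
Proof. by rewrite -sum1_card natr_sum [RHS]big_mkcond /=; apply: eq_bigr => x _; rewrite unfold_in; case: (Q x). Qed.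

Lemma prod_indic (T : finType) (A Q : pred T) :
  \prod_(x | A x) (Q x)%:R = [forall (x | A x), Q x]%:R :> R.
Proof.
have [/forall_inP h|] := boolP [forall (x | A x), Q x].
  by rewrite big1 // => x /h ->.
by case/forall_inPn => x Ax /negbTE Qx; rewrite (bigD1 x) //= Qx mul0r.
Qed.

Section Prob.
Variables (k : nat) (I : finType) (P : I -> R).
Hypothesis P0 : forall i, 0 <= P i.
Hypothesis P1 : \sum_i P i = 1.
Variables (n m : nat).
Hypothesis n0 : (0 < n)%N.
Local Notation fg := (factor_graph k I n m).

(** The law of a single constraint. [Ec] and [Ex] are the expectations over one constraint and over
    the whole graph. *)
Definition pc (v : k.-tuple 'I_n * I) : R := (n%:R ^+ k)^-1 * P v.2.

Lemma graph_probE (G : fg) : graph_prob P G = \prod_a pc (G a).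
Proof. by apply: eq_bigr => a _; rewrite /pc RmultE RinvE RpowE INRE. Qed.

Definition Ex (F : fg -> R) : R := \sum_G graph_prob P G * F G.

Lemma prob_eventE (E : fg -> Prop) : prob_event P E = Ex (fun G => (pb (E G))%:R).
Proof.
by apply: eq_bigr => G _; case: (pb _); rewrite ?mulr1 ?mulr0.
Qed.

Lemma nk_gt0 : 0 < (n%:R ^+ k)^-1 :> R.
Proof. by rewrite invr_gt0 exprn_gt0 // ltr0n. Qed.

Lemma pc_ge0 v : 0 <= pc v. Proof. by rewrite mulr_ge0 // ltW // nk_gt0. Qed.

Lemma graph_prob_ge0 (G : fg) : 0 <= graph_prob P G.
Proof. by rewrite graph_probE; apply: prodr_ge0 => a _; exact: pc_ge0. Qed.

Lemma Ex_le F1 F2 : (forall G, F1 G <= F2 G) -> Ex F1 <= Ex F2.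
Proof. by move=> h; apply: ler_sum => G _; rewrite ler_wpM2l ?graph_prob_ge0. Qed.
Lemma Ex_ge0 F : (forall G, 0 <= F G) -> 0 <= Ex F.
Proof. by move=> h; apply: sumr_ge0 => G _; rewrite mulr_ge0 ?graph_prob_ge0. Qed.
Lemma ExD F1 F2 : Ex (fun G => F1 G + F2 G) = Ex F1 + Ex F2.
Proof. by rewrite /Ex -big_split; apply: eq_bigr => G _; rewrite mulrDr. Qed.
Lemma ExZ c F : Ex (fun G => c * F G) = c * Ex F.
Proof. by rewrite /Ex mulr_sumr; apply: eq_bigr => G _; rewrite mulrCA. Qed.
Lemma Ex_sum (J : Type) (r : seq J) (Q : pred J) (F : J -> fg -> R) :
  Ex (fun G => \sum_(j <- r | Q j) F j G) = \sum_(j <- r | Q j) Ex (F j).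
Proof. by rewrite /Ex exchange_big /=; apply: eq_bigr => G _; rewrite mulr_sumr. Qed.
Lemma eq_Ex F1 F2 : F1 =1 F2 -> Ex F1 = Ex F2.
Proof. by move=> h; apply: eq_bigr => G _; rewrite h. Qed.

Definition Ec (q : k.-tuple 'I_n * I -> R) : R := \sum_v pc v * q v.

Lemma Ec_fst q : Ec (fun v => q v.1) = (n%:R ^+ k)^-1 * \sum_t q t.
Proof.
rewrite /Ec -(pair_bigA _ (fun t i => pc (t, i) * q t)) /= mulr_sumr.
apply: eq_bigr => t _; rewrite -mulr_suml /pc /= -mulr_sumr P1; ring.
Qed.

Lemma Ec_prod (g : 'I_k -> 'I_n -> R) :
  Ec (fun v => \prod_(p < k) g p (tnth v.1 p)) = \prod_(p < k) ((n%:R)^-1 * \sum_x g p x).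
Proof.
rewrite (Ec_fst (fun t => \prod_(p < k) g p (tnth t p))) sum_tuple_prod.
by rewrite big_split /= prodr_const card_ord exprVn.
Qed.

Lemma Ec_1 : Ec (fun=> 1) = 1.
Proof.
have nn : n%:R != 0 :> R by rewrite pnatr_eq0 -lt0n.
have := Ec_prod (fun _ _ => 1); rewrite /Ec => h.
transitivity (\prod_(p < k) (n%:R^-1 * \sum_(x < n) 1 : R)).
  by rewrite -h; apply: eq_bigr => v _; rewrite big1.
by rewrite big1 // => p _; rewrite sumr_const card_ord mulVf.
Qed.

Lemma Ex_prod (h : 'I_m -> k.-tuple 'I_n * I -> R) :
  Ex (fun G => \prod_a h a (G a)) = \prod_a Ec (h a).
Proof.
rewrite /Ec bigA_distr_bigA /=; apply: eq_bigr => G _.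
by rewrite graph_probE -big_split.
Qed.

Lemma Ex_cst c : Ex (fun=> c) = c.
Proof.
have h : Ex (fun=> 1) = 1.
  transitivity (Ex (fun G => \prod_(a < m) 1)); first by apply: eq_Ex => G; rewrite big1.
  by rewrite (Ex_prod (fun _ _ => 1)) big1 // => a _; exact: Ec_1.
by rewrite -[in RHS](mulr1 c) -[in RHS]h -ExZ; apply: eq_Ex => G; rewrite mulr1.
Qed.

(** Independence of the constraints: along the injection, the product over all constraints has the
    factor [q j] at [io j] and [r] elsewhere. For stars, [q] prescribes the tuples and [r] keeps all
    other constraints away. *)
Lemma Ex_inj_prod (J : finType) (io : J -> 'I_m) (q : J -> k.-tuple 'I_n * I -> R)
    (r : k.-tuple 'I_n * I -> R) : injective io ->
  Ex (fun G => \prod_j q j (G (io j)) * \prod_(a | a \notin codom io) r (G a)) =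
  \prod_j Ec (q j) * Ec r ^+ (m - #|J|).
Proof.
move=> ioi.
pose h a v := if [pick j | io j == a] is Some j then q j v else r v.
have hio j : h (io j) = q j.
  by rewrite /h; case: pickP => [j' /eqP/ioi ->|/(_ j)] //; rewrite eqxx.
have hn a : a \notin codom io -> h a = r.
  move=> na; rewrite /h; case: pickP => // j /eqP e; case/negP: na.
  by rewrite -e codom_f.
have split (z : 'I_m -> R) : \prod_a z a =
    \prod_j z (io j) * \prod_(a | a \notin codom io) z a.
  rewrite (bigID (mem (codom io))) /=; congr (_ * _).
  rewrite -(big_image (R := R) _ _ io predT z) /= -[LHS]big_filter.
  apply: perm_big; apply: uniq_perm; rewrite ?filter_uniq ?index_enum_uniq //.
    by rewrite map_inj_uniq // enum_uniq.
  by move=> a; rewrite mem_filter mem_index_enum andbT.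
transitivity (Ex (fun G => \prod_a h a (G a))).
  apply: eq_Ex => G; rewrite split; congr (_ * _).
    by apply: eq_bigr => j _; rewrite hio.
  by apply: eq_bigr => a na; rewrite hn.
rewrite Ex_prod split; congr (_ * _); first by apply: eq_bigr => j _; rewrite hio.
rewrite (eq_bigr (fun=> Ec r)); last by move=> a na; rewrite hn.
rewrite prodr_const; congr (_ ^+ _).
have := cardC (mem (codom io)); rewrite card_ord (card_codom ioi) => e.
rewrite -[X in _ = (X - _)%N]e addKn; apply: eq_card => a; by rewrite !inE.
Qed.

Lemma Ex_inj_prod1 (J : finType) (io : J -> 'I_m) (q : J -> k.-tuple 'I_n * I -> R) :
  injective io -> Ex (fun G => \prod_j q j (G (io j))) = \prod_j Ec (q j).
Proof.
move=> /(Ex_inj_prod q (fun=> 1)); rewrite Ec_1 expr1n mulr1 => <-.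
by apply: eq_Ex => G; rewrite [X in _ * X]big1 ?mulr1.
Qed.

Lemma Ex_prob_le (E : fg -> Prop) (F : fg -> R) :
  (forall G, 0 <= F G) -> (forall G, E G -> 1 <= F G) -> prob_event P E <= Ex F.
Proof.
move=> F0 h; rewrite prob_eventE; apply: Ex_le => G.
by case: pbP => // /h.
Qed.

Lemma prob_event_compl (E E' : fg -> Prop) (d : R) :
  (forall G, ~ E' G -> E G) -> prob_event P E' <= d -> 1 - d <= prob_event P E.
Proof.
move=> h; rewrite !prob_eventE => hd.
have : Ex (fun=> 1) <= Ex (fun G => (pb (E G))%:R) + Ex (fun G => (pb (E' G))%:R).
  rewrite -ExD; apply: Ex_le => G; case: pbP => [_|nE]; first by rewrite lerDl ler0n.
  by case: pbP => [|/h] //; rewrite add0r.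
by rewrite Ex_cst; lra.
Qed.

Lemma prob_event_union (E E1 E2 : fg -> Prop) :
  (forall G, E G -> E1 G \/ E2 G) -> prob_event P E <= prob_event P E1 + prob_event P E2.
Proof.
move=> h; rewrite !prob_eventE -ExD; apply: Ex_le => G; case: pbP => [/h|_]; last first.
  by rewrite addr_ge0 // ler0n.
case=> e; first by case: (pbP (E1 G)) => // _; rewrite lerDl ler0n.
by case: (pbP (E2 G)) => // _; rewrite lerDr ler0n.
Qed.

Lemma prob_event_ge0 (E : fg -> Prop) : 0 <= prob_event P E.
Proof. by rewrite prob_eventE; apply: Ex_ge0 => G; rewrite ler0n. Qed.
Lemma prob_event_le1 (E : fg -> Prop) : prob_event P E <= 1.
Proof. by rewrite prob_eventE -[leRHS]Ex_cst; apply: Ex_le => G; case: (pb _). Qed.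

Lemma Ec_inner (U : {set 'I_n}) :
  Ec (fun v => [forall p, tnth v.1 p \in U]%:R) = (#|U|%:R / n%:R) ^+ k.
Proof.
transitivity (Ec (fun v => \prod_(p < k) (tnth v.1 p \in U)%:R)).
  by apply: eq_bigr => v _; rewrite prod_indic.
rewrite (Ec_prod (fun _ x => (x \in U)%:R)) -[X in _ ^+ X]card_ord -prodr_const.
by apply: eq_bigr => p _; rewrite sum_indic mulrC.
Qed.

Lemma Ec_touch (U : {set 'I_n}) :
  Ec (fun v => [exists p, tnth v.1 p \in U]%:R) <= k%:R * #|U|%:R / n%:R.
Proof.
have nn : n%:R != 0 :> R by rewrite pnatr_eq0 -lt0n.
apply: (@le_trans _ _ (\sum_(p0 < k) Ec (fun v => (tnth v.1 p0 \in U)%:R))).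
  rewrite /Ec exchange_big /=; apply: ler_sum => v _; rewrite -mulr_sumr ler_wpM2l ?pc_ge0 //.
  case: existsP => [[p h]|_]; last by apply: sumr_ge0 => p _; rewrite ler0n.
  by rewrite (bigD1 p) //= h lerDl; apply: sumr_ge0 => q _; rewrite ler0n.
rewrite -mulrA mulr_natl -[X in _ *+ X]card_ord -sumr_const; apply: ler_sum => p _.
apply: eq_ler.
transitivity (Ec (fun v => \prod_(q < k) (if q == p then (tnth v.1 q \in U)%:R else 1))).
  by apply: eq_bigr => v _; rewrite -big_mkcond big_pred1_eq.
rewrite (Ec_prod (fun q x => if q == p then (x \in U)%:R else 1)) (bigD1 p) //= eqxx.
rewrite sum_indic big1 ?mulr1 1?mulrC // => q /negbTE ->.
by rewrite sumr_const card_ord mulVf.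
Qed.

End Prob.

(** * Resampling the outer vertices of the constraints touching a set *)

Section Resample.
Variables (k : nat) (I : finType) (P : I -> R) (n m : nat) (U : {set 'I_n}).
Local Notation fg := (factor_graph k I n m).
Local Notation Arr := {ffun 'I_m * 'I_k -> 'I_n}.

Definition tch (v : k.-tuple 'I_n * I) : bool := [exists p, tnth v.1 p \in U].

(** The condition is symmetric in the old and the new entry, hence survives the exchange
    ([swp_res]); this makes the exchange an involution. *)
Definition swp (G : fg) (Y : Arr) (a : 'I_m) (p : 'I_k) : bool :=
  [&& tch (G a), tnth (G a).1 p \notin U & Y (a, p) \notin U].

(* Exchanging the entries outside U of the constraints touching U with fresh
   ones is an involution preserving graph_prob: these entries are independent
   and uniform on the complement of U. *)
Definition res (G : fg) (Y : Arr) : fg :=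
  [ffun a => ([tuple if swp G Y a p then Y (a, p) else tnth (G a).1 p | p < k], (G a).2)].
Definition ser (G : fg) (Y : Arr) : Arr :=
  [ffun ap => if swp G Y ap.1 ap.2 then tnth (G ap.1).1 ap.2 else Y ap].

Lemma res_tnth G Y a p : tnth (res G Y a).1 p = if swp G Y a p then Y (a, p) else tnth (G a).1 p.
Proof. by rewrite ffunE /= tnth_mktuple. Qed.

Lemma res_in G Y a p : (tnth (res G Y a).1 p \in U) = (tnth (G a).1 p \in U).
Proof.
by rewrite res_tnth; case: ifP => // /and3P[_ /negbTE-> /negbTE->].
Qed.

Lemma res_tch G Y a : tch (res G Y a) = tch (G a).
Proof. by apply: eq_existsb => p; rewrite res_in. Qed.

Lemma ser_in G Y ap : (ser G Y ap \in U) = (Y ap \in U).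
Proof.
by rewrite ffunE; case: ifP => // /and3P[_ /negbTE-> ]; rewrite -surjective_pairing => /negbTE->.
Qed.

Lemma swp_res G Y a p : swp (res G Y) (ser G Y) a p = swp G Y a p.
Proof. by rewrite /swp res_tch res_in ser_in. Qed.

Lemma resK G Y : res (res G Y) (ser G Y) = G.
Proof.
apply/ffunP => a; rewrite {1}/res ffunE /= [in RHS](surjective_pairing (G a)); congr (_, _).
  apply: eq_from_tnth => p; rewrite tnth_mktuple swp_res res_tnth.
  by case: ifP => h; rewrite ?ffunE /= h.
by rewrite ffunE.
Qed.

Lemma serK G Y : ser (res G Y) (ser G Y) = Y.
Proof.
apply/ffunP => -[a p]; rewrite {1}/ser ffunE /= swp_res res_tnth.
by case: ifP => h; rewrite ?ffunE /= h.
Qed.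

Lemma graph_prob_res G Y : graph_prob P (res G Y) = graph_prob P G.
Proof. by apply: eq_bigr => a _; rewrite ffunE. Qed.

Definition offU (Y : Arr) := [forall ap, Y ap \notin U].

(** Reindexing by the involution shows that a random graph may be generated with its outer entries
    taken from an independent uniform array off U. *)
Lemma resample (F : fg -> R) :
  \sum_(Y | offU Y) Ex P (fun G => F (res G Y)) = #|[pred Y | offU Y]|%:R * Ex P F.
Proof.
rewrite mulr_natl -sumr_const /Ex pair_big_dep /= [RHS]pair_big_dep /=.
rewrite [RHS](reindex (fun x : Arr * fg => (ser x.2 x.1, res x.2 x.1))) /=; last first.
  by exists (fun x : Arr * fg => (ser x.2 x.1, res x.2 x.1)) => -[Y G] _ /=;
    rewrite resK serK.
apply: eq_big => [[Y G]|[Y G] _] /=; last by rewrite graph_prob_res.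
by rewrite !andbT inE; apply: eq_forallb => ap; rewrite ser_in.
Qed.

End Resample.

(** * Entries of a uniform random array *)

Section Marginal.
Variables (J V : finType) (A : {set V}).
Hypothesis A0 : A != set0.
Local Notation Arr := {ffun J -> V}.
Definition inAr (Y : Arr) := [forall j, Y j \in A].

(** Exchanging the entry [Y j] with a fresh element [a] is an involution, so [Y j] is uniform and
    independent of the other entries. *)
Lemma marg1 (j : J) (Psi : Arr -> V -> R) :
  (forall (Y Y' : Arr) a, (forall i, i != j -> Y i = Y' i) -> Psi Y a = Psi Y' a) ->
  \sum_(Y | inAr Y) Psi Y (Y j) = \sum_(Y | inAr Y) #|A|%:R^-1 * \sum_(a in A) Psi Y a.
Proof.
move=> hP; have A1 := cardA_gt0 R A0.
pose up (Y : Arr) a : Arr := [ffun i => if i == j then a else Y i].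
transitivity (\sum_(Y | inAr Y) \sum_(a in A) #|A|%:R^-1 * Psi Y (Y j)).
  apply: eq_bigr => Y _; rewrite sumr_const -[RHS]mulr_natl mulrA mulfV ?mul1r //.
  by rewrite gt_eqF.
under [RHS]eq_bigr do rewrite mulr_sumr.
rewrite !pair_big_dep /=.
rewrite (reindex (fun x : Arr * V => (up x.1 x.2, x.1 j))) /=; last first.
  exists (fun x : Arr * V => (up x.1 x.2, x.1 j)) => -[Y a] _ /=;
   rewrite ffunE eqxx; congr (_, _); apply/ffunP => i; rewrite !ffunE; by case: eqP => // ->.
apply: eq_big => [[Y a]|[Y a] _] /=.
  apply/andP/andP => -[/forallP h1 h2]; split.
  - apply/forallP => i; have := h1 i; rewrite ffunE; case: eqP => // -> //.
  - by have := h1 j; rewrite ffunE eqxx.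
  - by apply/forallP => i; rewrite ffunE; case: eqP.
  - exact: h1.
rewrite ffunE eqxx; congr (_ * _); apply: hP => i /negbTE ij; by rewrite ffunE ij.
Qed.

(** Entries at distinct positions form a uniform list independent of the rest; one position is
    integrated out at a time. This turns outer vertices into the random lists of the pinning
    argument. *)
Lemma marg (ps : seq J) (Phi : Arr -> seq V -> R) : uniq ps ->
  (forall (Y Y' : Arr) l, (forall i, i \notin ps -> Y i = Y' i) -> Phi Y l = Phi Y' l) ->
  \sum_(Y | inAr Y) Phi Y (map Y ps) = \sum_(Y | inAr Y) avgl A (size ps) (Phi Y).
Proof.
elim: ps Phi => [|j ps IH] Phi //= /andP[jps ups] hP.
pose Psi (Y : Arr) a l := Phi Y (a :: l).
have jm (Y Y' : Arr) : (forall i, i != j -> Y i = Y' i) -> map Y ps = map Y' ps.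
  move=> h; apply/eq_in_map => i ips; apply: h.
  by apply: contraNneq jps => <-.
rewrite (marg1 (j := j) (Psi := fun Y a => Phi Y (a :: map Y ps))); last first.
  move=> Y Y' a h; rewrite (jm _ _ h); apply: hP => i; rewrite inE negb_or => /andP[ij _].
  exact: h.
rewrite -!mulr_sumr; congr (_ * _); rewrite exchange_big [RHS]exchange_big /=.
apply: eq_bigr => a _; apply: (IH (fun Y l => Phi Y (a :: l))) => // Y Y' l h.
by apply: hP => i; rewrite inE negb_or => /andP[_]; exact: h.
Qed.

End Marginal.

(** * Decorrelation and the Bethe product formula *)

Section Near.
Implicit Types th x y : R.

(** Multiplicative closeness, chosen because it passes through products, quotients and
    normalisations. *)
Definition near th x y := x <= th * y /\ y <= th * x.

Lemma near_sym th x y : near th x y -> near th y x. Proof. by case. Qed.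

Lemma near_le th th' x y : th <= th' -> 0 <= x -> 0 <= y -> near th x y -> near th' x y.
Proof.
by move=> h x0 y0 [a b]; split; [apply: le_trans a _|apply: le_trans b _]; rewrite ler_wpM2r.
Qed.

Lemma near_trans th th' x y z : 0 <= th -> 0 <= th' ->
  near th x y -> near th' y z -> near (th * th') x z.
Proof.
move=> t0 t0' [a b] [c d]; split.
  by apply: le_trans a _; rewrite -mulrA ler_wpM2l.
by apply: le_trans d _; rewrite mulrAC [leRHS]mulrC ler_wpM2l.
Qed.

Lemma near_mul th th' x y x' y' : 0 <= x -> 0 <= y -> 0 <= x' -> 0 <= y' ->
  near th x y -> near th' x' y' -> near (th * th') (x * x') (y * y').
Proof. by move=> x0 y0 x0' y0' [a b] [c d]; split; rewrite mulrACA ler_pM. Qed.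

Lemma near_mull th c x y : 0 <= c -> near th x y -> near th (c * x) (c * y).
Proof. by move=> c0 [a b]; split; rewrite mulrCA ler_wpM2l. Qed.

Lemma near_sum (T : finType) (Q : pred T) th (X Y : T -> R) :
  (forall t, Q t -> near th (X t) (Y t)) ->
  near th (\sum_(t | Q t) X t) (\sum_(t | Q t) Y t).
Proof. by move=> h; split; rewrite mulr_sumr; apply: ler_sum => t /h[]. Qed.

Lemma near_div th th' x y x' y' : 0 <= x -> 0 <= y -> 0 < x' -> 0 < y' ->
  near th x y -> near th' x' y' -> near (th * th') (x / x') (y / y').
Proof.
move=> x0 y0 x0' y0' h [a b]; apply: near_mul => //; rewrite ?invr_ge0 1?ltW //.
by split; rewrite ler_pdivlMr // mulrC ler_pdivrMr // mulrC.
Qed.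

Lemma near_norm (T : finType) th (X Y : T -> R) t :
  (forall t, 0 < X t) -> (forall t, 0 < Y t) -> (forall t, near th (X t) (Y t)) ->
  near (th * th) (X t / \sum_t' X t') (Y t / \sum_t' Y t').
Proof.
move=> X0 Y0 h.
have pos (Z : T -> R) : (forall t, 0 < Z t) -> 0 < \sum_t' Z t'.
  move=> Z0; rewrite (bigD1 t) //= ltr_pwDl // sumr_ge0 // => i _; exact: ltW.
apply: near_div (h t) _; rewrite ?pos ?ltW //; exact: near_sum.
Qed.

Lemma near_prod (T : finType) (Q : pred T) th (X Y : T -> R) (B : nat) : 1 <= th ->
  (#|Q| <= B)%N -> (forall t, Q t -> 0 <= X t) -> (forall t, Q t -> 0 <= Y t) ->
  (forall t, Q t -> near th (X t) (Y t)) ->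
  near (th ^+ B) (\prod_(t | Q t) X t) (\prod_(t | Q t) Y t).
Proof.
move=> th1 QB X0 Y0 h; apply: (@near_le (th ^+ #|Q|)).
- exact: ler_weXn2l.
- exact: prodr_ge0.
- exact: prodr_ge0.
rewrite -prodr_const.
split; rewrite -big_split /=; apply: ler_prod => t Qt;
  by rewrite ?X0 ?Y0 //=; case: (h t Qt).
Qed.

Lemma near_of_abs (c d x y : R) : 0 < c -> c <= x -> c <= y -> `|x - y| <= d ->
  near (1 + d / c) x y.
Proof.
move=> c0 cx cy; rewrite ler_norml => /andP[h1 h2].
have d0 : 0 <= d by lra.
have e : d = d / c * c by field; exact: lt0r_neq0.
have dc0 : 0 <= d / c by rewrite divr_ge0 // ltW.
have : d / c * c <= d / c * x by rewrite ler_wpM2l.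
have : d / c * c <= d / c * y by rewrite ler_wpM2l.
by rewrite -e => a b; split; rewrite mulrDl mul1r; lra.
Qed.

Lemma near_l1 (T : finType) th (X Y : T -> R) : 1 <= th -> (forall t, 0 <= X t) ->
  (forall t, 0 <= Y t) -> \sum_t X t <= 1 -> \sum_t Y t <= 1 ->
  (forall t, near th (X t) (Y t)) -> \sum_t `|X t - Y t| <= (th - 1) *+ 2.
Proof.
move=> th1 X0 Y0 X1 Y1 h.
apply: (@le_trans _ _ ((th - 1) * (\sum_t X t + \sum_t Y t))).
  rewrite -big_split /= mulr_sumr; apply: ler_sum => t _; have [a b] := h t.
  have : 0 <= (th - 1) * X t by rewrite mulr_ge0 // subr_ge0.
  have : 0 <= (th - 1) * Y t by rewrite mulr_ge0 // subr_ge0.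
  by rewrite ler_norml mulrDr => h1 h2; apply/andP; split; lra.
by rewrite -mulr_natr ler_wpM2l ?subr_ge0 //; lra.
Qed.
End Near.

Section Det.
Variables (Omega : finType) (w0 : Omega) (k : nat) (I : finType).
Variable psi : I -> k.-tuple Omega -> R.
Hypothesis k_gt0 : (0 < k)%N.
Variables (n m : nat) (G : factor_graph k I n m) (U : {set 'I_n}).
Local Notation cfg := (config Omega n).
Local Notation asg := {ffun Usub U -> Omega}.
Local Notation evc := (evc psi G).
Local Notation nbr := (nbr G).
Local Notation inner := (inner G U).
Local Notation bdry := (bdry G U).
Local Notation ext := (@extU Omega n U w0).

Lemma nbr_tnth a (p : 'I_k) : tnth (G a).1 p \in nbr a.
Proof. by rewrite inE mem_tnth. Qed.

Lemma nbrP a x : x \in nbr a -> exists p, x = tnth (G a).1 p.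
Proof. by rewrite inE => /tnthP. Qed.

Lemma nbr_neq0 a : nbr a != set0.
Proof. by apply/set0Pn; exists (tnth (G a).1 (Ordinal k_gt0)); exact: nbr_tnth. Qed.

Lemma tchE a : tch U (G a) = (nbr a :&: U != set0).
Proof.
apply/existsP/set0Pn => [[p h]|[x]].
  by exists (tnth (G a).1 p); rewrite inE nbr_tnth.
by rewrite inE => /andP[/nbrP[p ->] h]; exists p.
Qed.

(** Euler's formula for G[U]. A constraint with repeated neighbours contributes less than k - 1, so
    the actual sizes of the neighbourhoods have to stay in the sum. *)
Lemma cavity_forest : ~ has_cycle G U ->
  (ncomp G U + \sum_(a | inner a) (#|nbr a| - 1) = #|U|)%N.
Proof.
move=> acyc; pose A := [set a | inner a].
have hU a : a \in A -> nbr a \subset U by rewrite /A inE.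
have e : ncomp G U = n_comp (adjA U nbr A) (inA U A).
  have ein v : inGU G U v = inA U A v by case: v => [x|a] //=; rewrite /A inE.
  rewrite /ncomp (eq_n_comp_r (a' := inA U A)) //; apply: eq_n_comp; apply: eq_connect => v w.
  by rewrite /adjGU /adjA !ein.
rewrite e n_comp_cl //; last by move=> a _; exact: nbr_neq0.
rewrite -(@forest _ _ U nbr A hU).
- by congr (_ + _)%N; apply: eq_bigl => a; rewrite /A inE.
- by move=> a _; exact: nbr_neq0.
move=> [r [r2 [a [x [ai [xi h]]]]]]; apply: acyc; exists r; split=> //; exists a, x.
by do 2!split=> //; move=> i; have [] := h i; rewrite /A inE.
Qed.

Definition mix (sg : 'I_n -> Omega) (s : cfg) : cfg := [ffun x => if x \in U then sg x else s x].
(* The weight of the constraints that do not touch U. *)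
Definition nuU (s : cfg) : R := \prod_(b < m | ~~ tch U (G b)) evc b s.
(** As a function of [s] this depends only on the spins at the outer vertices of [b], since those on
    U are overwritten by [sg]. *)
Definition FF b (sg : 'I_n -> Omega) (s : cfg) : R := evc b (mix sg s).
Definition pin (T : seq 'I_n) (s0 : cfg) : {set cfg} := [set s | mp T s == mp T s0].

Lemma evc_ext b (s s' : 'I_n -> Omega) : {in nbr b, s =1 s'} -> evc b s = evc b s'.
Proof.
move=> h; rewrite /Defs.evc; congr (psi _ _); apply: val_inj => /=.
by apply/eq_in_map => x xb; apply: h; rewrite inE.
Qed.

Lemma ext_in (tau : asg) (x : Usub U) : ext tau (val x) = tau x.
Proof. by rewrite /extU valK. Qed.

Lemma restr_ext (tau : asg) (s : cfg) : reflect (forall x, x \in U -> s x = ext tau x) (restr U s == tau).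
Proof.
apply: (iffP eqP) => [<- x xU|h].
  by rewrite -[x in RHS](SubK (Usub U) xU) ext_in ffunE SubK.
by apply/ffunP => x; rewrite ffunE h ?ext_in // (valP x).
Qed.

Section Bounds.
Variable C : R.
Hypothesis C1 : 1 <= C.
Hypothesis psiC : forall i t, C^-1 <= psi i t <= C.

Let C0 : 0 < C. Proof. exact: lt_le_trans C1. Qed.

Lemma evc_bd b s : C^-1 <= evc b s <= C. Proof. exact: psiC. Qed.
Lemma evc_gt0 b s : 0 < evc b s.
Proof. by case/andP: (evc_bd b s) => h _; apply: lt_le_trans h; rewrite invr_gt0. Qed.
Lemma nuU_gt0 s : 0 < nuU s. Proof. by apply: prodr_gt0 => b _; exact: evc_gt0. Qed.

Variables (T : seq 'I_n) (s0 : cfg).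
Local Notation E f := (ce nuU (mp T) f s0).

Lemma ce_bd (c1 c2 : R) f : (forall s, c1 <= f s <= c2) -> c1 <= E f <= c2.
Proof.
move=> h; rewrite -{1}(ce_cst nuU_gt0 (mp T) c1 s0) -(ce_cst nuU_gt0 (mp T) c2 s0).
by apply/andP; split; apply: (ce_le nuU_gt0) => s _; case/andP: (h s).
Qed.

Lemma prod_bd (Q : pred 'I_m) (B : nat) (f : 'I_m -> R) : (#|Q| <= B)%N ->
  (forall b, C^-1 <= f b <= C) -> (C ^+ B)^-1 <= \prod_(b | Q b) f b <= C ^+ B.
Proof.
move=> QB h; have Ci : 0 <= C^-1 by rewrite invr_ge0 ltW.
have c1 : C ^+ #|Q| <= C ^+ B by exact: ler_weXn2l.
apply/andP; split.
  apply: (@le_trans _ _ (C^-1 ^+ #|Q|)).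
    by rewrite exprVn lef_pV2 ?posrE ?exprn_gt0.
  by rewrite -prodr_const; apply: ler_prod => b _; rewrite Ci; case/andP: (h b).
apply: le_trans c1; rewrite -prodr_const; apply: ler_prod => b _.
by case/andP: (h b) => h1 ->; rewrite (le_trans Ci h1).
Qed.

(* Wb b lists the vertices outside U of the constraints other than b that touch
   U: pinning them makes the factors of these constraints constant. *)
Definition psb (b : 'I_m) : seq ('I_m * 'I_k) :=
  [seq cp <- enum {: 'I_m * 'I_k} | [&& tch U (G cp.1), cp.1 != b & tnth (G cp.1).1 cp.2 \notin U]].
Definition Wb b : seq 'I_n := [seq tnth (G cp.1).1 cp.2 | cp <- psb b].

(** The cost of decoupling [b] from the other touching constraints: how much the prediction of its
    factor changes once their outer vertices are pinned. *)
Definition Dev b sg s1 : R := ce nuU (mp T)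
  (fun x => `|ce nuU (mp (T ++ Wb b)) (FF b sg) x - ce nuU (mp T) (FF b sg) x|) s1.

Lemma Dev_ge0 b sg s1 : 0 <= Dev b sg s1.
Proof.
by rewrite -[leLHS](ce_cst nuU_gt0 (mp T) 0 s1); apply: (ce_le nuU_gt0) => s _.
Qed.

Lemma FF_meas b c sg s s' : tch U (G c) -> c != b ->
  mp (T ++ Wb b) s = mp (T ++ Wb b) s' -> FF c sg s = FF c sg s'.
Proof.
move=> tc cb /eq_in_map h; apply: evc_ext => x /nbrP[p ->]; rewrite !ffunE.
case: ifP => // /negbT xU; apply: h; rewrite mem_cat; apply/orP; right.
by apply/mapP; exists (c, p) => //; rewrite mem_filter mem_enum /= tc cb xU.
Qed.

Lemma FF_bd b sg s : C^-1 <= FF b sg s <= C. Proof. exact: psiC. Qed.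

(** Peel off one constraint [b] at a time. The product of the remaining factors is a function of the
    spins along [T ++ Wb b], so by the tower property the factor of [b] may be replaced by its
    expectation given these spins, and then by the one given [T] at the cost [Dev b]. *)
Lemma telescope_prod (r : seq 'I_m) sg : uniq r -> all (fun b => tch U (G b)) r ->
  `|E (fun s => \prod_(b <- r) FF b sg s) - \prod_(b <- r) E (FF b sg)| <=
  C ^+ size r * \sum_(b <- r) Dev b sg s0.
Proof.
elim: r => [|b r IH] /=.
  by move=> _ _; rewrite !big_nil mulr0 (@ce_eq _ _ nuU _ (mp T) _ (fun=> 1)) ?ce_cst
    ?subrr ?normr0 //; [exact: nuU_gt0 | move=> s _; rewrite big_nil].
case/andP => br ur /andP[tb tr].
pose H s := \prod_(c <- r) FF c sg s.
have Hm s s' : mp (T ++ Wb b) s = mp (T ++ Wb b) s' -> H s = H s'.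
  move=> e; rewrite /H big_seq [RHS]big_seq; apply: eq_bigr => c cr.
  apply: FF_meas e; first exact: (allP tr).
  by apply: contraNneq br => <-.
have Hb s : 0 <= H s <= C ^+ size r.
  apply/andP; split.
    by apply: prodr_ge0 => c _; apply: ltW; exact: evc_gt0.
  rewrite /H; elim: r {br ur tr IH Hm H} => [|c r IHr] /=; first by rewrite big_nil.
  rewrite big_cons exprS ler_pM //; first by apply: ltW; exact: evc_gt0.
    by apply: prodr_ge0 => c' _; apply: ltW; exact: evc_gt0.
  by case/andP: (FF_bd c sg s).
have e1 : E (fun s => \prod_(c <- b :: r) FF c sg s) =
    E (fun s => ce nuU (mp (T ++ Wb b)) (FF b sg) s * H s).
  rewrite (ce_tower_class nuU_gt0 (FF b sg) s0 (@mp_catl _ _ T (Wb b)) Hm).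
  by apply: ce_eq => s _; rewrite big_cons.
have e2 : E (fun s => ce nuU (mp T) (FF b sg) s * H s) = E (FF b sg) * E H.
  rewrite mulrC -(@ce_mulr_meas _ _ nuU _ (mp T) H (ce nuU (mp T) (FF b sg))); last first.
    by move=> x; exact: ce_meas.
  by apply: ce_eq => s _; rewrite mulrC.
have d1 : `|E (fun s => \prod_(c <- b :: r) FF c sg s) - E (FF b sg) * E H| <=
    C ^+ size r * Dev b sg s0.
  rewrite e1 -e2 -ceN -ceD; apply: le_trans (ce_norm nuU_gt0 _ _ _) _.
  apply: (@le_trans _ _ (E (fun s =>
    `|ce nuU (mp (T ++ Wb b)) (FF b sg) s - ce nuU (mp T) (FF b sg) s| * C ^+ size r))).
    apply: (ce_le nuU_gt0) => s _; rewrite -mulrBl normrM ler_wpM2l //.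
    by case/andP: (Hb s) => h1 h2; rewrite ger0_norm.
  by rewrite (@ce_mulr_meas _ _ nuU _ (mp T) _ (fun=> C ^+ size r)) // mulrC.
have d2 : `|E (FF b sg) * E H - \prod_(c <- b :: r) E (FF c sg)| <=
    C * (C ^+ size r * \sum_(c <- r) Dev c sg s0).
  rewrite big_cons -mulrBr normrM ler_pM //; last exact: IH.
  have /andP[h1 h2] := ce_bd (FF_bd b sg).
  by rewrite ger0_norm // (le_trans _ h1) // invr_ge0 ltW.
have -> : E (fun s => \prod_(b <- b :: r) FF b sg s) - \prod_(b <- b :: r) E (FF b sg) =
   (E (fun s => \prod_(c <- b :: r) FF c sg s) - E (FF b sg) * E H) +
   (E (FF b sg) * E H - \prod_(c <- b :: r) E (FF c sg)) by rewrite addrA subrK.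
apply: le_trans (ler_normD _ _) _.
apply: (le_trans (lerD d1 d2)).
rewrite big_cons mulrDr mulrA -exprS lerD2r ler_wpM2r ?Dev_ge0 //.
by rewrite exprS ler_peMl // exprn_ge0 // ltW.
Qed.

(** Summed over all assignments to U, so that a single number controls the whole distribution on
    U. *)
Definition Delta s1 : R := \sum_(tau : asg) \sum_(b | tch U (G b)) Dev b (ext tau) s1.

Lemma Delta_ge0 s1 : 0 <= Delta s1.
Proof. by do 2!apply: sumr_ge0 => ? _; exact: Dev_ge0. Qed.

Lemma bdry_tch b : bdry b -> tch U (G b).
Proof. by rewrite tchE => /andP[]. Qed.

(** Both sides are at least C^(-B), so the additive bound of [telescope_prod] becomes
    multiplicative. One factor C^B comes from the telescope, the other from this division. *)
Lemma near_fact (B : nat) (tau : asg) (Q : pred 'I_m) :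
  (#|[pred b | tch U (G b)]| <= B)%N -> (forall b, Q b -> bdry b) ->
  near (1 + (C ^+ B) ^+ 2 * Delta s0) (E (fun s => \prod_(c | Q c) FF c (ext tau) s))
     (\prod_(c | Q c) E (FF c (ext tau))).
Proof.
move=> tB Qb.
have QB : (#|Q| <= B)%N.
  apply: leq_trans tB; apply: subset_leq_card; apply/subsetP => b /Qb/bdry_tch.
  by rewrite inE.
have CB0 : 0 < C ^+ B by rewrite exprn_gt0.
have h1 : (C ^+ B)^-1 <= E (fun s => \prod_(c | Q c) FF c (ext tau) s) <= C ^+ B.
  by apply: ce_bd => s; apply: prod_bd => // b; exact: FF_bd.
have h2 : (C ^+ B)^-1 <= \prod_(c | Q c) E (FF c (ext tau)) <= C ^+ B.
  by apply: prod_bd => // b; apply: ce_bd => s; exact: FF_bd.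
have -> : (C ^+ B) ^+ 2 * Delta s0 = C ^+ B * Delta s0 / (C ^+ B)^-1.
  by rewrite invrK expr2 mulrAC.
apply: near_of_abs; rewrite ?invr_gt0 //; [by case/andP: h1|by case/andP: h2|].
have := @telescope_prod (enum Q) (ext tau) (enum_uniq _).
rewrite big_enum /= (@ce_eq _ _ nuU _ (mp T) _ (fun s => \prod_(c | Q c) FF c (ext tau) s));
  last by move=> s _; rewrite big_enum.
have -> : all (fun b => tch U (G b)) (enum Q).
  by apply/allP => b; rewrite mem_enum => /Qb/bdry_tch.
move/(_ isT)/le_trans; apply; rewrite -cardE.
apply: ler_pM; rewrite ?exprn_ge0 ?sumr_ge0 //; try by rewrite ltW.
- by move=> b _; exact: Dev_ge0.
- exact: ler_weXn2l.
rewrite big_enum /= /Delta (bigD1 tau) //= -[leLHS]addr0 lerD //; last first.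
  by do 2!apply: sumr_ge0 => ? _; exact: Dev_ge0.
rewrite [leRHS](bigID Q) /= -[leLHS]addr0 lerD //; last first.
  by apply: sumr_ge0 => ? _; exact: Dev_ge0.
apply: eq_ler; apply: eq_bigl => b.
by apply/idP/andP => [h|[]//]; split=> //; exact: bdry_tch (Qb _ h).
Qed.
End Bounds.
End Det.

(** * Marginals and messages of a pinned set *)

Section BetheError.
Variables (Omega : finType) (w0 : Omega) (k : nat) (I : finType).
Variable psi : I -> k.-tuple Omega -> R.
Hypothesis k_gt0 : (0 < k)%N.
Variables (n m : nat) (G : factor_graph k I n m) (U : {set 'I_n}).
Variable C : R.
Hypothesis C1 : 1 <= C.
Hypothesis psiC : forall i t, C^-1 <= psi i t <= C.
Variables (T : seq 'I_n) (s0 : config Omega n).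
Local Notation cfg := (config Omega n).
Local Notation asg := {ffun Usub U -> Omega}.
Local Notation evc := (evc psi G).
Local Notation nbr := (nbr G).
Local Notation inner := (inner G U).
Local Notation bdry := (bdry G U).
Local Notation ext := (@extU Omega n U w0).
Local Notation mix := (@mix Omega n U).
Local Notation nuU := (nuU psi G U).
Local Notation FF := (FF psi G U).
Local Notation S := (pin T s0).
Local Notation E f := (ce nuU (mp T) f s0).

Let nu_gt0 : forall s, 0 < nuU s := nuU_gt0 G U C1 psiC.
Let ev_gt0 : forall b s, 0 < evc b s := evc_gt0 G C1 psiC.

Lemma sum_div_le1 (J : finType) (X : J -> R) : (forall j, 0 <= X j) ->
  (forall j, 0 <= X j / \sum_j' X j') /\ \sum_j X j / (\sum_j' X j') <= 1.
Proof.
move=> X0; have s0' : 0 <= \sum_j' X j' by apply: sumr_ge0.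
split=> [j|]; first by rewrite divr_ge0.
rewrite -mulr_suml; have [->|h] := eqVneq (\sum_j' X j') 0; first by rewrite mul0r ler01.
by rewrite divff.
Qed.

Lemma sum_restr (S' : {set cfg}) (h : cfg -> R) :
  \sum_(s in S') h s = \sum_(tau : asg) \sum_(s in S' | restr U s == tau) h s.
Proof. by rewrite (partition_big (@restr Omega n U) predT). Qed.

Lemma margU_ge0 S' (tau : asg) : 0 <= margU psi G S' tau.
Proof.
by rewrite /margU RdivE divr_ge0 // sumr_ge0 // => s _; apply: prodr_ge0 => b _; exact: ltW.
Qed.

Lemma margU_sum S' : \sum_(tau : asg) margU psi G S' tau <= 1.
Proof.
under eq_bigr do rewrite /margU RdivE.
have X0 (tau : asg) : 0 <= \sum_(s in S' | restr U s == tau) psiG psi G s.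
  by apply: sumr_ge0 => s _; apply: prodr_ge0 => b _; exact: ltW.
have [_ h] := sum_div_le1 X0.
by under eq_bigr do rewrite [X in _ / X](sum_restr S').
Qed.

Lemma msg_num_ge0 a x S' t : 0 <= msg_num psi G a x S' t.
Proof. by apply: sumr_ge0 => s _; apply: prodr_ge0 => b _; exact: ltW. Qed.

Lemma msg_ge0 a x S' t : 0 <= msg psi G a x S' t.
Proof.
by rewrite /msg RdivE divr_ge0 ?msg_num_ge0 // sumr_ge0 // => t' _; exact: msg_num_ge0.
Qed.

Lemma wGU_gt0 (tau : asg) : 0 < wGU psi G w0 tau.
Proof. by apply: prodr_gt0 => a _; exact: ev_gt0. Qed.

Lemma muGU_ge0 (tau : asg) : 0 <= muGU psi G w0 tau.
Proof. by rewrite /muGU RdivE divr_ge0 ?sumr_ge0 // => *; rewrite ltW // wGU_gt0. Qed.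

Lemma barw_ge0 S' (tau : asg) : 0 <= barw psi G w0 S' tau.
Proof.
rewrite /barw RmultE mulr_ge0 ?muGU_ge0 //.
by apply: prodr_ge0 => a _; apply: prodr_ge0 => x _; exact: msg_ge0.
Qed.

Lemma barmu_ge0_le1 S' : (forall tau : asg, 0 <= barmu psi G w0 S' tau) /\
  \sum_(tau : asg) barmu psi G w0 S' tau <= 1.
Proof.
have [h1 h2] := sum_div_le1 (barw_ge0 S').
by split=> [tau|]; [rewrite /barmu RdivE | under eq_bigr do rewrite /barmu RdivE].
Qed.

Lemma err_le2 S' : \sum_(tau : asg) `|margU psi G S' tau - barmu psi G w0 S' tau| <= 2%:R.
Proof.
have [h1 h2] := barmu_ge0_le1 S'.
apply: (@le_trans _ _ (\sum_(tau : asg) (margU psi G S' tau + barmu psi G w0 S' tau))).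
  apply: ler_sum => tau _; apply: le_trans (ler_normB _ _) _.
  by rewrite !ger0_norm ?h1 // margU_ge0.
by rewrite big_split /= -[2%N]/(1 + 1)%N natrD lerD // margU_sum.
Qed.

Hypothesis TU : all (fun x => x \notin U) T.

Lemma mix_pin sg s : (mix sg s \in S) = (s \in S).
Proof.
rewrite !inE; congr (_ == _); apply/eq_in_map => x /(allP TU) xU.
by rewrite ffunE (negbTE xU).
Qed.

Lemma restr_mix (tau : asg) s : restr U (mix (ext tau) s) = tau.
Proof. by apply/eqP/(restr_ext w0) => x xU; rewrite ffunE xU. Qed.

Lemma mix_mix sg sg' s : mix sg (mix sg' s) = mix sg s.
Proof. by apply/ffunP => x; rewrite !ffunE; case: (x \in U). Qed.

(** Since [T] avoids U, membership in the pinned set ignores the spins on U, and overwriting them is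
    a bijection between the slices. *)
Lemma sum_shift (tau tau' : asg) (h : cfg -> R) :
  \sum_(s in S | restr U s == tau) h (mix (ext tau') s) =
  \sum_(s in S | restr U s == tau') h s.
Proof.
rewrite [RHS](reindex_onto (mix (ext tau')) (mix (ext tau))) /=; last first.
  move=> s /andP[_ /(restr_ext w0) e]; rewrite mix_mix; apply/ffunP => x; rewrite ffunE.
  by case: ifP => // /e.
apply: eq_bigl => s; rewrite mix_pin restr_mix eqxx andbT mix_mix; congr (_ && _).
apply/idP/eqP => [/(restr_ext w0) e|<-]; last by rewrite restr_mix.
by apply/ffunP => x; rewrite ffunE; case: ifP => // /e.
Qed.

Lemma sum_mix (tau : asg) (h : cfg -> R) :
  \sum_(s in S | restr U s == tau) h s =
  #|{: asg}|%:R^-1 * \sum_(s in S) h (mix (ext tau) s).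
Proof.
rewrite (sum_restr S (fun s => h (mix (ext tau) s))).
under [in RHS]eq_bigr do rewrite sum_shift.
rewrite sumr_const -[X in _ = _ * X]mulr_natl mulKf // pnatr_eq0 -lt0n.
by apply/card_gt0P; exists tau.
Qed.

Lemma evc_mix_inner c sg s : inner c -> evc c (mix sg s) = evc c sg.
Proof. by move=> /subsetP h; apply: evc_ext => x /h xU; rewrite ffunE xU. Qed.

Lemma evc_mix_far c sg s : ~~ tch U (G c) -> evc c (mix sg s) = evc c s.
Proof.
rewrite tchE negbK => /eqP/setP h; apply: evc_ext => x xc; rewrite ffunE.
by have := h x; rewrite in_setI xc in_set0 /= => ->.
Qed.

Lemma tch_split c : tch U (G c) = inner c || bdry c.
Proof.
rewrite tchE /Defs.bdry /Defs.inner; case: (boolP (_ \subset _)) => // h.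
  by rewrite (setIidPl h) nbr_neq0.
by rewrite andbT.
Qed.

Lemma prod_mix (Q : pred 'I_m) sg s : (forall c, ~~ tch U (G c) -> Q c) ->
  \prod_(c | Q c) evc c (mix sg s) =
  nuU s * (\prod_(c | inner c && Q c) evc c sg * \prod_(c | bdry c && Q c) FF c sg s).
Proof.
move=> hQ; rewrite (bigID (fun c => tch U (G c))) /= mulrC; congr (_ * _).
  apply: eq_big => [c|c /andP[_ h]]; last by rewrite evc_mix_far.
  by apply/andP/idP => [[]//|h]; split=> //; exact: hQ.
rewrite (bigID inner) /=; congr (_ * _).
  apply: eq_big => [c|c /andP[_ h]]; last by rewrite evc_mix_inner.
  by rewrite tch_split; case: (inner c); case: (Q c); rewrite ?andbF.
apply: eq_bigl => c; rewrite tch_split /Defs.bdry /Defs.inner.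
by case: (_ \subset _); rewrite /= ?andbF ?andbT //; case: (Q c); rewrite ?andbT ?andbF.
Qed.

Local Notation NS := (\sum_(s in S) nuU s).
Local Notation K := (#|{: asg}|%:R^-1 * NS : R).

Lemma NSE f : \sum_(s in S) nuU s * f s = NS * E f.
Proof.
rewrite /ce; have e : \sum_(s | mp T s == mp T s0) nuU s = NS by apply: eq_bigl => s; rewrite inE.
have h : NS != 0 by rewrite -e gt_eqF //; exact: class_gt0.
by rewrite e mulrC divfK //; apply: eq_bigl => s; rewrite inE.
Qed.

Lemma K_gt0 (tau : asg) : 0 < K.
Proof.
rewrite mulr_gt0 //; first by rewrite invr_gt0 ltr0n; apply/card_gt0P; exists tau.
rewrite (bigD1 s0) ?inE //= ltr_pwDl // sumr_ge0 // => s _; exact: ltW.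
Qed.

(** One formula for marginal and messages: [Q] is everything in the first case and the constraints
    kept by the message in the second. The factor [K] is independent of [tau] and cancels on
    normalisation. *)
Lemma sum_cond (Q : pred 'I_m) (tau : asg) : (forall c, ~~ tch U (G c) -> Q c) ->
  \sum_(s in S | restr U s == tau) \prod_(c | Q c) evc c s =
  K * (\prod_(c | inner c && Q c) evc c (ext tau) *
       E (fun s => \prod_(c | bdry c && Q c) FF c (ext tau) s)).
Proof.
move=> hQ; rewrite sum_mix -mulrA; congr (_ * _).
rewrite mulrCA -NSE mulr_sumr; apply: eq_bigr => s _.
by rewrite (prod_mix (ext tau) s hQ) mulrCA.
Qed.

Hypothesis cav2 : CAV2 G U.
Variable th : R.
Hypothesis th1 : 1 <= th.
Hypothesis th_near : forall (tau : asg) (Q : pred 'I_m), (forall b, Q b -> bdry b) ->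
  near th (E (fun s => \prod_(c | Q c) FF c (ext tau) s)) (\prod_(c | Q c) E (FF c (ext tau))).

(** Up to normalisation and a factor near 1, the message from a boundary constraint [c] to U; by
    CAV2 it depends on one spin only ([qm_cst]). *)
Definition qm c (sg : 'I_n -> Omega) : R := E (FF c sg).
Definition cst (t : Omega) : 'I_n -> Omega := fun=> t.

Lemma qm_gt0 c sg : 0 < qm c sg.
Proof.
have C0 : 0 < C^-1 by rewrite invr_gt0; apply: lt_le_trans C1.
apply: lt_le_trans C0 _.
by have /andP[] := ce_bd G U C1 psiC T s0 (FF_bd G U psiC c sg).
Qed.

Lemma bdry_nbr b x : bdry b -> x \in nbr b :&: U -> nbr b :&: U = [set x].
Proof.
move=> /andP[_ h] xb; apply/eqP; rewrite eq_sym eqEcard sub1set xb cards1.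
exact: cav2 h.
Qed.

Lemma qm_cst b x sg : bdry b -> x \in nbr b :&: U -> qm b sg = qm b (cst (sg x)).
Proof.
move=> bb xb; apply: ce_eq => s _; apply: evc_ext => y yb; rewrite !ffunE.
case: ifP => // yU; have : y \in nbr b :&: U by rewrite in_setI yb.
by rewrite (bdry_nbr bb xb) inE => /eqP->.
Qed.

Lemma qm_ext c (sg sg' : 'I_n -> Omega) : {in nbr c :&: U, sg =1 sg'} -> qm c sg = qm c sg'.
Proof.
move=> h; apply: ce_eq => s _; apply: evc_ext => y yb; rewrite !ffunE.
by case: ifP => // yU; apply: h; rewrite in_setI yb.
Qed.

Section Message.
Variables (b : 'I_m) (x : 'I_n).
Hypotheses (bb : bdry b) (xb : x \in nbr b :&: U).

Let xU : x \in U. Proof. by move: xb; rewrite inE => /andP[]. Qed.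
Let xnb : x \in nbr b. Proof. by move: xb; rewrite in_setI => /andP[]. Qed.

Definition kap (t : Omega) : R := \sum_(tau : asg | ext tau x == t)
  (\prod_(c | inner c && (x \notin nbr c)) evc c (ext tau) *
   \prod_(c | bdry c && (x \notin nbr c)) qm c (ext tau)).

(** The factors in [kap] come from constraints avoiding [x], so changing the spin at [x] is a
    bijection that preserves the summand. *)
Lemma kap_cst t t' : kap t = kap t'.
Proof.
pose up (u : Omega) (tau : asg) : asg := [ffun y => if val y == x then u else tau y].
have upx u tau : ext (up u tau) x = u.
  by rewrite -{1}[x](SubK (Usub U) xU) ext_in ffunE SubK eqxx.
have upn u tau y : y != x -> ext (up u tau) y = ext tau y.
  move=> yx; rewrite /extU; case: insubP => // z _ zy.
  by rewrite ffunE zy (negbTE yx).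
have upK u u' tau : ext tau x = u' -> up u' (up u tau) = tau.
  move=> e; apply/ffunP => y; rewrite !ffunE; case: eqP => // yx.
  by rewrite -e -yx ext_in.
rewrite /kap [RHS](reindex_onto (up t') (up t)) /=; last by move=> tau /eqP /upK.
apply: eq_big => [tau|tau _].
  rewrite upx eqxx /=; apply/eqP/eqP => [/upK //|<-]; exact: upx.
congr (_ * _); apply: eq_bigr => c /andP[_ xc].
  by apply: evc_ext => y yc; rewrite upn //; apply: contraNneq xc => <-.
apply: qm_ext => y; rewrite in_setI => /andP[yc _]; rewrite upn //.
by apply: contraNneq xc => <-.
Qed.

Lemma kap_gt0 t : 0 < kap t.
Proof.
rewrite (kap_cst t (ext [ffun=> w0] x)) /kap (bigD1 [ffun=> w0]) //=.
have pos tau : 0 < \prod_(c | inner c && (x \notin nbr c)) evc c (ext tau) *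
   \prod_(c | bdry c && (x \notin nbr c)) qm c (ext tau).
  by rewrite mulr_gt0 //; apply: prodr_gt0 => c _; rewrite ?ev_gt0 ?qm_gt0.
by rewrite ltr_pwDl // sumr_ge0 // => tau _; exact: ltW.
Qed.

(** Sum over the assignments to U with spin [t] at [x], and decorrelate the boundary constraints
    that the message keeps: [b], which yields [qm b (cst t)], and those avoiding [x], which enter
    [kap]. *)
Lemma msg_num_near t :
  near th (msg_num psi G b x S t) (K * kap t * qm b (cst t)).
Proof.
pose Q := [pred c | (c == b) || (x \notin nbr c)].
have hQ c : ~~ tch U (G c) -> Q c.
  rewrite tchE negbK => /eqP/setP/(_ x); rewrite in_setI in_set0 xU andbT => h.
  by rewrite /Q /= h orbT.
have e : msg_num psi G b x S t = \sum_(tau : asg | ext tau x == t)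
    \sum_(s in S | restr U s == tau) \prod_(c | Q c) evc c s.
  rewrite /msg_num (partition_big (@restr Omega n U) (fun tau : asg => ext tau x == t)) /=.
    apply: eq_bigr => tau /eqP ht; apply: eq_bigl => s.
    case: (s \in S) => //=; apply: andb_idl => /(restr_ext w0) h.
    by rewrite h // ht.
  by move=> s /andP[_ /eqP <-]; rewrite -(elimT (restr_ext w0 _ _) (eqxx _)).
rewrite e /kap -mulrA mulr_suml mulr_sumr; apply: near_sum => tau /eqP ht.
rewrite sum_cond //; apply: near_mull; first by rewrite ltW // (K_gt0 tau).
have e1 : \prod_(c | inner c && Q c) evc c (ext tau) =
    \prod_(c | inner c && (x \notin nbr c)) evc c (ext tau).
  apply: eq_bigl => c; rewrite inE; case: eqP => //= ->.
  by rewrite xnb andbF andbT; move: bb => /andP[_ /negbTE].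
rewrite e1 -mulrA; apply: near_mull; first by apply: prodr_ge0 => c _; rewrite ltW.
have -> : \prod_(c | bdry c && (x \notin nbr c)) qm c (ext tau) * qm b (cst t) =
    \prod_(c | bdry c && Q c) qm c (ext tau).
  rewrite [RHS](bigD1 b) /=; last by rewrite bb inE eqxx.
  rewrite mulrC (qm_cst (ext tau) bb xb) ht; congr (_ * _); apply: eq_bigl => c; rewrite /Q /=.
  by case: (eqVneq c b) => [->|_] /=; rewrite ?xnb ?andbF ?andbT.
by apply: th_near => c /andP[].
Qed.

Lemma msg_near t : near (th * th) (msg psi G b x S t)
  (qm b (cst t) / \sum_t' qm b (cst t')).
Proof.
have q0 t' : 0 < K * kap t' * qm b (cst t').
  by rewrite mulr_gt0 ?qm_gt0 // mulr_gt0 ?kap_gt0 // (K_gt0 [ffun=> w0]).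
have n0 t' : 0 < msg_num psi G b x S t'.
  have [_] := msg_num_near t'; rewrite -(pmulr_rgt0 _ (lt_le_trans ltr01 th1)).
  exact: lt_le_trans.
have := near_norm t n0 q0 msg_num_near.
rewrite /msg RdivE; congr near.
have -> : \sum_t' K * kap t' * qm b (cst t') = K * kap t * \sum_t' qm b (cst t').
  by rewrite [RHS]mulr_sumr; apply: eq_bigr => t' _; rewrite (kap_cst t' t).
rewrite -mulf_div divff ?mul1r // gt_eqF // mulr_gt0 ?kap_gt0 //.
exact: K_gt0 [ffun=> w0].
Qed.
End Message.

(** Both sides are compared with the normalisation of [X], the inner weight times the product of the
    [qm]. The marginal costs th^2; at most B messages cost th^2 each, and normalising their product
    doubles the exponent to 4B. *)
Lemma bethe_near (B : nat) (tau : asg) : (#|[pred b | tch U (G b)]| <= B)%N ->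
  near (th ^+ (4 * B + 2)) (margU psi G S tau) (barmu psi G w0 S tau).
Proof.
move=> tB; have th0 : 0 <= th by apply: le_trans th1.
have bB : (#|[pred b | bdry b]| <= B)%N.
  apply: leq_trans tB; apply: subset_leq_card; apply/subsetP => b.
  by rewrite !inE; exact: bdry_tch.
pose w (t : asg) := \prod_(c | inner c) evc c (ext t).
pose X t := w t * \prod_(c | bdry c) qm c (ext t).
have w0' t : 0 < w t by apply: prodr_gt0.
have X0 t : 0 < X t by rewrite mulr_gt0 // prodr_gt0 // => c _; exact: qm_gt0.
pose Y t := w t * E (fun s => \prod_(c | bdry c) FF c (ext t) s).
have YX t : near th (Y t) (X t) by apply: near_mull; [exact: ltW | exact: th_near].
have Y0 t : 0 < Y t.
  have [_] := YX t; rewrite -(pmulr_rgt0 _ (lt_le_trans ltr01 th1)); exact: lt_le_trans.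
have margE : margU psi G S tau = Y tau / \sum_t Y t.
  rewrite /margU RdivE.
  have c t : \sum_(s in S | restr U s == t) psiG psi G s = K * Y t.
    rewrite (eq_bigr (fun s : cfg => \prod_(c | predT c) evc c s)) // sum_cond //.
    by congr (_ * (_ * _)); [apply: eq_bigl => a; rewrite andbT|
      apply: ce_eq => s _; apply: eq_bigl => a; rewrite andbT].
  rewrite sum_restr; under [\sum_(t : asg) _]eq_bigr do rewrite c.
  rewrite [X in X / _]c -mulr_sumr -mulf_div divff ?mul1r // gt_eqF //.
  exact: K_gt0 tau.
have n1 : near (th * th) (margU psi G S tau) (X tau / \sum_t X t).
  by rewrite margE; apply: near_norm.
pose Qt c := \sum_t' qm c (cst t').
have Qt0 c : 0 < Qt c.
  by rewrite /Qt (bigD1 w0) //= ltr_pwDl ?qm_gt0 // sumr_ge0 // => t _; rewrite ltW // qm_gt0.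
pose W := \sum_t w t.
have W0 : 0 < W by rewrite /W (bigD1 tau) //= ltr_pwDl // sumr_ge0 // => t _; rewrite ltW.
(* The normalisations of [muGU] and of the messages; they do not depend on the assignment and cancel
   in [barmu]. *)
pose D := W^-1 * \prod_(c | bdry c) (Qt c)^-1.
have D0 : 0 < D by rewrite mulr_gt0 ?invr_gt0 // prodr_gt0 // => c _; rewrite invr_gt0.
have barw_near (t : asg) : near ((th * th) ^+ B) (barw psi G w0 S t) (D * X t).
  have -> : D * X t = w t / W * \prod_(c | bdry c) (qm c (ext t) / Qt c).
    by rewrite big_split /= /D /X; ring.
  rewrite /barw RmultE /muGU RdivE; apply: near_mull.
    by rewrite divr_ge0 // ltW.
  apply: near_prod => //.
  - by rewrite -(mulr1 1) ler_pM.
  - by move=> c _; apply: prodr_ge0 => x _; exact: msg_ge0.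
  - by move=> c _; rewrite divr_ge0 // ltW // qm_gt0.
  move=> c bc; have /set0Pn[x xc] : nbr c :&: U != set0 by case/andP: bc.
  rewrite (bdry_nbr bc xc) big_set1 (qm_cst _ bc xc); exact: msg_near.
have barw_gt0 (t : asg) : 0 < barw psi G w0 S t.
  have [_ h] := barw_near t.
  have : 0 < (th * th) ^+ B * barw psi G w0 S t by apply: lt_le_trans h; rewrite mulr_gt0.
  by rewrite pmulr_rgt0 // exprn_gt0 // mulr_gt0 // (lt_le_trans ltr01 th1).
have n2 : near ((th * th) ^+ B * (th * th) ^+ B) (barmu psi G w0 S tau) (X tau / \sum_t X t).
  have -> : X tau / \sum_t X t = (D * X tau) / \sum_t (D * X t).
    by rewrite -mulr_sumr -mulf_div divff ?mul1r // gt_eqF.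
  rewrite /barmu RdivE; apply: near_norm => // t; exact: mulr_gt0.
have -> : th ^+ (4 * B + 2) = th * th * ((th * th) ^+ B * (th * th) ^+ B).
  by rewrite -expr2 -!exprM -!exprD; congr (_ ^+ _); lia.
apply: near_trans n1 (near_sym n2); rewrite ?mulr_ge0 ?exprn_ge0 ?mulr_ge0 //.
Qed.

Lemma bethe_err_th (B : nat) : (#|[pred b | tch U (G b)]| <= B)%N ->
  \sum_(tau : asg) `|margU psi G S tau - barmu psi G w0 S tau| <= (th ^+ (4 * B + 2) - 1) *+ 2.
Proof.
move=> tB; have [h1 h2] := barmu_ge0_le1 S.
apply: near_l1 => //; first exact: exprn_ege1.
- exact: margU_ge0.
- exact: margU_sum.
by move=> tau; apply: bethe_near.
Qed.
End BetheError.

(** * First moment of the error *)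

Section Model.
Variables (Omega : finType) (w0 : Omega) (k : nat) (I : finType).
Variable psi : I -> k.-tuple Omega -> R.
Hypothesis k_gt0 : (0 < k)%N.
Variable C : R.
Hypothesis C1 : 1 <= C.
Hypothesis psiC : forall i t, C^-1 <= psi i t <= C.
Variable P : I -> R.
Hypothesis P0 : forall i, 0 <= P i.
Hypothesis P1 : \sum_i P i = 1.

Let C0 : 0 < C. Proof. exact: lt_le_trans C1. Qed.

Section FixedSize.
Variables (n m : nat).
Hypothesis n0 : (0 < n)%N.
Local Notation fg := (factor_graph k I n m).
Local Notation cfg := (config Omega n).

Definition err (G : fg) (U : {set 'I_n}) (S : {set cfg}) : R :=
  \sum_(tau : {ffun Usub U -> Omega}) `|margU psi G S tau - barmu psi G w0 S tau|.

Definition muw (G : fg) (s : cfg) : R := psiG psi G s / Zpart psi G.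

Lemma psiG_gt0 (G : fg) s : 0 < psiG psi G s.
Proof. by apply: prodr_gt0 => b _; exact: (evc_gt0 G C1 psiC). Qed.

Lemma muw_ge0 G s : 0 <= muw G s.
Proof. by rewrite divr_ge0 ?sumr_ge0 ?(ltW (psiG_gt0 _ _)) // => t _; rewrite ltW ?psiG_gt0. Qed.

Lemma muw_sum G : \sum_s muw G s = 1.
Proof.
rewrite -mulr_suml -[Zpart psi G]/(\sum_s psiG psi G s) divff // gt_eqF //.
by rewrite (bigD1 [ffun=> w0]) //= ltr_pwDl ?psiG_gt0 // sumr_ge0 // => s _; rewrite ltW ?psiG_gt0.
Qed.

Lemma muS_muw G S : muS psi G S = \sum_(s in S) muw G s.
Proof. by rewrite /muS RdivE /muw mulr_suml. Qed.

Lemma muw_avg (G : fg) (f : cfg -> R) (c : R) : (forall s, f s <= c) -> \sum_s muw G s * f s <= c.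
Proof.
move=> h; rewrite -[leRHS]mul1r -(muw_sum G) mulr_suml; apply: ler_sum => s _.
by rewrite ler_wpM2l ?muw_ge0.
Qed.

Lemma err_ge0 G U S : 0 <= err G U S. Proof. exact: sumr_ge0. Qed.

Lemma err_bound G U S : err G U S <= 2%:R. Proof. exact: (err_le2 w0 G U C1 psiC). Qed.

Section FixedSet.
Variable U : {set 'I_n}.
Local Notation A := (~: U).
Hypothesis A0 : A != set0.
Local Notation tchG G := [pred b | tch U ((G : fg) b)].

(** The error of the product formula when [Delta] is at most [d0], i.e. with th = 1 + C^(2B) d0. *)
Definition eps1 (B : nat) (d0 : R) : R := ((1 + (C ^+ B) ^+ 2 * d0) ^+ (4 * B + 2) - 1) *+ 2.

(** If [Delta] is at most [d0] the product formula applies; otherwise the trivial bound 2 is already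
    below 2 [Delta] / [d0]. *)
Lemma err_Delta (B : nat) (d0 : R) (G : fg) (T : seq 'I_n) (s : cfg) : 0 < d0 ->
  CAV2 G U -> all (fun x => x \notin U) T -> (#|tchG G| <= B)%N ->
  err G U (pin T s) <= eps1 B d0 + 2%:R / d0 * Delta w0 psi G U T s.
Proof.
move=> d00 cav2 TU tB; have CB : 0 <= (C ^+ B) ^+ 2 by rewrite exprn_ge0 // exprn_ge0 // ltW.
have D0 := Delta_ge0 w0 G U C1 psiC T s.
have e0 : 0 <= eps1 B d0.
  by rewrite mulrn_wge0 // subr_ge0 exprn_ege1 // lerDl mulr_ge0 // ltW.
have [Dd|dD] := lerP (Delta w0 psi G U T s) d0; last first.
  apply: le_trans (err_bound _ _ _) _; rewrite -[leLHS]add0r lerD //.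
  by rewrite mulrAC ler_pdivlMr // ler_wpM2l // ltW.
apply: (@le_trans _ _ (eps1 B d0)); last by rewrite lerDl mulr_ge0 // divr_ge0 // ltW.
set D := Delta _ _ _ _ _ _ in D0 Dd.
have th1 : 1 <= 1 + (C ^+ B) ^+ 2 * D by rewrite lerDl mulr_ge0.
apply: (le_trans (bethe_err_th k_gt0 C1 psiC TU cav2 th1
  (fun tau Q h => near_fact w0 C1 psiC T s tau tB h) tB)).
rewrite lerMn2r /= lerD2r; apply: lerXn2r.
- by rewrite nnegrE addr_ge0 // mulr_ge0.
- by rewrite nnegrE addr_ge0 // mulr_ge0 // ltW.
- by rewrite lerD2l ler_wpM2l.
Qed.

(** Reinstating at most B constraints changes every weight, and therefore also the partition
    function, by a factor of at most C^B. *)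
Lemma muw_nu (B : nat) (G : fg) s : (#|tchG G| <= B)%N ->
  muw G s <= (C ^+ B) ^+ 2 * (nuU psi G U s / \sum_s' nuU psi G U s').
Proof.
move=> tB; have CB0 : 0 < C ^+ B by rewrite exprn_gt0.
have nu0 := nuU_gt0 G U C1 psiC.
pose pi0 s := \prod_(b | tch U (G b)) evc psi G b s.
have e s' : psiG psi G s' = nuU psi G U s' * pi0 s'.
  by rewrite /psiG [LHS](bigID (fun b => tch U (G b))) /= mulrC.
have pb s' : (C ^+ B)^-1 <= pi0 s' <= C ^+ B.
  by apply: (prod_bd C1) => // b; exact: psiC.
have Z0 : 0 < \sum_s' nuU psi G U s'.
  by rewrite (bigD1 s) //= ltr_pwDl // sumr_ge0 // => s' _; exact: ltW.
have ZZ : (C ^+ B)^-1 * \sum_s' nuU psi G U s' <= \sum_s' psiG psi G s'.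
  rewrite mulr_sumr; apply: ler_sum => s' _; rewrite e mulrC ler_pM2l //.
  by case/andP: (pb s').
rewrite /muw -[Zpart psi G]/(\sum_s' psiG psi G s').
set Z' := \sum_s' psiG psi G s' in ZZ *; set Z := \sum_s' nuU psi G U s' in Z0 ZZ *.
have Z'0 : 0 < Z' by apply: lt_le_trans ZZ; rewrite mulr_gt0 ?invr_gt0.
rewrite mulrA ler_pdivrMr // mulrAC ler_pdivlMr //.
rewrite mulrC in ZZ; rewrite ler_pdivrMr // in ZZ.
apply: (@le_trans _ _ (nuU psi G U s * C ^+ B * (Z' * C ^+ B))).
  rewrite e ler_pM ?mulr_ge0 // ?(ltW (nu0 _)) // ?(ltW Z0) //.
    by case/andP: (pb s) => h _; apply: le_trans h; rewrite invr_ge0 ltW.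
  by rewrite ler_pM2l //; case/andP: (pb s).
by apply: eq_ler; ring.
Qed.

Lemma res_far (G : fg) Y b : ~~ tch U (G b) -> res U G Y b = G b.
Proof.
move=> nt; rewrite ffunE [RHS]surjective_pairing; congr (_, _).
by apply: eq_from_tnth => p; rewrite tnth_mktuple /swp (negbTE nt).
Qed.

Lemma nuU_res (G : fg) Y s : nuU psi (res U G Y) U s = nuU psi G U s.
Proof.
apply: eq_big => [b|b nt]; first by rewrite res_tch.
by rewrite res_tch in nt; rewrite /evc (res_far _ nt).
Qed.

Lemma psb_res (G : fg) Y b : psb (res U G Y) U b = psb G U b.
Proof. by apply: eq_filter => cp; rewrite res_tch res_in. Qed.

Lemma Wb_res (G : fg) (Y : {ffun 'I_m * 'I_k -> 'I_n}) b : offU U Y ->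
  Wb (res U G Y) U b = map Y (psb G U b).
Proof.
move=> /forallP oY; rewrite /Wb psb_res; apply/eq_in_map => -[c p].
rewrite mem_filter /= => /andP[/and3P[tc _ nU] _].
by rewrite res_tnth /swp tc nU oY.
Qed.

Lemma FF_res (G : fg) (Y Y' : {ffun 'I_m * 'I_k -> 'I_n}) b sg s :
  (forall p, Y (b, p) = Y' (b, p)) -> FF psi (res U G Y) U b sg s = FF psi (res U G Y') U b sg s.
Proof.
move=> e; have eb : res U G Y b = res U G Y' b.
  rewrite /res !ffunE; congr (_, _); apply: eq_from_tnth => p.
  by rewrite !tnth_mktuple /swp e.
by rewrite /FF /evc eb.
Qed.

Lemma size_psb (B : nat) (G : fg) b : (#|tchG G| <= B)%N -> (size (psb G U b) <= B * k)%N.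
Proof.
move=> tB; apply: (@leq_trans #|[pred cp : 'I_m * 'I_k | tch U (G cp.1)]|).
  rewrite cardE; apply: uniq_leq_size; first by rewrite filter_uniq // enum_uniq.
  by move=> cp; rewrite mem_filter !mem_enum !inE => /andP[/and3P[h _ _] _].
rewrite (@eq_card _ _ (predX [pred b | tch U (G b)] predT)); last first.
  by move=> cp; rewrite !inE andbT.
by rewrite cardX card_ord leq_mul.
Qed.

Local Notation nasg := #|{: {ffun Usub U -> Omega}}|.

Lemma ce_ext (T : finType) (nu nu' : T -> R) (K : eqType) (ka : T -> K) f f' s :
  nu =1 nu' -> f =1 f' -> ce nu ka f s = ce nu' ka f' s.
Proof.
by move=> e e'; rewrite /ce; congr (_ / _); apply: eq_bigr => t _; rewrite ?e ?e'.
Qed.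

(** Resampling changes neither the weight [nuU] nor which constraints touch U. For fixed [b], the
    factor of [b] sees only row b of [Y], while the vertices to be pinned are entries of other rows
    because [psb] excludes [b]. Given row b they are thus a uniform list off U, and [pinning]
    applies. The prefactors come from [muw_nu], the assignments to U and the touching
    constraints. *)
Lemma resampled_Delta (B Th : nat) (eta : R) (G : fg) : (#|tchG G| <= B)%N -> 0 < eta ->
  \sum_(Y | offU U Y) \sum_(t < Th) avgl A t (fun T =>
     \sum_s muw (res U G Y) s * Delta w0 psi (res U G Y) U T s) <=
  #|[pred Y : {ffun 'I_m * 'I_k -> 'I_n} | offU U Y]|%:R *
   ((C ^+ B) ^+ 2 * (nasg%:R * B%:R) * (Th%:R * eta + (B * k)%:R * C ^+ 2 / eta)).
Proof.
move=> tB eta0; pose nu := nuU psi G U.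
have nu0 : forall s, 0 < nu s := nuU_gt0 G U C1 psiC.
set Z := \sum_s nu s.
have Z0 : 0 < Z.
  by rewrite /Z (bigD1 [ffun=> w0]) //= ltr_pwDl // sumr_ge0 // => s' _; exact: ltW.
have C20 : 0 <= (C ^+ B) ^+ 2 / Z by rewrite divr_ge0 ?exprn_ge0 ?(ltW C0) ?(ltW Z0).
pose Phi b (tau : {ffun Usub U -> Omega}) T Y W := \sum_s nu s * ce nu (mp T) (fun x =>
  `|ce nu (mp (T ++ W)) (FF psi (res U G Y) U b (extU w0 tau)) x -
    ce nu (mp T) (FF psi (res U G Y) U b (extU w0 tau)) x|) s.
have b1 Y T : offU U Y -> \sum_s muw (res U G Y) s * Delta w0 psi (res U G Y) U T s <=
   (C ^+ B) ^+ 2 / Z * \sum_(tau : {ffun Usub U -> Omega}) \sum_(b | tch U (G b))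
     Phi b tau T Y (map Y (psb G U b)).
  move=> oY; have tB' : (#|tchG (res U G Y)| <= B)%N.
    by rewrite (eq_card (B := tchG G)) // => b; rewrite !inE res_tch.
  apply: (@le_trans _ _ (\sum_s (C ^+ B) ^+ 2 / Z *
     (nu s * Delta w0 psi (res U G Y) U T s))).
    apply: ler_sum => s _; rewrite mulrA ler_wpM2r ?(Delta_ge0 w0 _ _ C1 psiC) //.
    apply: le_trans (muw_nu s tB') _; rewrite nuU_res -mulrA ler_wpM2l ?exprn_ge0 ?(ltW C0) //.
    by rewrite mulrC; under eq_bigr do rewrite nuU_res.
  rewrite -mulr_sumr ler_wpM2l //; apply: eq_ler.
  rewrite /Delta; under eq_bigr do rewrite mulr_sumr.
  rewrite exchange_big /=; apply: eq_bigr => tau _.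
  under eq_bigr do rewrite mulr_sumr.
  rewrite exchange_big /=; apply: eq_big => [b|b _]; first by rewrite res_tch.
  apply: eq_bigr => s _; congr (_ * _); rewrite /Dev Wb_res //.
  apply: ce_ext => [x|x]; first exact: nuU_res.
  by congr (`|_ - _|); apply: ce_ext => // x'; exact: nuU_res.
apply: (@le_trans _ _ (\sum_(Y | offU U Y) \sum_(t < Th) avgl A t (fun T =>
   (C ^+ B) ^+ 2 / Z * \sum_(tau : {ffun Usub U -> Omega}) \sum_(b | tch U (G b))
     Phi b tau T Y (map Y (psb G U b))))).
  by apply: ler_sum => Y oY; apply: ler_sum => t _; apply: avgl_le => // T _ _; exact: b1.
have e1 : \sum_(Y | offU U Y) \sum_(t < Th) avgl A t (fun T =>
   (C ^+ B) ^+ 2 / Z * \sum_(tau : {ffun Usub U -> Omega}) \sum_(b | tch U (G b))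
     Phi b tau T Y (map Y (psb G U b))) =
   (C ^+ B) ^+ 2 / Z * \sum_(tau : {ffun Usub U -> Omega}) \sum_(b | tch U (G b))
     \sum_(t < Th) \sum_(Y | offU U Y) avgl A t (fun T => Phi b tau T Y (map Y (psb G U b))).
  rewrite exchange_big /=.
  transitivity ((C ^+ B) ^+ 2 / Z * \sum_(t < Th) \sum_(Y | offU U Y)
     \sum_(tau : {ffun Usub U -> Omega}) \sum_(b | tch U (G b))
       avgl A t (fun T => Phi b tau T Y (map Y (psb G U b)))).
    rewrite mulr_sumr; apply: eq_bigr => t _; rewrite mulr_sumr; apply: eq_bigr => Y _.
    rewrite avglZ //; congr (_ * _); rewrite avgl_sum; apply: eq_bigr => tau _.
    by rewrite avgl_sum.
  congr (_ * _).
  under eq_bigr do rewrite exchange_big; rewrite exchange_big /=; apply: eq_bigr => tau _.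
  under eq_bigr do rewrite exchange_big; rewrite exchange_big /=; apply: eq_bigr => b _.
  by [].
rewrite e1.
have b2 tau b : tch U (G b) -> \sum_(t < Th) \sum_(Y | offU U Y)
    avgl A t (fun T => Phi b tau T Y (map Y (psb G U b))) <=
    #|[pred Y : {ffun 'I_m * 'I_k -> 'I_n} | offU U Y]|%:R *
    (Z * (Th%:R * eta + (B * k)%:R * C ^+ 2 / eta)).
  move=> tb.
  have -> : \sum_(t < Th) \sum_(Y | offU U Y)
    avgl A t (fun T => Phi b tau T Y (map Y (psb G U b))) =
    \sum_(Y | offU U Y) \sum_(t < Th)
      avgl A t (fun T => avgl A (size (psb G U b)) (Phi b tau T Y)).
    rewrite [RHS]exchange_big; apply: eq_bigr => t _ /=; rewrite -2!avgl_sum.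
    apply: eq_avgl => T _.
    have inE' (Y : {ffun 'I_m * 'I_k -> 'I_n}) : offU U Y = inAr A Y by apply: eq_forallb => ap; rewrite inE.
    rewrite (eq_bigl _ _ inE') [RHS](eq_bigl _ _ inE').
    apply: (@marg _ _ A A0 (psb G U b) (Phi b tau T)).
      by rewrite filter_uniq // enum_uniq.
    move=> Y Y' W h; apply: eq_bigr => s _; congr (_ * _).
    have hF x : FF psi (res U G Y) U b (extU w0 tau) x = FF psi (res U G Y') U b (extU w0 tau) x.
      by apply: FF_res => p; apply: h; rewrite mem_filter /= eqxx andbF.
    by apply: ce_ext => // x; congr (`|_ - _|); apply: ce_ext.
  rewrite mulr_natl -sumr_const; apply: ler_sum => Y _.
  have FC s : `|FF psi (res U G Y) U b (extU w0 tau) s| <= C.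
    have /andP[h1 h2] := FF_bd (res U G Y) U psiC b (extU w0 tau) s.
    by rewrite ger0_norm // (le_trans _ h1) // invr_ge0 ltW.
  apply: le_trans (pinning Th (size (psb G U b)) A0 nu0 FC eta0) _.
  rewrite ler_pM2l // lerD2l -!mulrA ler_wpM2r //.
    by rewrite mulr_ge0 ?divr_ge0 ?(ltW eta0) ?(ltW C0).
  by rewrite ler_nat size_psb.
apply: (@le_trans _ _ ((C ^+ B) ^+ 2 / Z * \sum_(tau : {ffun Usub U -> Omega})
  \sum_(b | tch U (G b)) (#|[pred Y : {ffun 'I_m * 'I_k -> 'I_n} | offU U Y]|%:R *
    (Z * (Th%:R * eta + (B * k)%:R * C ^+ 2 / eta))))).
  by rewrite ler_wpM2l //; apply: ler_sum => tau _; apply: ler_sum => b tb; exact: b2.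
set N1 := #|[pred Y : {ffun 'I_m * 'I_k -> 'I_n} | offU U Y]|%:R : R.
set Q := Th%:R * eta + _.
have Q0 : 0 <= Q.
  by rewrite addr_ge0 ?mulr_ge0 ?exprn_ge0 ?invr_ge0 ?(ltW eta0) ?(ltW C0).
rewrite !sumr_const.
have -> : N1 * ((C ^+ B) ^+ 2 * (nasg%:R * B%:R) * Q) =
   (C ^+ B) ^+ 2 / Z * ((N1 * (Z * Q) * B%:R) * nasg%:R).
  by field; exact: lt0r_neq0.
rewrite ler_wpM2l // -[leLHS]mulr_natr ler_wpM2r // -[leLHS]mulr_natr ler_wpM2l ?ler_nat //.
by rewrite mulr_ge0 // mulr_ge0 // ltW.
Qed.
End FixedSet.
End FixedSize.
End Model.

Ltac nneg := repeat first [done | assumption | exact: ltW | exact: ler0n | apply: addr_ge0 |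
  apply: mulr_ge0 | apply: exprn_ge0 | rewrite invr_ge0].

Section FirstMoment.
Variables (Omega : finType) (w0 : Omega) (k : nat) (I : finType).
Variable psi : I -> k.-tuple Omega -> R.
Hypothesis k_gt0 : (0 < k)%N.
Variable C : R.
Hypothesis C1 : 1 <= C.
Hypothesis psiC : forall i t, C^-1 <= psi i t <= C.
Variable P : I -> R.
Hypothesis P0 : forall i, 0 <= P i.
Hypothesis P1 : \sum_i P i = 1.
Variables (n m : nat).
Hypothesis n0 : (0 < n)%N.
Local Notation fg := (factor_graph k I n m).
Local Notation cfg := (config Omega n).
Local Notation Ex := (@Ex k I P n m).

Definition inn (U : {set 'I_n}) (v : k.-tuple 'I_n * I) : bool := [forall p, tnth v.1 p \in U].

Lemma innE (U : {set 'I_n}) (G : fg) a : inn U (G a) = inner G U a.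
Proof.
apply/forallP/subsetP => [h x /nbrP[p ->]|h p]; first exact: h.
exact: h (nbr_tnth G a p).
Qed.

(* Counts the ordered choices of N constraints inside U; unlike the indicator of
   a cavity, it has a product form whose expectation factorises. *)
Definition wN N (U : {set 'I_n}) (G : fg) : R :=
  \sum_(io : {ffun 'I_N -> 'I_m} | injectiveb io) \prod_(j < N) (inn U (G (io j)))%:R.

Lemma wN_ge0 N U G : 0 <= wN N U G.
Proof. by apply: sumr_ge0 => io _; apply: prodr_ge0 => j _; rewrite ler0n. Qed.

Lemma wN_ge1 N U G : (N <= #|[pred a | inner G U a]|)%N -> 1 <= wN N U G.
Proof.
move=> h; case: N h => [|N] h.
  pose io : {ffun 'I_0 -> 'I_m} := ffun0 (card_ord 0).
  rewrite /wN (bigD1 io) /=; last by apply/injectiveP => -[].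
  rewrite big_ord0 lerDl; apply: sumr_ge0 => io' _.
  by apply: prodr_ge0 => j _; rewrite ler0n.
have [a0 ha0] : exists a, a \in [pred a | inner G U a].
  by apply/card_gt0P; apply: leq_trans h.
pose io : {ffun 'I_N.+1 -> 'I_m} := [ffun j : 'I_N.+1 => nth a0 (enum [pred a | inner G U a]) j].
have sz (j : 'I_N.+1) : (j < size (enum [pred a | inner G U a]))%N.
  by rewrite -cardE; apply: leq_trans (ltn_ord j) h.
rewrite /wN (bigD1 io) /=; last first.
  apply/injectiveP => i j; rewrite !ffunE => /eqP.
  by rewrite nth_uniq ?enum_uniq // => /eqP/val_inj.
rewrite big1 ?lerDl; last first.
  move=> j _; rewrite innE ffunE.
  by have := mem_nth a0 (sz j); rewrite mem_enum inE => ->.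
by apply: sumr_ge0 => io' _; apply: prodr_ge0 => j _; rewrite ler0n.
Qed.

Lemma card_inj_le N : #|[pred io : {ffun 'I_N -> 'I_m} | injectiveb io]|%:R <= m%:R ^+ N :> R.
Proof.
rewrite -natrX ler_nat; apply: leq_trans (max_card _) _.
by rewrite card_ffun !card_ord.
Qed.

Lemma Ex_inner N (U : {set 'I_n}) (io : {ffun 'I_N -> 'I_m}) : injectiveb io ->
  Ex (fun G => \prod_(j < N) (inn U (G (io j)))%:R) = (#|U|%:R / n%:R) ^+ (k * N).
Proof.
move/injectiveP => ioi.
rewrite (Ex_inj_prod1 P1 n0 (fun _ v => (inn U v)%:R) ioi).
by under eq_bigr do rewrite (Ec_inner k P1); rewrite prodr_const card_ord exprM.
Qed.

Lemma Ex_wN N (U : {set 'I_n}) : Ex (wN N U) <= m%:R ^+ N * (#|U|%:R / n%:R) ^+ (k * N).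
Proof.
rewrite /wN Ex_sum; under eq_bigr do rewrite Ex_inner //.
rewrite sumr_const -[leLHS]mulr_natl ler_wpM2r ?card_inj_le //.
by rewrite exprn_ge0 // divr_ge0.
Qed.

(** The N chosen constraints contribute at most N; every other constraint is independent of them and
    touches U with probability at most k |U| / n. *)
Lemma Ex_wN_tch N (U : {set 'I_n}) :
  Ex (fun G => wN N U G * #|[pred b | tch U (G b)]|%:R) <=
  m%:R ^+ N * (#|U|%:R / n%:R) ^+ (k * N) * (N%:R + m%:R * (k%:R * #|U|%:R / n%:R)).
Proof.
have x0 : 0 <= #|U|%:R / n%:R :> R by rewrite divr_ge0.
have kx0 : 0 <= k%:R * #|U|%:R / n%:R :> R by rewrite divr_ge0 ?mulr_ge0.
pose F (io : {ffun 'I_N -> 'I_m}) G := \prod_(j < N) (inn U ((G : fg) (io j)))%:R : R.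
have F0 io G : 0 <= F io G by apply: prodr_ge0 => j _; rewrite ler0n.
have -> : Ex (fun G => wN N U G * #|[pred b | tch U (G b)]|%:R) =
  \sum_(io : {ffun 'I_N -> 'I_m} | injectiveb io)
   Ex (fun G => F io G * #|[pred b | tch U (G b)]|%:R).
  by rewrite -Ex_sum; apply: eq_Ex => G; rewrite mulr_suml.
have b1 (io : {ffun 'I_N -> 'I_m}) : injectiveb io -> Ex (fun G => F io G * #|[pred b | tch U (G b)]|%:R) <=
    (#|U|%:R / n%:R) ^+ (k * N) * (N%:R + m%:R * (k%:R * #|U|%:R / n%:R)).
  move=> /injectiveP ioi; have ioi' : injectiveb io by apply/injectiveP.
  have b2 a : a \notin codom io -> Ex (fun G => F io G * (tch U (G a))%:R) <=
      (#|U|%:R / n%:R) ^+ (k * N) * (k%:R * #|U|%:R / n%:R).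
    move=> na; pose io' (o : option 'I_N) := if o is Some j then io j else a.
    pose q (o : option 'I_N) (v : k.-tuple 'I_n * I) : R :=
      if o is Some _ then (inn U v)%:R else (tch U v)%:R.
    have ioi2 : injective io'.
      move=> [i|] [j|] //= e; first by rewrite (ioi _ _ e).
        by rewrite -e codom_f in na.
      by rewrite e codom_f in na.
    have opt (f : option 'I_N -> R) : \prod_o f o = f None * \prod_j f (Some j).
      rewrite (bigD1 None) //=; congr (_ * _).
      rewrite (reindex_omap Some id) /=; last by case.
      by apply: eq_bigl => j; rewrite eqxx.
    have -> : Ex (fun G => F io G * (tch U (G a))%:R) = Ex (fun G => \prod_o q o (G (io' o))).
      by apply: eq_Ex => G; rewrite opt /= mulrC.
    rewrite (Ex_inj_prod1 P1 n0 q ioi2) opt /= mulrC.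
    under eq_bigr do rewrite (Ec_inner k P1).
    rewrite prodr_const card_ord -exprM ler_wpM2l ?exprn_ge0 //.
    exact: (Ec_touch k P0 P1 n0 U).
  apply: (@le_trans _ _ (Ex (fun G => N%:R * F io G + \sum_(a | a \notin codom io)
     F io G * (tch U (G a))%:R))).
    apply: (Ex_le P0 n0) => G; rewrite -mulr_sumr -(sum_indic (fun a => tch U (G a))).
    rewrite (bigID (mem (codom io))) /= mulrDr lerD2r mulrC ler_wpM2r //.
    have -> : N%:R = \sum_(a | a \in codom io) 1 :> R.
      by rewrite sumr_const (card_codom ioi) card_ord.
    by apply: ler_sum => a _; case: (tch _ _).
  rewrite ExD ExZ Ex_sum Ex_inner // mulrDr [N%:R * _]mulrC lerD2l.
  apply: (@le_trans _ _ (\sum_(a < m | a \notin codom io)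
     (#|U|%:R / n%:R) ^+ (k * N) * (k%:R * #|U|%:R / n%:R))).
    by apply: ler_sum => a; exact: b2.
  rewrite sumr_const -[leLHS]mulr_natl mulrCA ler_wpM2l ?exprn_ge0 //.
  rewrite ler_wpM2r // ler_nat; apply: leq_trans (max_card _) _; by rewrite card_ord.
apply: (@le_trans _ _ (\sum_(io : {ffun 'I_N -> 'I_m} | injectiveb io)
  (#|U|%:R / n%:R) ^+ (k * N) * (N%:R + m%:R * (k%:R * #|U|%:R / n%:R)))).
  by apply: ler_sum => io; exact: b1.
rewrite sumr_const -[leLHS]mulr_natl -[leRHS]mulrA ler_wpM2r ?card_inj_le //.
by rewrite mulr_ge0 ?exprn_ge0 // addr_ge0 // mulr_ge0.
Qed.

(** The lists are drawn from all vertices, not from the complement of U, because a single list has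
    to serve all U at once. *)
Definition Ftot (Th : nat) (G : fg) (U : {set 'I_n}) : R :=
  \sum_(t < Th) avgl [set: 'I_n] t (fun T => \sum_s muw psi G s * err w0 psi G U (pin T s)).

Lemma Ftot_ge0 Th (G : fg) U : 0 <= Ftot Th G U.
Proof.
have T0 : [set: 'I_n] != set0 by apply/set0Pn; exists (Ordinal n0); rewrite inE.
apply: sumr_ge0 => t _; rewrite -[leLHS](avgl_cst T0 t (0 : R)); apply: avgl_le => // T _ _.
by apply: sumr_ge0 => s _; rewrite mulr_ge0 ?(muw_ge0 C1 psiC) // err_ge0.
Qed.

Lemma wN_res N (U : {set 'I_n}) (G : fg) Y : wN N U (res U G Y) = wN N U G.
Proof.
apply: eq_bigr => io _; apply: eq_bigr => j _; congr (nat_of_bool _)%:R.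
by apply: eq_forallb => p; rewrite res_in.
Qed.

(** The summands on the right come from Markov's inequality for more than B touching constraints,
    from lists meeting U, and from [err_Delta]. The weight [wN] replaces the indicator; it is
    invariant under resampling, so [resampled_Delta] can be used inside the expectation. *)
Lemma first_moment_err (N l B Th : nat) (d0 eta : R) (U : {set 'I_n}) :
  #|U| = l -> (l < n)%N -> (0 < B)%N -> (0 < Th)%N -> 0 < d0 -> 0 < eta ->
  Ex (fun G => (pb (CAV2 G U /\ (N <= #|[pred a | inner G U a]|)%N))%:R * Ftot Th G U) <=
  m%:R ^+ N * (l%:R / n%:R) ^+ (k * N) * Th%:R *
  (2%:R * (N%:R + m%:R * (k%:R * l%:R / n%:R)) / B%:R + 2%:R * Th%:R * l%:R / n%:R +
   eps1 C B d0 + 2%:R / d0 * ((C ^+ B) ^+ 2 * ((#|Omega| ^ l)%:R * B%:R) *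
      (eta + (B * k)%:R * C ^+ 2 / (Th%:R * eta)))).
Proof.
move=> Ul ln B0 Th0 d00 eta0.
have A0 : ~: U != set0.
  rewrite -card_gt0; have := cardsC U; rewrite card_ord Ul; lia.
have B0' : 0 < B%:R :> R by rewrite ltr0n.
have Th0' : 0 < Th%:R :> R by rewrite ltr0n.
have n0' : 0 < n%:R :> R by rewrite ltr0n.
have C0 : 0 < C by apply: lt_le_trans C1.
pose tB (G : fg) : R := (#|[pred b | tch U (G b)]| <= B)%N%:R.
pose FD (G : fg) := \sum_(t < Th) avgl (~: U) t (fun T =>
     \sum_s muw psi G s * Delta w0 psi G U T s).
have e1_ge0 : 0 <= eps1 C B d0.
  rewrite mulrn_wge0 // subr_ge0 exprn_ege1 // lerDl mulr_ge0 ?(ltW d00) //.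
  by rewrite exprn_ge0 // exprn_ge0 // ltW.
have muerr0 (G : fg) T : 0 <= \sum_s muw psi G s * err w0 psi G U (pin T s) <= 2%:R.
  apply/andP; split.
    apply: sumr_ge0 => s _; rewrite mulr_ge0 ?(muw_ge0 C1 psiC) //; exact: err_ge0.
  by apply: (muw_avg w0 C1 psiC) => s; exact: (err_bound w0 C1 psiC).
have FD0 G : 0 <= FD G.
  apply: sumr_ge0 => t _; rewrite -[leLHS](avgl_cst A0 t (0 : R)); apply: avgl_le => // T _ _ /=.
  apply: sumr_ge0 => s _; rewrite mulr_ge0 ?(muw_ge0 C1 psiC) //.
  exact: (Delta_ge0 w0 _ _ C1 psiC).
have F2 G : Ftot Th G U <= 2%:R * Th%:R.
  rewrite mulr_natr -[X in _ *+ X]card_ord -sumr_const; apply: ler_sum => t _.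
  have T0 : [set: 'I_n] != set0 by apply/set0Pn; exists (Ordinal n0); rewrite inE.
  rewrite -[leRHS](avgl_cst T0 t (2%:R : R)); apply: avgl_le => // T _ _.
  by case/andP: (muerr0 G T).
have pt G : (pb (CAV2 G U /\ (N <= #|[pred a | inner G U a]|)%N))%:R * Ftot Th G U <=
   2%:R * Th%:R / B%:R * (wN N U G * #|[pred b | tch U (G b)]|%:R) +
   (2%:R * Th%:R * l%:R / n%:R * Th%:R + Th%:R * eps1 C B d0) * wN N U G +
   2%:R / d0 * (wN N U G * tB G * FD G).
  have w0' := wN_ge0 N U G.
  have t1 : 0 <= 2%:R * Th%:R / B%:R * (wN N U G * #|[pred b | tch U (G b)]|%:R).
    by nneg.
  have t2 : 0 <= (2%:R * Th%:R * l%:R / n%:R * Th%:R + Th%:R * eps1 C B d0) * wN N U G.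
    by nneg.
  have t3 : 0 <= 2%:R / d0 * (wN N U G * tB G * FD G).
    by nneg; exact: FD0.
  case: pbP => [[cav hN]|_]; last by rewrite mul0r; apply: addr_ge0 => //; exact: addr_ge0.
  have w1 := wN_ge1 hN; rewrite mul1r.
  have [hB|hB] := leqP #|[pred b | tch U (G b)]| B; last first.
    apply: le_trans (F2 G) _; rewrite -addrA -[leLHS]addr0 lerD //; last exact: addr_ge0.
    set c := #|_|%:R.
    have c1 : 1 <= c / B%:R by rewrite ler_pdivlMr // mul1r ler_nat ltnW.
    have -> : 2%:R * Th%:R / B%:R * (wN N U G * c) = 2%:R * Th%:R * (wN N U G * (c / B%:R)) by ring.
    rewrite -[leLHS]mulr1 ler_wpM2l //; first by nneg.
    by rewrite -[leLHS]mulr1 ler_pM.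
  have tB1 : tB G = 1 by rewrite /tB hB.
  have hF : Ftot Th G U <= (2%:R * Th%:R * l%:R / n%:R * Th%:R + Th%:R * eps1 C B d0) +
       2%:R / d0 * FD G.
    rewrite /Ftot /FD.
    apply: (@le_trans _ _ (\sum_(t < Th) ((2%:R * Th%:R * l%:R / n%:R + eps1 C B d0) +
       2%:R / d0 * avgl (~: U) t (fun T =>
     \sum_s muw psi G s * Delta w0 psi G U T s)))); last first.
      rewrite big_split /= -mulr_sumr sumr_const card_ord -[X in X + _ <= _]mulr_natr.
      by apply: eq_ler; ring.
    apply: ler_sum => t _.
    apply: le_trans (avgl_avoid t A0 (muerr0 G)) _.
    rewrite card_ord Ul addrC -addrA; apply: lerD.
      rewrite ler_wpM2r ?invr_ge0 // ler_wpM2r // mulrC ler_wpM2l // ler_nat.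
      exact: ltnW.
    rewrite -(avgl_cst A0 t (eps1 C B d0)) -avglZ // -avglD //.
    apply: avgl_le => // T _ TA; rewrite mulr_sumr.
    apply: (@le_trans _ _ (\sum_s muw psi G s * (eps1 C B d0 + 2%:R / d0 * Delta w0 psi G U T s))).
      apply: ler_sum => s _; rewrite ler_wpM2l ?(muw_ge0 C1 psiC) //.
      apply: (err_Delta w0 k_gt0 C1 psiC s d00 cav _ hB).
      by apply/allP => x /(allP TA); rewrite /= in_setC.
    apply: eq_ler.
    under eq_bigr do rewrite mulrDr.
    rewrite big_split /= -mulr_suml (muw_sum w0 C1 psiC) mul1r; congr (_ + _).
    by apply: eq_bigr => s _; rewrite mulrCA.
  apply: le_trans hF _; rewrite tB1 mulr1.
  rewrite -[leLHS]add0r addrA lerD //.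
    by rewrite lerD // -[leLHS]mulr1 ler_wpM2l //; nneg.
  by rewrite ler_wpM2l ?divr_ge0 ?(ltW d00) // -[leLHS]mul1r ler_wpM2r.
apply: (le_trans (Ex_le P0 n0 pt)).
rewrite !ExD !ExZ.
set W := m%:R ^+ N * (l%:R / n%:R) ^+ (k * N).
have W0 : 0 <= W by rewrite mulr_ge0 ?exprn_ge0 ?divr_ge0.
have EW : Ex (wN N U) <= W by have := Ex_wN N U; rewrite Ul.
have EWt : Ex (fun G => wN N U G * #|[pred b | tch U (G b)]|%:R) <=
    W * (N%:R + m%:R * (k%:R * l%:R / n%:R)) by have := Ex_wN_tch N U; rewrite Ul.
set X := (C ^+ B) ^+ 2 * ((#|Omega| ^ l)%:R * B%:R) *
      (eta + (B * k)%:R * C ^+ 2 / (Th%:R * eta)).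
have EWD : Ex (fun G => wN N U G * tB G * FD G) <= W * (Th%:R * X).
  have X0 : 0 <= Th%:R * X.
    by rewrite /X; nneg.
  have N0 : 0 < #|[pred Y : {ffun 'I_m * 'I_k -> 'I_n} | offU U Y]|%:R :> R.
    rewrite ltr0n; apply/card_gt0P; case/set0Pn: A0 => x; rewrite inE => xU.
    by exists [ffun=> x]; rewrite inE; apply/forallP => ap; rewrite ffunE.
  rewrite -(ler_pM2l N0) -resample -Ex_sum.
  apply: (@le_trans _ _ (Ex (fun G => (#|[pred Y : {ffun 'I_m * 'I_k -> 'I_n} | offU U Y]|%:R
      * (Th%:R * X)) * wN N U G))).
    apply: (Ex_le P0 n0) => G.
    have -> : \sum_(Y | offU U Y) wN N U (res U G Y) * tB (res U G Y) * FD (res U G Y) =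
       wN N U G * tB G * \sum_(Y | offU U Y) FD (res U G Y).
      rewrite mulr_sumr; apply: eq_bigr => Y _; rewrite wN_res; congr (_ * _ * _).
      rewrite /tB; congr (nat_of_bool (_ <= _)%N)%:R; apply: eq_card => b.
      by rewrite !inE res_tch.
    rewrite -mulrA [leRHS]mulrC ler_wpM2l ?wN_ge0 // /tB.
    have [hB|_] := leqP; last by rewrite mul0r mulr_ge0 // ltW.
    rewrite mul1r; apply: le_trans (resampled_Delta w0 C1 psiC A0 Th hB eta0) _.
    rewrite ler_pM2l // card_ffun card_sig (eq_card (B := U)) // Ul /X.
    apply: eq_ler; field.
    by rewrite !gt_eqF.
  rewrite ExZ -[leLHS]mulrA ler_pM2l //.
  by rewrite [leRHS]mulrC ler_wpM2l.
have i1 : 2%:R * Th%:R / B%:R * Ex (fun G => wN N U G * #|[pred b | tch U (G b)]|%:R) <=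
   2%:R * Th%:R / B%:R * (W * (N%:R + m%:R * (k%:R * l%:R / n%:R))).
  by rewrite ler_wpM2l // divr_ge0 // mulr_ge0.
have i2 : (2%:R * Th%:R * l%:R / n%:R * Th%:R + Th%:R * eps1 C B d0) * Ex (wN N U) <=
  (2%:R * Th%:R * l%:R / n%:R * Th%:R + Th%:R * eps1 C B d0) * W.
  by rewrite ler_wpM2l //; nneg.
have i3 : 2%:R / d0 * Ex (fun G => wN N U G * tB G * FD G) <= 2%:R / d0 * (W * (Th%:R * X)).
  by rewrite ler_wpM2l // divr_ge0 // ltW.
apply: (le_trans (lerD (lerD i1 i2) i3)).
apply: eq_ler; ring.
Qed.
End FirstMoment.

Lemma pow_near1 (p : nat) (e : R) : 0 < e -> exists2 x : R, 0 < x & (1 + x) ^+ p <= 1 + e.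
Proof.
elim: p e => [|p IH] e e0; first by exists 1; rewrite ?expr0 ?lerDl ?ltW.
pose e' := Num.min (e / 3%:R) 1.
have e'0 : 0 < e' by rewrite lt_min ltr01 andbT divr_gt0.
have e'1 : e' <= 1 by rewrite ge_min lexx orbT.
have e'3 : e' <= e / 3%:R by rewrite ge_min lexx.
have [x x0 hx] := IH e' e'0.
pose y := Num.min x e'.
have y0 : 0 < y by rewrite lt_min x0.
have yx : y <= x by rewrite ge_min lexx.
have ye : y <= e' by rewrite ge_min lexx orbT.
exists y => //; rewrite exprS.
have h : (1 + y) ^+ p <= 1 + e'.
  by apply: le_trans hx; apply: lerXn2r; rewrite ?nnegrE ?lerD2l // addr_ge0 // ltW.
apply: (@le_trans _ _ ((1 + y) * (1 + e'))); first by rewrite ler_wpM2l // addr_ge0 // ltW.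
have : y * e' <= e' * 1 by rewrite ler_pM // ltW.
rewrite mulr1 => h'; lra.
Qed.

Lemma ex_nat_ge (x : R) : exists N : nat, x <= N%:R.
Proof.
exists (Num.truncn `|x|).+1; apply: le_trans (ler_norm x) _; apply: ltW.
exact: truncnS_gt.
Qed.

(* For d = k - 1 this is the least number of constraints that can reduce
   l variables to r components. *)
Definition cdiv (a d : nat) : nat := ((a + d.-1) %/ d)%N.

Lemma cdiv_le a d N : (0 < d)%N -> (a <= N * d)%N -> (cdiv a d <= N)%N.
Proof. by move=> d0 h; rewrite /cdiv -ltnS ltn_divLR //; lia. Qed.

Lemma cdiv_ge a d : (0 < d)%N -> (a <= cdiv a d * d)%N.
Proof. by move=> d0; rewrite /cdiv; have := divn_eq (a + d.-1) d; have := ltn_pmod (a + d.-1) d0; lia. Qed.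

Lemma cdiv_lt a d : (0 < d)%N -> (cdiv a d * d < a + d)%N.
Proof. by move=> d0; rewrite /cdiv; have := leq_trunc_div (a + d.-1) d; lia. Qed.

(** * Expected total error over all cavities *)

Section UpperBound.
Variables (Omega : finType) (w0 : Omega) (k : nat) (I : finType).
Variable psi : I -> k.-tuple Omega -> R.
Hypothesis k_gt1 : (1 < k)%N.
Variable C : R.
Hypothesis C1 : 1 <= C.
Hypothesis psiC : forall i t, C^-1 <= psi i t <= C.
Variable P : I -> R.
Hypothesis P0 : forall i, 0 <= P i.
Hypothesis P1 : \sum_i P i = 1.

Let k_gt0 : (0 < k)%N. Proof. exact: ltnW. Qed.

(** Order of choice: B against the number of touching constraints, [d0] against B, [eta] against
    both, Th against all of these, and finally n against Th. The five resulting terms are at most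
    [del] / 5 each. *)
Lemma choose_params (N l M : nat) (del : R) : 0 < del ->
  exists2 Th0, (0 < Th0)%N & forall Th, (Th0 <= Th)%N -> exists n0 : nat, forall n m : nat,
    (n0 <= n)%N -> (m <= M * n)%N -> exists (B : nat) (d0 eta : R),
    [/\ (l < n)%N, (0 < B)%N, 0 < d0, 0 < eta &
  2%:R * (N%:R + m%:R * (k%:R * l%:R / n%:R)) / B%:R + 2%:R * Th%:R * l%:R / n%:R +
   eps1 C B d0 + 2%:R / d0 * ((C ^+ B) ^+ 2 * ((#|Omega| ^ l)%:R * B%:R) *
      (eta + (B * k)%:R * C ^+ 2 / (Th%:R * eta))) <= del].
Proof.
move=> del0; have C0 : 0 < C by apply: lt_le_trans C1.
pose e := del / 5%:R; have e0 : 0 < e by rewrite divr_gt0.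
pose a := 2%:R * (N%:R + M%:R * (k%:R * l%:R)) : R.
have a0 : 0 <= a by rewrite /a; nneg.
have [B' hB'] := ex_nat_ge (a / e); pose B := B'.+1.
have B0 : 0 < B%:R :> R by rewrite ltr0n.
have hB : a / B%:R <= e.
  rewrite ler_pdivrMr // mulrC -ler_pdivrMr //; apply: le_trans hB' _.
  by rewrite ler_nat.
pose CB := (C ^+ B) ^+ 2; have CB0 : 0 < CB by rewrite !exprn_gt0.
have [x x0 hx] := pow_near1 (4 * B + 2) (divr_gt0 e0 (ltr0n R 2)).
pose d0 := x / CB; have d00 : 0 < d0 by rewrite divr_gt0.
have he : eps1 C B d0 <= e.
  rewrite /eps1 -/CB (_ : CB * d0 = x); last by rewrite /d0 mulrC divfK // gt_eqF.
  by rewrite -mulr_natr -ler_pdivlMr // lerBlDl.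
pose c := 2%:R / d0 * (CB * ((#|Omega| ^ l)%:R * B%:R)).
have c0 : 0 < c.
  rewrite mulr_gt0 ?divr_gt0 // mulr_gt0 // mulr_gt0 // ltr0n expn_gt0.
  by apply/orP; left; apply/card_gt0P; exists w0.
pose eta := e / c; have eta0 : 0 < eta by rewrite divr_gt0.
pose b := c * ((B * k)%:R * C ^+ 2 / eta).
have [Th0 hTh0] := ex_nat_ge (b / e).
exists Th0.+1 => // Th hTh.
have Th_gt0 : 0 < Th%:R :> R by rewrite ltr0n; exact: leq_trans hTh.
have hb : b / Th%:R <= e.
  rewrite ler_pdivrMr // mulrC -ler_pdivrMr //; apply: le_trans hTh0 _.
  by rewrite ler_nat ltnW.
have [n1 hn1] := ex_nat_ge (2%:R * Th%:R * l%:R / e).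
exists (maxn n1 l).+1 => n m hn hm.
have n0 : 0 < n%:R :> R by rewrite ltr0n; exact: leq_trans hn.
exists B, d0, eta; split=> //; first exact: leq_ltn_trans (leq_maxr n1 l) hn.
have h1 : 2%:R * (N%:R + m%:R * (k%:R * l%:R / n%:R)) / B%:R <= e.
  apply: le_trans hB; rewrite ler_pM2r ?invr_gt0 // ler_pM2l // lerD2l.
  rewrite mulrA ler_pdivrMr // mulrAC ler_wpM2r //; first by nneg.
  by rewrite -natrM ler_nat.
have h2 : 2%:R * Th%:R * l%:R / n%:R <= e.
  rewrite ler_pdivrMr // [leRHS]mulrC -ler_pdivrMr //; apply: le_trans hn1 _.
  by rewrite ler_nat; exact: leq_trans (leq_maxl n1 l) (ltnW hn).
have h3 : 2%:R / d0 * ((C ^+ B) ^+ 2 * ((#|Omega| ^ l)%:R * B%:R) *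
      (eta + (B * k)%:R * C ^+ 2 / (Th%:R * eta))) = e + b / Th%:R.
  transitivity (c * (eta + (B * k)%:R * C ^+ 2 / (Th%:R * eta))).
    by rewrite /c -/CB [LHS]mulrA.
  rewrite /b mulrDr; congr (_ + _); first by rewrite /eta mulrC divfK // gt_eqF.
  by field; rewrite !gt_eqF.
rewrite h3 (_ : del = e + e + e + (e + e)); last by rewrite /e; field.
by apply: lerD; [apply: lerD => //; apply: lerD | rewrite lerD2l].
Qed.

(** By Euler's formula the inner constraints remove l - r components in total, each of them at most
    k - 1. *)
Lemma Cset_facts n m (G : factor_graph k I n m) l r (U : {set 'I_n}) : U \in Cset G l r ->
  #|U| = l /\ (CAV2 G U /\ (cdiv (l - r) k.-1 <= #|[pred a | inner G U a]|)%N).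
Proof.
rewrite inE => /andP[/andP[/pbP[_ [cav1 [cav2 _]]] /eqP Ul] /eqP nr]; split=> //; split=> //.
apply: cdiv_le; first by rewrite -ltnS prednK.
have := cavity_forest k_gt0 cav1; rewrite Ul nr => e.
have -> : (l - r = \sum_(a | inner G U a) (#|nbr G a| - 1))%N by rewrite -e addKn.
rewrite -sum_nat_const; apply: leq_sum => a _; rewrite -subn1 leq_sub2r //.
apply: leq_trans (_ : (#|(G a).1| <= k)%N).
  by apply: subset_leq_card; apply/subsetP => x; rewrite inE.
by apply: leq_trans (card_size _) _; rewrite size_tuple.
Qed.

(* The order of magnitude of the number of cavities in C(G, l, r), if there are
   any. *)
Definition scale (n l r : nat) : R := n%:R ^+ l / n%:R ^+ (k.-1 * cdiv (l - r) k.-1).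

(** There are at most n^l sets U, and for m <= M n the weight m^N (l/n)^(kN) from the first moment
    is of order n^(-(k-1)N). *)
Lemma upper_bound (M l r : nat) (del : R) : 0 < del ->
  exists2 Th0, (0 < Th0)%N & forall Th, (Th0 <= Th)%N -> exists n0 : nat, forall n m : nat,
    (n0 <= n)%N -> (m <= M * n)%N ->
   @Ex k I P n m (fun G => \sum_(U in Cset G l r) Ftot w0 psi Th G U) <=
     Th%:R * del * scale n l r.
Proof.
move=> del0; set N := cdiv (l - r) k.-1.
(* The constant lost when m and l are traded for [scale]; the summand 1 keeps it positive in all
   cases. *)
pose a : R := M%:R ^+ N * l%:R ^+ (k * N) + 1.
have a0 : 0 < a by rewrite ltr_wpDl // ; nneg.
have [Th0 Th00 hTh] := choose_params N l M (divr_gt0 del0 a0).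
exists Th0 => // Th /[dup] ThTh0 /hTh[n0 hn0]; exists n0.+1 => n m hn hm.
have [|B [d0 [eta [ln B0 d00 eta0 hle]]]] := hn0 n m _ hm; first exact: ltnW.
have n_gt0 : (0 < n)%N by exact: leq_trans hn.
have nR : 0 < n%:R :> R by rewrite ltr0n.
have Th_gt0 : (0 < Th)%N by exact: leq_trans ThTh0.
pose F (U : {set 'I_n}) (G : factor_graph k I n m) :=
  (pb (CAV2 G U /\ (N <= #|[pred a | inner G U a]|)%N))%:R * Ftot w0 psi Th G U.
apply: (@le_trans _ _ (\sum_(U : {set 'I_n} | #|U| == l) Ex P (F U))).
  rewrite -Ex_sum; apply: (Ex_le P0 n_gt0) => G; rewrite [leLHS]big_mkcond [leRHS]big_mkcond /=.
  apply: ler_sum => U _; case: ifP => [/Cset_facts[-> h]|_].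
    by rewrite eqxx /F; case: pbP => // _; rewrite mul1r.
  by case: ifP => // _; rewrite mulr_ge0 // (Ftot_ge0 w0 C1 psiC n_gt0).
pose W : R := m%:R ^+ N * (l%:R / n%:R) ^+ (k * N) * Th%:R * (del / a).
have W0 : 0 <= W by rewrite /W; nneg; rewrite ltW.
apply: (@le_trans _ _ (\sum_(U : {set 'I_n} | #|U| == l) W)).
  apply: ler_sum => U /eqP Ul.
  apply: le_trans (first_moment_err w0 k_gt0 C1 psiC P0 P1 m n_gt0 N Ul ln B0 Th_gt0 d00 eta0) _.
  by apply: ler_wpM2l => //; nneg.
rewrite sumr_const -[leLHS]mulr_natl.
apply: (@le_trans _ _ (n%:R ^+ l * W)).
  rewrite ler_wpM2r // -natrX ler_nat.
  have := card_draws 'I_n l; rewrite cardsE card_ord => ->.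
  have := bin_ffact n l; have : (n ^_ l <= n ^ l)%N.
    elim: (l) {ln} => // j IH; rewrite ffactnSr expnSr leq_mul //; exact: leq_subr.
  by move=> h1 h2; apply: leq_trans h1; rewrite -h2 leq_pmulr // fact_gt0.
have nk : n%:R ^+ (k * N) = n%:R ^+ N * n%:R ^+ (k.-1 * N) :> R.
  by rewrite -exprD; congr (_ ^+ _); rewrite -{1}(prednK k_gt0) mulSn.
have hm' : m%:R ^+ N <= M%:R ^+ N * n%:R ^+ N :> R.
  by rewrite -exprMn -natrM lerXn2r ?nnegrE ?ler_nat.
rewrite /scale -/N.
have -> : n%:R ^+ l * W = (m%:R ^+ N / n%:R ^+ N * l%:R ^+ (k * N) / a) *
   (Th%:R * del * (n%:R ^+ l / n%:R ^+ (k.-1 * N))).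
  rewrite /W expr_div_n nk; field.
  by rewrite !expf_neq0 ?gt_eqF.
rewrite -[leRHS]mul1r ler_wpM2r //; first by nneg.
rewrite ler_pdivrMr // mul1r; apply: (@le_trans _ _ (M%:R ^+ N * l%:R ^+ (k * N))).
  rewrite ler_wpM2r ?exprn_ge0 // ler_pdivrMr ?exprn_gt0 //.
by rewrite /a lerDl.
Qed.
End UpperBound.

(** * Counting cavities from below *)

Section Span.
Variables (k : nat) (I : finType) (P : I -> R).
Hypothesis k_gt0 : (0 < k)%N.
Hypothesis P0 : forall i, 0 <= P i.
Hypothesis P1 : \sum_i P i = 1.

(* Violated only by a set of constraints with at least one cycle more than
   components; a random graph has no such set of bounded size. *)
Definition spans n m (K0 : nat) (G : factor_graph k I n m) : Prop :=
  forall A : {set 'I_m}, (0 < #|A| <= K0)%N -> (k.-1 * #|A| <= #|\bigcup_(a in A) nbr G a|)%N.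

(** First moment: N constraints violating the condition lie in a set of at most q N = (k-1)N - 1
    vertices, and the expected number of such configurations is n^(q N) m^N O(n^(-kN)) = O(1/n). The
    vertex sets are enumerated as images of maps, so that their size need not be exact. *)
Lemma spans_whp (M K0 : nat) (del : R) : 0 < del -> exists n0 : nat, forall n m : nat,
  (n0 <= n)%N -> (m <= M * n)%N ->
  prob_event P (fun G : factor_graph k I n m => ~ spans K0 G) <= del.
Proof.
move=> del0; pose q N := (k.-1 * N).-1.
pose c : R := \sum_(N < K0.+1) M%:R ^+ N * (q N)%:R ^+ (k * N).
have c0 : 0 <= c by apply: sumr_ge0 => N _; nneg.
have [n1 hn1] := ex_nat_ge (c / del).
exists n1.+1 => n m hn hm; have n_gt0 : (0 < n)%N by lia.
have nR : 0 < n%:R :> R by rewrite ltr0n.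
pose F (N : nat) (G : factor_graph k I n m) : R :=
  if (0 < N)%N then \sum_(f : {ffun 'I_(q N) -> 'I_n}) wN N [set f i | i in 'I_(q N)] G else 0.
have F0 N G : 0 <= F N G.
  by rewrite /F; case: ifP => // _; apply: sumr_ge0 => f _; exact: wN_ge0.
apply: (@le_trans _ _ (Ex P (fun G => \sum_(N < K0.+1) F N G))).
  apply: (Ex_prob_le P0 n_gt0) => G; first by apply: sumr_ge0.
  move=> nsp; have [/forallP h|] := boolP [forall A : {set 'I_m},
      (0 < #|A| <= K0)%N ==> (k.-1 * #|A| <= #|\bigcup_(a in A) nbr G a|)%N].
    by case: nsp => A hA; have := h A; rewrite hA.
  rewrite negb_forall => /existsP[A]; rewrite negb_imply -ltnNge => /andP[/andP[A0 AK] hA].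
  have AK' : (#|A| < K0.+1)%N by rewrite ltnS.
  rewrite (bigD1 (Ordinal AK')) //= -[leLHS]addr0 lerD ?sumr_ge0 //.
  set W := \bigcup_(a in A) nbr G a in hA.
  have W0 : (0 < #|W|)%N.
    case/card_gt0P: A0 => a aA; have /set0Pn[x xa] := nbr_neq0 k_gt0 G a.
    by apply/card_gt0P; exists x; apply/bigcupP; exists a.
  have Wq : (#|W| <= q #|A|)%N by rewrite /q; lia.
  case/card_gt0P: W0 => x0 x0W.
  pose f : {ffun 'I_(q #|A|) -> 'I_n} := [ffun i : 'I_(q #|A|) => nth x0 (enum W) i].
  have Wf : W \subset [set f i | i in 'I_(q #|A|)].
    apply/subsetP => x xW; have ix : (index x (enum W) < q #|A|)%N.
      by apply: leq_trans Wq; rewrite cardE index_mem mem_enum.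
    by apply/imsetP; exists (Ordinal ix) => //; rewrite ffunE nth_index ?mem_enum.
  rewrite /F A0 (bigD1 f) //= -[leLHS]addr0 lerD ?sumr_ge0 //.
    apply: wN_ge1; apply: subset_leq_card; apply/subsetP => a aA; rewrite inE.
    by apply: subset_trans Wf; apply: bigcup_sup aA.
  by move=> f' _; exact: wN_ge0.
rewrite Ex_sum; apply: (@le_trans _ _ (\sum_(N < K0.+1)
   M%:R ^+ N * (q N)%:R ^+ (k * N) / n%:R)).
  apply: ler_sum => N _; rewrite /F; case: (posnP N) => [_|N0].
    have -> : Ex P (fun _ : factor_graph k I n m => 0) = 0.
      by rewrite /Ex big1 // => G _; rewrite mulr0.
    by nneg.
  rewrite Ex_sum.
  apply: (@le_trans _ _ (\sum_(f : {ffun 'I_(q N) -> 'I_n}) m%:R ^+ N *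
      ((q N)%:R / n%:R) ^+ (k * N))).
    apply: ler_sum => f _; apply: le_trans (Ex_wN k P1 m n_gt0 N _) _.
    rewrite ler_wpM2l ?exprn_ge0 // lerXn2r ?nnegrE ?divr_ge0 // ler_wpM2r ?invr_ge0 //.
    by rewrite ler_nat; apply: leq_trans (leq_imset_card _ _) _; rewrite card_ord.
  rewrite sumr_const card_ffun !card_ord -[leLHS]mulr_natl natrX expr_div_n.
  have hm' : m%:R ^+ N <= M%:R ^+ N * n%:R ^+ N :> R.
    by rewrite -exprMn -natrM lerXn2r ?nnegrE ?ler_nat.
  have kN : (k * N = N + k.-1 * N)%N by rewrite -mulSn prednK.
  have nk : n%:R ^+ (k * N) = n%:R ^+ N * (n%:R ^+ (q N)) * (if (0 < k.-1)%N then n%:R else 1) :> R.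
    rewrite kN; have [k1|k1] := posnP k.-1.
      by rewrite mulr1 -exprD /q k1.
    rewrite -exprD -exprSr; congr (_ ^+ _).
    by rewrite /q -addnS prednK // muln_gt0 k1.
  have [k1|k1] := ltnP 0 k.-1; last first.
    have k1' : k.-1 = 0%N by apply/eqP; rewrite -leqn0.
    have q0 : q N = 0%N by rewrite /q k1' mul0n.
    rewrite q0 !expr0n; have -> : (k * N == 0)%N = false by rewrite muln_eq0 !eqn0Ngt k_gt0 N0.
    by rewrite !(mul0r, mulr0).
  rewrite nk k1.
  have -> : n%:R ^+ q N * (m%:R ^+ N * ((q N)%:R ^+ (k * N) / (n%:R ^+ N * n%:R ^+ q N * n%:R))) =
     m%:R ^+ N / n%:R ^+ N * ((q N)%:R ^+ (k * N) / n%:R) :> R.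
    by field; rewrite !expf_neq0 ?gt_eqF.
  rewrite -[leRHS]mulrA ler_wpM2r //; first by nneg.
  by rewrite ler_pdivrMr ?exprn_gt0.
rewrite -mulr_suml -/c ler_pdivrMr // mulrC -ler_pdivrMr //.
by apply: le_trans hn1 _; rewrite ler_nat; lia.
Qed.
End Span.

(** * Isolated stars: second moment method *)

Lemma bernoulli_sub (x : R) (s : nat) : 0 <= x <= 1 -> 1 - s%:R * x <= (1 - x) ^+ s.
Proof.
move=> /andP[x0 x1]; elim: s => [|s IH]; first by rewrite mul0r subr0 expr0.
rewrite exprS -[s.+1]addn1 natrD.
have h : (1 - x) * (1 - s%:R * x) <= (1 - x) * (1 - x) ^+ s by rewrite ler_wpM2l // subr_ge0.
apply: le_trans h; have : 0 <= s%:R * x * x by nneg.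
by move=> h; lra.
Qed.

(** With s the integer part of n / (2v), Bernoulli gives (1 - v/n)^s >= 1/2, and n <= 4vs. *)
Lemma pow_n_lower (v n : nat) : (0 < v)%N -> (2 * v <= n)%N ->
  (2%:R^-1) ^+ (4 * v) <= (1 - v%:R / n%:R : R) ^+ n.
Proof.
move=> v0 vn; have n0 : (0 < n)%N by lia.
have nR : 0 < n%:R :> R by rewrite ltr0n.
pose s := (n %/ (2 * v))%N.
have s1 : (s * (2 * v) <= n)%N by apply: leq_trunc_div.
have s2 : (n <= s * (4 * v))%N.
  have h : (0 < 2 * v)%N by lia.
  have : (0 < s)%N by rewrite divn_gt0.
  have := divn_eq n (2 * v); have := ltn_pmod n h; rewrite -/s; nia.
have x01 : 0 <= (v%:R / n%:R : R) <= 1.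
  by rewrite divr_ge0 //= ler_pdivrMr // mul1r ler_nat; lia.
have y0 : 0 <= 1 - v%:R / n%:R :> R by rewrite subr_ge0; case/andP: x01.
have hs : 2%:R^-1 <= (1 - v%:R / n%:R : R) ^+ s.
  apply: le_trans (bernoulli_sub s x01).
  have : s%:R * (v%:R / n%:R) <= 2%:R^-1 :> R.
    rewrite mulrA ler_pdivrMr // [leRHS]mulrC ler_pdivlMr // -!natrM ler_nat; lia.
  by move=> h; lra.
apply: (@le_trans _ _ ((1 - v%:R / n%:R) ^+ (s * (4 * v)))).
  rewrite [leRHS]exprM; apply: lerXn2r; rewrite ?nnegrE ?exprn_ge0 //.
  by rewrite invr_ge0.
apply: ler_wiXn2l => //; rewrite lerBlDr lerDl; by case/andP: x01.
Qed.

Lemma ffact_lower (n j : nat) : ((n - j) ^ j <= n ^_ j)%N.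
Proof.
elim: j => // j IH; rewrite ffactnSr expnSr; apply: leq_mul; last by rewrite leq_sub2l.
by apply: leq_trans IH; case: j => // j; rewrite leq_exp2r // leq_sub2l.
Qed.

Section Stars.
Variables (k' : nat) (I : finType) (P : I -> R).
Hypothesis k'_gt0 : (0 < k')%N.
Hypothesis P0 : forall i, 0 <= P i.
Hypothesis P1 : \sum_i P i = 1.
Variable N : nat.
Local Notation k := k'.+1.
Local Notation J := (option ('I_N * 'I_k')).
Local Notation v := #|{: J}|.

Lemma card_J : v = (N * k').+1.
Proof. by rewrite card_option card_prod !card_ord. Qed.

Section FixedSize.
Variables (n m : nat).
Local Notation fg := (factor_graph k I n m).
Local Notation iot := {ffun 'I_N -> 'I_m}.
Local Notation the := {ffun J -> 'I_n}.

Definition tup (th : the) (j : 'I_N) : k.-tuple 'I_n :=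
  [tuple of th None :: [tuple th (Some (j, i)) | i < k']].
Definition im (th : the) : {set 'I_n} := [set th o | o in {: J}].

Lemma mem_tup th j x : (x \in tup th j) = (x == th None) || [exists i, x == th (Some (j, i))].
Proof.
rewrite inE; congr (_ || _); apply/mapP/existsP => [[i _ ->]|[i /eqP ->]].
  by exists i.
by exists i => //; rewrite mem_enum.
Qed.

(* An isolated star: N constraints sharing only the vertex th None, whose
   vertices lie in no other constraint. *)
Definition star (G : fg) (io : iot) (th : the) : bool :=
  [&& injectiveb io, injectiveb th, [forall j, (G (io j)).1 == tup th j] &
   [forall (a | a \notin codom io), ~~ tch (im th) (G a)]].

Section Facts.
Variables (G : fg) (io : iot) (th : the).
Hypothesis st : star G io th.

Lemma star_ioI : injective io. Proof. by case/and4P: st => /injectiveP. Qed.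
Lemma star_thI : injective th. Proof. by case/and4P: st => _ /injectiveP. Qed.
Lemma star_tup j : (G (io j)).1 = tup th j.
Proof. by case/and4P: st => _ _ /forallP/(_ j)/eqP. Qed.

Lemma star_nbr j x : (x \in nbr G (io j)) = (x == th None) || [exists i, x == th (Some (j, i))].
Proof. by rewrite inE star_tup mem_tup. Qed.

Lemma star_nbr_im j : nbr G (io j) \subset im th.
Proof.
apply/subsetP => x; rewrite star_nbr => /orP[/eqP->|/existsP[i /eqP->]]; exact: imset_f.
Qed.

Lemma star_touch a x : x \in nbr G a -> x \in im th -> a \in codom io.
Proof.
move=> xa xi; apply: contraT => na; case/and4P: st => _ _ _ /forall_inP/(_ a na) /negP[].
by case/nbrP: xa => p e; apply/existsP; exists p; rewrite -e.
Qed.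

Lemma star_card_nbr j : #|nbr G (io j)| = k.
Proof.
rewrite -[RHS](size_tuple (tup th j)) -(star_tup j) cardsE; apply/card_uniqP.
rewrite star_tup /= map_inj_uniq ?enum_uniq ?andbT => [|i i' /star_thI[]//].
by apply/mapP => -[i _ /star_thI].
Qed.

Lemma star_card_im : #|im th| = v.
Proof. by rewrite card_imset //; exact: star_thI. Qed.
End Facts.

(** The centre lies only in constraints of the star, so [io j] is some [io' j']; comparing the first
    private vertex of this constraint forces j = j'. *)
Lemma star_iota_unique G io io' th : star G io th -> star G io' th -> io = io'.
Proof.
move=> st st'; apply/ffunP => j.
have c : th None \in nbr G (io j) by rewrite (star_nbr st) eqxx.
have /codomP[j' e] := star_touch st' c (imset_f _ isT).
rewrite e; congr (io' _).
have := star_tup st j; rewrite e (star_tup st') => /(congr1 val) [] /eqP h.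
have {}h : [tuple th (Some (j', i)) | i < k'] = [tuple th (Some (j, i)) | i < k'].
  by apply/val_inj/eqP.
have := congr1 (fun t => tnth t (Ordinal k'_gt0)) h; rewrite !tnth_mktuple.
by move=> /(star_thI st)[->].
Qed.

(** Isolation propagates: a constraint of the second star at a common vertex belongs to the first
    one, hence so does the centre of the second star, and with it all its constraints. *)
Lemma star_overlap G io io' th th' : star G io th -> star G io' th' ->
  im th :&: im th' != set0 -> im th' \subset im th.
Proof.
move=> st st' /set0Pn[x]; rewrite inE => /andP[xi /imsetP[o _ xo]].
have sub j : io' j \in codom io -> nbr G (io' j) \subset im th.
  by case/codomP => j0 ->; exact: star_nbr_im.
have cen j : th' None \in nbr G (io' j) by rewrite (star_nbr st') eqxx.
have c0 : th' None \in im th.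
  case: o xo => [[j i]|] xo; last by rewrite -xo.
  have xn : x \in nbr G (io' j).
    by rewrite (star_nbr st') xo; apply/orP; right; apply/existsP; exists i.
  exact: (subsetP (sub j (star_touch st xn xi))).
apply/subsetP => y /imsetP[[[j i]|] _ ->] //.
apply: (subsetP (sub j (star_touch st (cen j) c0))).
by rewrite (star_nbr st'); apply/orP; right; apply/existsP; exists i.
Qed.

Definition Xs (G : fg) : R := \sum_(x : iot * the) (star G x.1 x.2)%:R.

Hypothesis n_gt0 : (0 < n)%N.
Let nR : 0 < n%:R :> R. Proof. by rewrite ltr0n. Qed.

Lemma Ec_eq (t : k.-tuple 'I_n) : Ec P (fun u => (u.1 == t)%:R) = (n%:R ^+ k)^-1.
Proof.
rewrite (Ec_fst P1 (fun u => (u == t)%:R)) (bigD1 t) //= eqxx big1 ?addr0 ?mulr1 //.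
by move=> u /negbTE->.
Qed.

Lemma Ec_avoid (U : {set 'I_n}) :
  Ec P (fun u : k.-tuple 'I_n * I => (~~ tch U u)%:R) = ((n%:R - #|U|%:R) / n%:R) ^+ k.
Proof.
have -> : n%:R - #|U|%:R = #|~: U|%:R :> R.
  have := cardsC U; rewrite card_ord => {1}<-; rewrite natrD; ring.
rewrite -(Ec_inner k P1 (~: U)); apply: eq_bigr => u _; congr (_ * (nat_of_bool _)%:R).
rewrite /tch negb_exists; apply: eq_forallb => p; by rewrite inE.
Qed.

(** The probability of a given star: N prescribed tuples, while the other m - N constraints avoid
    its v vertices. [p2] is the analogue for two disjoint stars. *)
Definition p1 : R := (n%:R ^+ k)^-1 ^+ N * ((n%:R - v%:R) / n%:R) ^+ (k * (m - N)).
Definition p2 : R := (n%:R ^+ k)^-1 ^+ (2 * N) *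
  ((n%:R - (2 * v)%:R) / n%:R) ^+ (k * (m - 2 * N)).

Lemma Ex_star (io : iot) (th : the) : injective io -> injective th ->
  Ex P (fun G : fg => (star G io th)%:R) = p1.
Proof.
move=> ioI thI.
transitivity (Ex P (fun G : fg => \prod_j ((G (io j)).1 == tup th j)%:R *
   \prod_(a | a \notin codom io) (~~ tch (im th) (G a))%:R)).
  apply: eq_Ex => G; rewrite prod_indic prod_indic -natrM mulnb /star.
  have -> : injectiveb io by apply/injectiveP.
  by have -> : injectiveb th by apply/injectiveP.
rewrite (Ex_inj_prod P (fun j u => (u.1 == tup th j)%:R)
   (fun u => (~~ tch (im th) u)%:R) ioI).
under eq_bigr do rewrite Ec_eq.
by rewrite prodr_const !card_ord Ec_avoid -exprM (card_imset _ thI).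
Qed.

Definition npairs : R := (m ^_ N * n ^_ v)%:R.

Lemma star_sum (F : iot -> the -> R) (c : R) :
  (forall (io : iot) (th : the), injective io -> injective th -> F io th = c) ->
  (forall (io : iot) (th : the), ~~ (injectiveb io && injectiveb th) -> F io th = 0) ->
  \sum_(x : iot * the) F x.1 x.2 = npairs * c.
Proof.
move=> h1 h0; rewrite (bigID (fun x : iot * the => injectiveb x.1 && injectiveb x.2)) /=.
rewrite [X in _ + X]big1 ?addr0; last by move=> x; exact: h0.
rewrite (eq_bigr (fun=> c)); last by move=> x /andP[/injectiveP ? /injectiveP ?]; exact: h1.
rewrite sumr_const -[LHS]mulr_natl; congr (_ * _).
rewrite /npairs; congr _%:R.
have e := cardsX [set f : iot | injectiveb f] [set f : the | injectiveb f].
rewrite !card_inj_ffuns !card_ord in e; rewrite -e; apply: eq_card => x.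
by rewrite !inE.
Qed.

Lemma Ex_Xs : Ex P Xs = npairs * p1.
Proof.
rewrite /Xs Ex_sum; apply: (star_sum (F := fun io th => Ex P (fun G : fg => (star G io th)%:R))).
  by move=> io th; exact: Ex_star.
move=> io th h; rewrite /Ex big1 // => G _; rewrite /star andbA (negbTE h) mulr0 //.
Qed.

(** Stars on disjoint vertex sets cannot share a constraint, so either the product vanishes or 2N
    distinct constraints are prescribed and the others avoid 2v vertices. *)
Lemma Ex_star2 (io io' : iot) (th th' : the) : (2 * N <= m)%N -> (2 * v <= n)%N ->
  im th :&: im th' = set0 ->
  Ex P (fun G : fg => (star G io th)%:R * (star G io' th')%:R) <=
  (injectiveb io && injectiveb th)%:R * (injectiveb io' && injectiveb th')%:R * p2.
Proof.
move=> mN vn dis.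
have p20 : 0 <= p2.
  have : 0 <= n%:R - (2 * v)%:R :> R by rewrite subr_ge0 ler_nat.
  by move=> ?; rewrite /p2; nneg.
have [/andP[/injectiveP ioI /injectiveP thI]|h] := boolP (injectiveb io && injectiveb th); last first.
  rewrite !mul0r /Ex big1 // => G _; rewrite /star [in X in X%:R * _]andbA (negbTE h).
  by rewrite mul0r mulr0.
have [/andP[/injectiveP ioI' /injectiveP thI']|h] := boolP (injectiveb io' && injectiveb th'); last first.
  rewrite mulr0 mul0r /Ex big1 // => G _; rewrite /star [in X in _ * X%:R]andbA (negbTE h).
  by rewrite !mulr0.
rewrite !mul1r.
have [/existsP[j /existsP[j' /eqP e]]|] := boolP [exists j, exists j', io j == io' j'].
  rewrite /Ex big1 // => G _; case: (boolP (star G io th)) => [st|_]; last by rewrite mul0r mulr0.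
  case: (boolP (star G io' th')) => [st'|_]; last by rewrite !mulr0.
  have c : th None \in nbr G (io j) by rewrite (star_nbr st) eqxx.
  have : th None \in im th :&: im th'.
    by rewrite inE imset_f //= (subsetP (star_nbr_im st' j')) // -e.
  by rewrite dis inE.
rewrite negb_exists => /forallP hd.
pose ij (o : 'I_N + 'I_N) := match o with inl j => io j | inr j => io' j end.
have ijI : injective ij.
  have hd' j j' : io j <> io' j'.
    by move=> e; have := hd j; rewrite negb_exists => /forallP/(_ j'); rewrite e eqxx.
  move=> [j|j] [j'|j'] /= e; [by rewrite (ioI _ _ e)| | |by rewrite (ioI' _ _ e)].
    by case: (hd' _ _ e).
  by case: (hd' _ _ (esym e)).
pose q (o : 'I_N + 'I_N) (u : k.-tuple 'I_n * I) : R :=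
  match o with inl j => (u.1 == tup th j)%:R | inr j => (u.1 == tup th' j)%:R end.
pose U := im th :|: im th'.
have U2 : #|U| = (2 * v)%N.
  by rewrite cardsU dis cards0 subn0 !card_imset // addnn mul2n.
have opt (f : 'I_N + 'I_N -> R) : \prod_o f o = \prod_j f (inl j) * \prod_j f (inr j).
  by rewrite big_sumType.
apply: (@le_trans _ _ (Ex P (fun G : fg => \prod_o q o (G (ij o)) *
   \prod_(a | a \notin codom ij) (~~ tch U (G a))%:R))).
  apply: (Ex_le P0 n_gt0) => G.
  case: (boolP (star G io th)) => [st|_]; last first.
    by rewrite mul0r; apply: mulr_ge0; apply: prodr_ge0 => o _ //; case: o => j; exact: ler0n.
  case: (boolP (star G io' th')) => [st'|_]; last first.
    by rewrite mulr0; apply: mulr_ge0; apply: prodr_ge0 => o _ //; case: o => j; exact: ler0n.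
  rewrite mul1r opt /= !big1 ?mulr1 //.
  - move=> a na; rewrite (_ : ~~ tch U (G a)) //; apply/existsP => -[p].
    rewrite inE => /orP[h|h].
      have /codomP[j e] := star_touch st (nbr_tnth G a p) h.
      by case/negP: na; apply/codomP; exists (inl j).
    have /codomP[j e] := star_touch st' (nbr_tnth G a p) h.
    by case/negP: na; apply/codomP; exists (inr j).
  - by move=> j _; rewrite (star_tup st') eqxx.
  - by move=> j _; rewrite (star_tup st) eqxx.
rewrite (Ex_inj_prod P q (fun u => (~~ tch U u)%:R) ijI) opt /=.
under eq_bigr do rewrite Ec_eq.
under [X in _ * X * _]eq_bigr do rewrite Ec_eq.
rewrite !prodr_const !card_ord Ec_avoid -exprM U2 card_sum !card_ord /p2.
by rewrite -exprD addnn -[N.*2]mul2n.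
Qed.

(** Disjoint pairs contribute [p2] each. A star meeting a given one has all its vertices there,
    which leaves at most v^v maps [th], and [th] determines [io]. *)
Lemma Ex_Xs2 : (2 * N <= m)%N -> (2 * v <= n)%N ->
  Ex P (fun G => Xs G ^+ 2) <= npairs ^+ 2 * p2 + (v ^ v)%:R * Ex P Xs.
Proof.
move=> mN vn.
have p20 : 0 <= p2.
  have : 0 <= n%:R - (2 * v)%:R :> R by rewrite subr_ge0 ler_nat.
  by move=> ?; rewrite /p2; nneg.
pose ok (x : iot * the) : R := (injectiveb x.1 && injectiveb x.2)%:R.
pose dj (x y : iot * the) := im x.2 :&: im y.2 == set0.
have nok : \sum_x ok x = npairs.
  rewrite -[npairs]mulr1; apply: (star_sum (F := fun io th => (injectiveb io && injectiveb th)%:R)).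
    by move=> io th /injectiveP-> /injectiveP->.
  by move=> io th /negbTE->.
apply: (@le_trans _ _ (Ex P (fun G : fg => \sum_x \sum_(y | dj x y)
    (star G x.1 x.2)%:R * (star G y.1 y.2)%:R + (v ^ v)%:R * Xs G))).
  apply: (Ex_le P0 n_gt0) => G.
  have -> : Xs G ^+ 2 = \sum_x \sum_(y | dj x y) (star G x.1 x.2)%:R * (star G y.1 y.2)%:R +
      \sum_x (star G x.1 x.2)%:R * \sum_(y | ~~ dj x y) (star G y.1 y.2)%:R.
    rewrite expr2 /Xs mulr_suml -big_split /=; apply: eq_bigr => x _.
    by rewrite -mulr_sumr -mulrDr; congr (_ * _); rewrite (bigID (dj x)).
  rewrite lerD2l mulr_sumr; apply: ler_sum => x _; rewrite [leRHS]mulrC.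
  case: (boolP (star G x.1 x.2)) => st; last by rewrite !mul0r.
  rewrite !mul1r.
  rewrite (_ : \sum_(y | ~~ dj x y) (star G y.1 y.2)%:R =
     #|[set y : iot * the | ~~ dj x y && star G y.1 y.2]|%:R :> R); last first.
    rewrite cardsE -sum1_card natr_sum big_mkcond [RHS]big_mkcond /=.
    by apply: eq_bigr => y _; rewrite unfold_in /=; case: (dj x y); case: (star _ _ _).
  rewrite ler_nat; apply: (@leq_trans #|[pred th : the | th \in ffun_on (mem (im x.2))]|); last first.
    rewrite (eq_card (B := ffun_on (mem (im x.2)))); last by move=> th; rewrite inE.
    by rewrite card_ffun_on (eq_card (B := im x.2)) // (star_card_im st).
  rewrite -(card_in_imset (f := snd)); last first.
    move=> [a th1] [b th2]; rewrite !inE /= => /andP[_ s1] /andP[_ s2] e.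
    by move: s1; rewrite e => s1; rewrite (star_iota_unique s1 s2).
  apply: subset_leq_card; apply/subsetP => th /imsetP[[a th1]].
  rewrite inE /= => /andP[nd s1] ->; rewrite inE; apply/ffun_onP => o.
  by apply: (subsetP (star_overlap st s1 nd)); exact: imset_f.
rewrite ExD ExZ lerD2r Ex_sum.
apply: (@le_trans _ _ (\sum_x \sum_(y | dj x y) ok x * ok y * p2)).
  apply: ler_sum => x _; rewrite Ex_sum; apply: ler_sum => y /eqP d.
  exact: Ex_star2.
rewrite expr2 -nok -mulrA mulr_suml; apply: ler_sum => x _.
rewrite -mulr_suml -mulr_sumr -mulrA ler_wpM2l ?ler0n // ler_wpM2r //.
rewrite [leRHS](bigID (dj x)) /= lerDl sumr_ge0 // => y _; exact: ler0n.
Qed.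
End FixedSize.
End Stars.

Section Whp.
Variables (I : finType) (P : I -> R).
Hypothesis P0 : forall i, 0 <= P i.
Hypothesis P1 : \sum_i P i = 1.

(** The indicator of X < mu/2 is at most (2 (mu - X) / mu)^2, whose expectation is computed from the
    two moments. *)
Lemma chebyshev_half k n m (X : factor_graph k I n m -> R) (mu e : R) : (0 < n)%N ->
  0 < mu -> Ex P X = mu -> Ex P (fun G => X G ^+ 2) <= (1 + e) * mu ^+ 2 ->
  prob_event P (fun G => X G < mu / 2%:R) <= 4%:R * e.
Proof.
move=> n0 mu0 EX EX2.
apply: (@le_trans _ _ (Ex P (fun G => 4%:R / mu ^+ 2 * X G ^+ 2 +
   (- (8%:R / mu) * X G + 4%:R)))).
  have sq G : 4%:R / mu ^+ 2 * X G ^+ 2 + (- (8%:R / mu) * X G + 4%:R) =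
      (2%:R / mu * (mu - X G)) ^+ 2.
    by field; rewrite gt_eqF.
  apply: (Ex_prob_le P0 n0) => G; rewrite sq ?sqr_ge0 // => h.
  rewrite -[leLHS](expr1n _ 2) lerXn2r ?nnegrE ?ler01 //.
    by apply: mulr_ge0; [rewrite divr_ge0 // ltW | rewrite subr_ge0; lra].
  by rewrite mulrAC ler_pdivlMr // mul1r; lra.
rewrite ExD ExD !ExZ (Ex_cst k P1 m n0) EX.
have -> : 4%:R * e = 4%:R / mu ^+ 2 * ((1 + e) * mu ^+ 2) + (- (8%:R / mu) * mu + 4%:R).
  by field; rewrite gt_eqF.
by rewrite lerD2r ler_pM2l // divr_gt0 // exprn_gt0.
Qed.

Variables (k' N M : nat) (c0 : R).
Hypothesis k'_gt0 : (0 < k')%N.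
Hypothesis c00 : 0 < c0.
Local Notation k := k'.+1.
Local Notation v := #|{: option ('I_N * 'I_k')}|.

(** Half of a lower bound for the mean divided by n: the first two factors come from the falling
    factorials of m and n, the third from the other constraints avoiding the star. *)
Definition cstar : R :=
  (c0 / 2%:R) ^+ N * (2%:R^-1) ^+ v * ((2%:R^-1) ^+ (4 * v)) ^+ (k * M) / 2%:R.

Lemma cstar_gt0 : 0 < cstar.
Proof. by rewrite divr_gt0 // !mulr_gt0 // ?exprn_gt0 ?divr_gt0 ?invr_gt0 ?exprn_gt0 ?invr_gt0. Qed.

(** A star has v = (k-1)N + 1 vertices, so the m^N n^v choices of order n^(N+v) against the
    probability n^(-kN) of the tuples leave exactly one power of n. *)
Lemma mean_lower n m : (2 * v <= n)%N -> (2 * N)%:R <= c0 * n%:R -> c0 * n%:R <= m%:R ->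
  (m <= M * n)%N -> cstar * n%:R <= npairs k' N n m * p1 k' N n m / 2%:R.
Proof.
move=> vn Nn cm mM; have v0 : (0 < v)%N by rewrite card_J.
have n0 : (0 < n)%N by apply: leq_trans vn; rewrite muln_gt0.
have nR : 0 < n%:R :> R by rewrite ltr0n.
have NR : N%:R <= c0 * n%:R / 2%:R.
  by rewrite ler_pdivlMr // mulrC -natrM.
have vR : v%:R <= n%:R / 2%:R :> R by rewrite ler_pdivlMr // mulrC -natrM ler_nat.
have Nm : (N <= m)%N.
  rewrite -(ler_nat R); apply: le_trans cm; apply: le_trans NR _.
  by rewrite ler_pdivrMr // ler_peMr //; [nneg | rewrite ler1n].
have vn' : (v <= n)%N by apply: leq_trans vn; rewrite leq_pmull.
have h1 : (c0 * n%:R / 2%:R) ^+ N <= (m ^_ N)%:R.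
  apply: (@le_trans _ _ ((m - N)%N%:R ^+ N)); last by rewrite -natrX ler_nat ffact_lower.
  by rewrite lerXn2r ?nnegrE //; [nneg | rewrite natrB //; lra].
have h2 : (n%:R / 2%:R) ^+ v <= (n ^_ v)%:R :> R.
  apply: (@le_trans _ _ ((n - v)%N%:R ^+ v)); last by rewrite -natrX ler_nat ffact_lower.
  by rewrite lerXn2r ?nnegrE //; [nneg | rewrite natrB //; lra].
set y : R := (n%:R - v%:R) / n%:R.
have yE : y = 1 - v%:R / n%:R by rewrite /y mulrBl divff // gt_eqF.
have y01 : 0 <= y <= 1.
  rewrite /y divr_ge0 ?subr_ge0 ?ler_nat //= ler_pdivrMr // mul1r lerBlDr lerDl.
  exact: ler0n.
have h3 : ((2%:R^-1) ^+ (4 * v)) ^+ (k * M) <= y ^+ (k * (m - N)) :> R.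
  apply: (@le_trans _ _ (y ^+ (n * (k * M)))).
    rewrite [leRHS]exprM; apply: lerXn2r; rewrite ?nnegrE ?exprn_ge0 ?invr_ge0 //.
      by case/andP: y01.
    by rewrite yE; apply: pow_n_lower.
  apply: ler_wiXn2l => //; try by case/andP: y01.
  rewrite [leqRHS]mulnCA leq_mul2l; apply/orP; right.
  by rewrite mulnC; exact: leq_trans (leq_subr _ _) mM.
rewrite /cstar /npairs /p1 -/y natrM ler_pdivlMr // mulrAC divfK ?pnatr_eq0 //.
apply: (@le_trans _ _ ((c0 * n%:R / 2%:R) ^+ N * (n%:R / 2%:R) ^+ v *
   ((n%:R ^+ k)^-1 ^+ N * ((2%:R^-1) ^+ (4 * v)) ^+ (k * M)))); last first.
  apply: ler_pM; rewrite ?mulr_ge0 ?exprn_ge0 ?invr_ge0 ?exprn_ge0 ?invr_ge0 ?divr_ge0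
    ?mulr_ge0 // ?(ltW c00) //.
    by apply: ler_pM; rewrite ?exprn_ge0 ?divr_ge0 ?mulr_ge0 ?(ltW c00).
  by rewrite ler_wpM2l // exprn_ge0 // invr_ge0 exprn_ge0.
set Q := (_ ^+ (k * M)).
apply: eq_ler.
have e : n%:R ^+ N * n%:R ^+ v = n%:R * (n%:R ^+ k) ^+ N :> R.
  rewrite -exprM -exprD -exprS card_J; congr (_ ^+ _).
  by rewrite addnS addnC mulSn mulnC addnC.
have -> : (c0 * n%:R / 2%:R) ^+ N * (n%:R / 2%:R) ^+ v * ((n%:R ^+ k)^-1 ^+ N * Q) =
   (c0 / 2%:R) ^+ N * (2%:R^-1) ^+ v * ((n%:R ^+ N * n%:R ^+ v) * (n%:R ^+ k)^-1 ^+ N) * Q.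
  have a1 : (c0 * n%:R / 2%:R) ^+ N = (c0 / 2%:R) ^+ N * n%:R ^+ N.
    by rewrite -exprMn mulrAC.
  have a2 : (n%:R / 2%:R) ^+ v = (2%:R^-1) ^+ v * n%:R ^+ v :> R.
    by rewrite -exprMn mulrC.
  by rewrite a1 a2; set X1 := _ ^+ N; set X2 := _ ^+ v; set X3 := _ ^+ N; ring.
rewrite e [(n%:R ^+ k)^-1 ^+ N]exprVn mulfK; last by rewrite !expf_neq0 // gt_eqF.
ring.
Qed.

(** The variance is small for two reasons: 1 - 2v/n <= (1 - v/n)^2 gives p2 <= (1 + e) p1^2 up to a
    bounded number of exponents, and the overlap term v^v mu is at most e mu^2 because mu is at
    least linear in n. *)
Lemma stars_whp (del : R) : 0 < del -> exists n0 : nat, forall n m : nat,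
  (n0 <= n)%N -> c0 * n%:R <= m%:R -> (m <= M * n)%N ->
  prob_event P (fun G : factor_graph k I n m => ~ (cstar * n%:R <= Xs N G)) <= del.
Proof.
move=> del0; have v0 : (0 < v)%N by rewrite card_J.
pose e := del / 8%:R; have e0 : 0 < e by rewrite divr_gt0.
have cs0 := cstar_gt0.
have [n1 hn1] := ex_nat_ge ((2 * N)%:R / c0).
have [n2 hn2] := ex_nat_ge ((2 * k * N * v)%:R * (1 + e) / e).
have [n3 hn3] := ex_nat_ge ((v ^ v)%:R / (e * cstar)).
exists (2 * v + n1 + n2 + n3)%N => n m hn cm mM.
have [vn hn1' hn2' hn3'] : [/\ 2 * v <= n, n1 <= n, n2 <= n & n3 <= n]%N.
  by move: hn; clear; move: (2 * _)%N => w; split; lia.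
clear hn.
have n0 : (0 < n)%N by apply: leq_trans vn; rewrite muln_gt0.
have nR : 0 < n%:R :> R by rewrite ltr0n.
have Nn : (2 * N)%:R <= c0 * n%:R.
  by rewrite mulrC -ler_pdivrMr //; apply: le_trans hn1 _; rewrite ler_nat.
have Nm : (2 * N <= m)%N by rewrite -(ler_nat R); apply: le_trans cm.
have vn' : (v <= n)%N by apply: leq_trans vn; rewrite leq_pmull.
set mu := npairs k' N n m * p1 k' N n m.
have mu_ge : cstar * n%:R <= mu / 2%:R by exact: mean_lower.
have mu_ge' : cstar * n%:R <= mu.
  apply: (le_trans mu_ge); rewrite ler_pdivrMr // ler_peMr //.
    have : 0 < mu / 2%:R by apply: lt_le_trans mu_ge; rewrite mulr_gt0.
    by rewrite pmulr_lgt0 ?invr_gt0 // => /ltW.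
  by rewrite ler1n.
have mu0 : 0 < mu by apply: lt_le_trans mu_ge'; rewrite mulr_gt0.
have EX : Ex P (@Xs k' I N n m) = mu by exact: Ex_Xs.
have EX2 := Ex_Xs2 k'_gt0 P0 P1 n0 Nm vn.
set y : R := (n%:R - v%:R) / n%:R.
have yE : y = 1 - v%:R / n%:R by rewrite /y mulrBl divff // gt_eqF.
have x01 : 0 <= (v%:R / n%:R : R) <= 1.
  by rewrite divr_ge0 //= ler_pdivrMr // mul1r ler_nat.
have y0 : 0 <= y by rewrite yE subr_ge0; case/andP: x01.
set z : R := (n%:R - (2 * v)%:R) / n%:R.
have z0 : 0 <= z by rewrite divr_ge0 // subr_ge0 ler_nat.
have zy : z <= y ^+ 2.
  have -> : y ^+ 2 = z + (v%:R / n%:R) ^+ 2.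
    by rewrite /y /z natrM; field; rewrite gt_eqF.
  by rewrite lerDl sqr_ge0.
have p2E : p2 k' N n m = (n%:R ^+ k)^-1 ^+ (2 * N) * z ^+ (k * (m - 2 * N)) by [].
have p1E : p1 k' N n m = (n%:R ^+ k)^-1 ^+ N * y ^+ (k * (m - N)) by [].
have pp : p2 k' N n m * y ^+ (2 * k * N) <= p1 k' N n m ^+ 2.
  rewrite p2E p1E [leRHS]exprMn -exprM [(N * 2)%N]mulnC -mulrA.
  apply: ler_wpM2l; first by rewrite exprn_ge0 // invr_ge0 exprn_ge0.
  have hz : z ^+ (k * (m - 2 * N)) <= y ^+ (2 * (k * (m - 2 * N))).
    by rewrite [leRHS]exprM lerXn2r ?nnegrE ?exprn_ge0.
  apply: (@le_trans _ _ (y ^+ (2 * (k * (m - 2 * N))) * y ^+ (2 * k * N))).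
    by rewrite ler_wpM2r ?exprn_ge0.
  rewrite -exprD -exprM; apply: eq_ler; congr (_ ^+ _).
  rewrite -mulnA -mulnDr -mulnDr [RHS]mulnC; congr (2 * (_ * _))%N.
  by clear -Nm; lia.
have yb : (1 + e)^-1 <= y ^+ (2 * k * N).
  rewrite yE; apply: le_trans (bernoulli_sub _ x01).
  have e1 : 0 < 1 + e by rewrite addr_gt0.
  have h : (2 * k * N)%:R * (v%:R / n%:R) <= e / (1 + e).
    rewrite mulrA -natrM ler_pdivrMr // mulrAC ler_pdivlMr // [leRHS]mulrC.
    by rewrite -ler_pdivrMr //; apply: le_trans hn2 _; rewrite ler_nat.
  have -> : (1 + e)^-1 = 1 - e / (1 + e) by field; rewrite gt_eqF.
  by rewrite lerD2l lerN2.
have p20 : 0 <= p2 k' N n m.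
  by rewrite p2E mulr_ge0 ?exprn_ge0 // invr_ge0 exprn_ge0.
have pp2 : p2 k' N n m <= (1 + e) * p1 k' N n m ^+ 2.
  have e1 : 0 < 1 + e by rewrite addr_gt0.
  rewrite mulrC -ler_pdivrMr //; apply: le_trans pp.
  by rewrite ler_wpM2l.
have EX2' : Ex P (fun G => Xs N (G : factor_graph k I n m) ^+ 2) <= (1 + 2%:R * e) * mu ^+ 2.
  apply: le_trans EX2 _.
  have -> : (1 + 2%:R * e) * mu ^+ 2 = (npairs k' N n m) ^+ 2 * ((1 + e) * p1 k' N n m ^+ 2) +
     e * mu * mu by rewrite /mu; ring.
  rewrite EX; apply: lerD; first by rewrite ler_wpM2l // sqr_ge0.
  rewrite ler_wpM2r ?(ltW mu0) //.
  apply: (@le_trans _ _ (e * (cstar * n%:R))); last by rewrite ler_pM2l.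
  rewrite mulrA [leRHS]mulrC -ler_pdivrMr; last exact: mulr_gt0 e0 cs0.
  apply: (le_trans hn3).
  by rewrite ler_nat.
apply: (@le_trans _ _ (prob_event P (fun G : factor_graph k I n m => Xs N G < mu / 2%:R))).
  rewrite !prob_eventE; apply: (Ex_le P0 n0) => G; case: pbP => [h|_]; last exact: ler0n.
  case: pbP => // h'; case: h; apply: (le_trans mu_ge); rewrite leNgt; exact/negP.
apply: le_trans (chebyshev_half n0 mu0 EX EX2') _.
by rewrite le_eqVlt /e; apply/orP; left; apply/eqP; field.
Qed.
End Whp.

(* lia does not identify cardinals whose types are only convertible. *)
Ltac card_lia := repeat match goal with |- context [fintype.card.body ?S] =>
  let c := fresh "c" in set c := (fintype.card.body S); move: c => c end; clear; lia.

(** * Building cavities from degenerate constraints, a star and isolated vertices *)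

Section Build.
Local Open Scope nat_scope.
Variables (k' : nat) (I : finType).
Hypothesis k'_gt0 : 0 < k'.
Local Notation k := k'.+1.
Variables (n m : nat) (G : factor_graph k I n m).
Local Notation nbr := (nbr G).
Variable K0 : nat.
Hypothesis K0_ge4 : 4 <= K0.
Hypothesis sp : spans K0 G.

Lemma nbr_le a : #|nbr a| <= k.
Proof.
apply: leq_trans (_ : #|(G a).1| <= k).
  by apply: subset_leq_card; apply/subsetP => x; rewrite inE.
by apply: leq_trans (card_size _) _; rewrite size_tuple.
Qed.

Lemma spans_seq (s : seq 'I_m) : uniq s -> 0 < size s <= K0 ->
  k' * size s <= #|\bigcup_(a <- s) nbr a|.
Proof.
move=> us hs; have c : #|[set a in s]| = size s by rewrite cardsE; apply/card_uniqP.
have := sp (A := [set a in s]); rewrite c => /(_ hs); rewrite big_uniq //.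
by rewrite (eq_bigl (mem s)) // => a; rewrite inE.
Qed.

Lemma nbr_ge a : k' <= #|nbr a|.
Proof.
by have := @spans_seq [:: a] isT; rewrite big_seq1 /= muln1; apply; apply: leq_trans K0_ge4.
Qed.

(** The source of all contradictions with [spans] below: each vertex that a constraint shares with S
    reduces by one the at most k vertices that it adds. *)
Lemma card_nbrU (S : {set 'I_n}) b (t : seq 'I_n) : uniq t -> {subset t <= S :&: nbr b} ->
  #|nbr b :|: S| + size t <= #|S| + k.
Proof.
move=> ut ts; have := cardsUI (nbr b) S; have := nbr_le b.
have : size t <= #|nbr b :&: S|.
  by rewrite cardE uniq_leq_size // => x /ts; rewrite mem_enum setIC.
card_lia.
Qed.

Section Degenerate.
Variable A : {set 'I_m}.
Hypothesis Ak : forall a, a \in A -> #|nbr a| = k'.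
Definition XA : {set 'I_n} := \bigcup_(a in A) nbr a.

(** Two distinct intersecting members of A would span at most 2k' - 1 vertices. *)
Lemma A_disj a a' x : a \in A -> a' \in A -> a != a' -> x \in nbr a -> x \notin nbr a'.
Proof.
move=> aA a'A ne xa; apply/negP => xa'.
have := @spans_seq [:: a'; a]; rewrite /= inE eq_sym ne /=.
have -> : 1 < K0 by lia.
move=> /(_ isT isT); rewrite big_cons big_seq1 /=.
have := cardsUI (nbr a') (nbr a); rewrite !Ak //.
have : 0 < #|nbr a' :&: nbr a| by apply/card_gt0P; exists x; rewrite in_setI xa xa'.
card_lia.
Qed.

Lemma A_disj_card a a' : a \in A -> a' \in A -> #|nbr a' :|: nbr a| <= 2 * k'.
Proof. by move=> aA a'A; have := cardsUI (nbr a') (nbr a); rewrite !Ak //; lia. Qed.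

(** CAV2 for [XA]. With two contacts, [b] adds at most k' - 1 vertices to the one or two members of
    A that it meets, violating [spans] for two or three constraints. *)
Lemma A_touch b : b \notin A -> #|nbr b :&: XA| <= 1.
Proof.
move=> bA; rewrite leqNgt; apply/negP => h.
have [x [y [xb yb xy]]] : exists x y, [/\ x \in nbr b :&: XA, y \in nbr b :&: XA & x != y].
  have /card_gt0P[x xb] : 0 < #|nbr b :&: XA| by lia.
  have : 0 < #|(nbr b :&: XA) :\ x| by have := cardsD1 x (nbr b :&: XA); rewrite xb; lia.
  by case/card_gt0P => y; rewrite in_setD1 => /andP[yx yb]; exists x, y; rewrite eq_sym.
move: xb yb; rewrite !in_setI => /andP[xb /bigcupP[a aA xa]] /andP[yb /bigcupP[a' a'A ya']].
have ba c : c \in A -> b != c by move=> cA; apply: contraNneq bA => ->.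
have u2 : uniq [:: x; y] by rewrite /= inE xy.
have [e|ne] := eqVneq a a'.
  subst a'; have := @spans_seq [:: b; a]; rewrite /= inE ba //=.
  have -> : 1 < K0 by lia.
  move=> /(_ isT isT); rewrite big_cons big_seq1 /=.
  have := @card_nbrU (nbr a) b [:: x; y] u2; rewrite Ak //=.
  have h' : {subset [:: x; y] <= nbr a :&: nbr b}.
    move=> z; rewrite inE => /orP[|]; last rewrite inE; move=> /eqP->;
    by rewrite in_setI ?xa ?xb ?ya' ?yb.
  by move=> /(_ h'); card_lia.
have := @spans_seq [:: b; a'; a]; rewrite /= !inE negb_or !ba //= eq_sym ne /=.
have -> : 2 < K0 by lia.
move=> /(_ isT isT); rewrite !big_cons big_nil setU0 /=.
have := @card_nbrU (nbr a' :|: nbr a) b [:: x; y] u2.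
have h' : {subset [:: x; y] <= (nbr a' :|: nbr a) :&: nbr b}.
  move=> z; rewrite inE => /orP[|]; last rewrite inE; move=> /eqP->;
  by rewrite in_setI in_setU ?xa ?xb ?ya' ?yb ?orbT.
move=> /(_ h') /=; have := A_disj_card aA a'A; card_lia.
Qed.

(** CAV3 for [XA]. Relative to the members of A that they meet, [b] adds at most k' vertices and
    then [c], which also shares [x], at most k' - 1. Up to four constraints are involved, whence the
    lower bound on [K0]. *)
Lemma A_cav3 b c x : b \notin A -> c \notin A -> b != c -> nbr b :&: XA != set0 ->
  nbr c :&: XA != set0 -> x \in nbr b -> x \in nbr c -> x \in XA.
Proof.
move=> bA cA bc /set0Pn[y] + /set0Pn[z] + xb xc; rewrite !in_setI.
move=> /andP[yb /bigcupP[a aA ya]] /andP[zc /bigcupP[a' a'A za']].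
apply/negPn/negP => xA.
have nA d : d \in A -> x \notin nbr d.
  by move=> dA; apply: contra xA => xd; apply/bigcupP; exists d.
have ba d : d \in A -> b != d by move=> dA; apply: contraNneq bA => ->.
have ca d : d \in A -> c != d by move=> dA; apply: contraNneq cA => ->.
have zx : z != x by apply: contraNneq (nA _ a'A) => <-.
have uz : uniq [:: z; x] by rewrite /= inE zx.
have [e|ne] := eqVneq a a'.
  subst a'; have := @spans_seq [:: c; b; a].
  rewrite /= !inE negb_or (eq_sym c b) bc !ba ?ca //=.
  have -> : 2 < K0 by lia.
  move=> /(_ isT isT); rewrite !big_cons big_nil setU0 /=.
  have h1 : {subset [:: y] <= nbr a :&: nbr b} by move=> w; rewrite inE in_setI => /eqP->; rewrite ya yb.
  have := @card_nbrU (nbr a) b [:: y] isT h1; rewrite Ak //=.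
  have h2 : {subset [:: z; x] <= (nbr b :|: nbr a) :&: nbr c}.
    move=> w; rewrite inE => /orP[|]; last rewrite inE; move=> /eqP->;
    by rewrite in_setI in_setU ?za' ?zc ?xb ?xc ?orbT.
  have := @card_nbrU (nbr b :|: nbr a) c [:: z; x] uz h2 => /=.
  by card_lia.
have := @spans_seq [:: c; b; a'; a].
rewrite /= !inE !negb_or (eq_sym c b) bc !ba ?ca //= (eq_sym a' a) ne /= K0_ge4.
move=> /(_ isT isT); rewrite !big_cons big_nil setU0 /=.
have h1 : {subset [:: y] <= (nbr a' :|: nbr a) :&: nbr b}.
  by move=> w; rewrite inE in_setI in_setU => /eqP->; rewrite ya yb orbT.
have := @card_nbrU (nbr a' :|: nbr a) b [:: y] isT h1 => /=.
have h2 : {subset [:: z; x] <= (nbr b :|: (nbr a' :|: nbr a)) :&: nbr c}.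
  move=> w; rewrite inE => /orP[|]; last rewrite inE; move=> /eqP->;
  by rewrite in_setI !in_setU ?za' ?zc ?xb ?xc ?orbT.
have := @card_nbrU (nbr b :|: (nbr a' :|: nbr a)) c [:: z; x] uz h2 => /=.
have := A_disj_card aA a'A; card_lia.
Qed.

Lemma card_XA : #|XA| = #|A| * k'.
Proof.
have triv : trivIset [set nbr a | a in A].
  apply/trivIsetP => B1 B2 /imsetP[a aA ->] /imsetP[a' a'A ->] ne.
  apply/pred0P => x /=; apply/negP => /andP[xa xa'].
  have ne' : a != a' by apply: contraNneq ne => ->.
  by have := A_disj aA a'A ne' xa; rewrite xa'.
have inj : {in A &, injective nbr}.
  move=> a a' aA a'A e; apply/eqP/negPn/negP => ne.
  have /card_gt0P[x xa] : 0 < #|nbr a| by rewrite Ak.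
  by have := A_disj aA a'A ne xa; rewrite -e xa.
have -> : XA = cover [set nbr a | a in A].
  by rewrite /cover /XA big_imset.
rewrite -(eqP triv) big_imset //= (eq_bigr (fun=> k')) ?sum_nat_const //.
Qed.

Variables (N p : nat) (io : {ffun 'I_N -> 'I_m}) (th : {ffun option ('I_N * 'I_k') -> 'I_n}).
Hypothesis st : star G io th.
Variable f : {ffun 'I_p -> 'I_n}.
Hypothesis f_inj : injective f.
Hypothesis f_iso : forall i a, f i \notin nbr a.
Hypothesis f_th : forall i, f i \notin im th.
Hypothesis hA : A = set0 \/ 1 < k'.

(** The components will be the members of A, the star and p single vertices, hence #|A| + 1 + p in
    number. *)
Definition Ub : {set 'I_n} := XA :|: im th :|: [set f i | i in 'I_p].

Lemma iota_A j : io j \notin A.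
Proof. by apply/negP => /Ak; rewrite (star_card_nbr st); lia. Qed.

Lemma A_iota a x : a \in A -> x \in nbr a -> x \notin im th.
Proof.
move=> aA xa; apply/negP => /(star_touch st xa) /codomP[j e].
by have := iota_A j; rewrite -e aA.
Qed.

Lemma nbr_Ub b x : x \in nbr b -> x \in Ub -> x \in XA \/ (x \in im th /\ b \in codom io).
Proof.
move=> xb; rewrite !in_setU => /orP[/orP[h|h]|/imsetP[i _ e]].
- by left.
- by right; split=> //; exact: (star_touch st xb h).
- by have := f_iso i b; rewrite -e xb.
Qed.

Lemma outer_XA b x : b \notin codom io -> x \in nbr b -> x \in Ub -> x \in XA.
Proof. by move=> nb xb /(nbr_Ub xb)[//|[_ h]]; rewrite h in nb. Qed.

(** Any other constraint contained in [Ub] would lie in [XA], as the star and the vertices [f i] are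
    isolated from it. There it has at most one vertex, against [nbr_ge] if k' > 1; if A is empty, so
    is [XA]. *)
Lemma inner_Ub b : inner G Ub b = (b \in A) || (b \in codom io).
Proof.
apply/idP/orP; last first.
  case=> [bA|/codomP[j ->]]; apply/subsetP => x xb; rewrite !in_setU.
    by have -> : x \in XA by apply/bigcupP; exists b.
  by rewrite (subsetP (star_nbr_im st j) x xb) orbT.
move=> /subsetP h; have [|bA] := boolP (b \in A); first by left.
have [|bi] := boolP (b \in codom io); first by right.
have := A_touch bA; have -> : nbr b :&: XA = nbr b.
  by apply/setIidPl/subsetP => x xb; exact: outer_XA bi xb (h x xb).
have [A0|k2] := hA; last by have := nbr_ge b; lia.
have /card_gt0P[x xb] : 0 < #|nbr b| by apply: leq_trans (nbr_ge b).
have := outer_XA bi xb (h x xb); rewrite /XA A0 big_set0 inE //.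
Qed.

Lemma outer_touch b : ~~ inner G Ub b -> nbr b :&: Ub = nbr b :&: XA.
Proof.
rewrite inner_Ub negb_or => /andP[_ bi]; apply/setP => x; rewrite !in_setI.
case: (boolP (x \in nbr b)) => //= xb; apply/idP/idP; first exact: (outer_XA bi xb).
by rewrite !in_setU => ->.
Qed.

Lemma card_Ub : #|Ub| = #|A| * k' + (N * k').+1 + p.
Proof.
have d1 : XA :&: im th = set0.
  apply/setP => x; rewrite in_setI in_set0; apply/negP => /andP[/bigcupP[a aA xa]].
  by apply/negP; exact: A_iota aA xa.
have d2 : (XA :|: im th) :&: [set f i | i in 'I_p] = set0.
  apply/setP => x; rewrite in_setI in_set0 in_setU.
  apply/negP => /andP[+ /imsetP[i _ e]]; rewrite e (negbTE (f_th i)) orbF.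
  by move=> /bigcupP[a _]; rewrite (negbTE (f_iso i a)).
rewrite /Ub cardsU d2 cards0 subn0 cardsU d1 cards0 subn0 card_XA (star_card_im st) card_J.
by rewrite card_imset // card_ord.
Qed.

(** Consecutive constraints of a cycle share a vertex. Members of A share none with other inner
    constraints, so the cycle runs in the star, whose constraints share only the centre; then all
    variable nodes of the cycle coincide. *)
Lemma Ub_acyclic : CAV1 G Ub.
Proof.
move=> [r [r2 [a [x [aI [xI h]]]]]].
have r0 : 0 < r by lia.
have ordSn (i : 'I_r) : ordS i != i.
  apply/eqP => /(congr1 val) /= e; have := ltn_ord i; case: (ltnP i.+1 r) => hi.
    by move: e; rewrite modn_small //; lia.
  have e2 : i.+1 = r by apply/eqP; rewrite eqn_leq hi ltn_ord.
  by move: e; rewrite e2 modnn; lia.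
have step i : a i \notin A.
  apply/negP => aA; have [in1 [x1 x2]] := h i; have [in2 _] := h (ordS i).
  have ne : a i != a (ordS i) by apply: contra (ordSn i) => /eqP/aI<-.
  move: in2; rewrite inner_Ub => /orP[aA2|/codomP[j e]].
    by have := A_disj aA aA2 ne x1; rewrite x2.
  have := A_iota aA x1; rewrite (subsetP (star_nbr_im st j)) //.
  by rewrite -e.
have cen i : x i = th None.
  have [in1 [x1 x2]] := h i; have [in2 _] := h (ordS i).
  move: in1 in2; rewrite !inner_Ub !(negbTE (step _)) /= => /codomP[j e] /codomP[j' e'].
  have ne : a i != a (ordS i) by apply: contra (ordSn i) => /eqP/aI<-.
  move: x1 x2; rewrite e e' !(star_nbr st) => /orP[/eqP->//|/existsP[u /eqP eu]].
  move=> /orP[/eqP->//|/existsP[u' /eqP eu']].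
  have /(star_thI st)[jj _] : th (Some (j, u)) = th (Some (j', u')) by rewrite -eu -eu'.
  by move: ne; rewrite e e' jj eqxx.
pose i0 : 'I_r := Ordinal r0.
have /xI/eqP : x (ordS i0) = x i0 by rewrite !cen.
by rewrite (negbTE (ordSn i0)).
Qed.

(** A constraint that is not inner meets [Ub] only in [XA], so CAV2 and CAV3 reduce to the
    statements about [XA]. *)
Lemma Ub_cavity : cavity G Ub.
Proof.
split; first by apply/set0Pn; exists (th None); rewrite !in_setU (imset_f th) ?orbT.
split; first exact: Ub_acyclic.
split.
  move=> b; rewrite -[_ \subset _]/(inner G Ub b) => nin; rewrite (outer_touch nin).
  by apply: A_touch; move: nin; rewrite inner_Ub negb_or => /andP[].
move=> b c bc tb tc; apply/setP => x; rewrite in_set0 in_setD in_setI.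
apply/negP => /andP[xU /andP[xb xc]].
have nb : ~~ inner G Ub b by apply: contra xU => /subsetP; apply.
have nc : ~~ inner G Ub c by apply: contra xU => /subsetP; apply.
rewrite (outer_touch nb) in tb; rewrite (outer_touch nc) in tc.
have bA : b \notin A by move: nb; rewrite inner_Ub negb_or => /andP[].
have cA : c \notin A by move: nc; rewrite inner_Ub negb_or => /andP[].
have xXA := A_cav3 bA cA bc tb tc xb xc.
by move: xU; rewrite !in_setU xXA.
Qed.

Lemma Ub_Cset r : #|A| * k'.-1 + N * k' + r = #|Ub| -> Ub \in Cset G #|Ub| r.
Proof.
move=> hr; rewrite inE eqxx andbT; apply/andP; split; first by apply/pbP; exact: Ub_cavity.
have := cavity_forest (ltn0Sn k') Ub_acyclic.
suff -> : \sum_(a | inner G Ub a) (#|nbr a| - 1) = #|A| * k'.-1 + N * k'.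
  by move=> e; apply/eqP; lia.
rewrite (bigID (mem A)) /=; congr (_ + _).
  rewrite (eq_bigl (mem A)); last by move=> a; rewrite inner_Ub /=; case: (a \in A) => //; rewrite andbF.
  by rewrite -sum_nat_const; apply: eq_bigr => a /Ak ->; rewrite subn1.
rewrite (eq_bigl (mem (codom io))); last first.
  move=> a; rewrite inner_Ub /=; have [/codomP[j ->]|_] := boolP (a \in codom io).
    by rewrite iota_A orbT.
  by rewrite orbF andbN.
rewrite (eq_bigr (fun=> k')); last by move=> a /codomP[j ->]; rewrite (star_card_nbr st) subn1.
by rewrite sum_nat_const (card_codom (star_ioI st)) card_ord.
Qed.
End Degenerate.

Lemma subset_card (T : finType) (B : {set T}) d : d <= #|B| -> exists2 A : {set T}, A \subset B & #|A| = d.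
Proof.
move=> h; exists [set x in take d (enum B)].
  by apply/subsetP => x; rewrite inE => /mem_take; rewrite mem_enum.
rewrite cardsE; have /card_uniqP-> : uniq (take d (enum B)) by rewrite take_uniq ?enum_uniq.
by rewrite size_takel // -cardE.
Qed.

(* Fewer than N constraints cannot reduce l variables to r components, and N
   constraints with k distinct neighbours each reduce them too much: the excess D
   forces constraints with a repeated neighbour. *)
Lemma Cset_degenerate l r (U0 : {set 'I_n}) : U0 \in Cset G l r -> l <= K0 ->
  let N := cdiv (l - r) k' in let D := N * k' - (l - r) in
  [/\ N * k' <= l, D <= N & exists A : {set 'I_m}, #|A| = D /\ forall a, a \in A -> #|nbr a| = k'].
Proof.
move=> hU lK N D; have [Ul [_ hN]] := Cset_facts (k'_gt0 : 1 < k) hU.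
rewrite -[k.-1]/k' -/N in hN.
have NK : N <= K0.
  apply: leq_trans lK; apply: leq_trans (leq_subr r l); apply: cdiv_le => //.
  by rewrite leq_pmulr.
have Nge : l - r <= N * k' := cdiv_ge _ k'_gt0.
pose inn0 := [set a | inner G U0 a].
have hN' : N <= #|inn0| by rewrite cardsE.
have h1 : N * k' <= l.
  have [B Bs Bc] := subset_card hN'.
  have [->|N0] := posnP N; first by rewrite mul0n.
  have := sp (A := B); rewrite Bc N0 NK mulnC => /(_ isT) /leq_trans; apply.
  rewrite -Ul; apply: subset_leq_card; apply/bigcupsP => a aB.
  by have := subsetP Bs _ aB; rewrite inE.
pose deg := [set a | inner G U0 a & #|nbr a| == k'].
have acyc : ~ has_cycle G U0 by move: hU; rewrite inE => /andP[/andP[/pbP[_ []]]].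
have hr : ncomp G U0 = r by move: hU; rewrite inE => /andP[_ /eqP].
have := cavity_forest (ltn0Sn k') acyc; rewrite hr Ul => fo.
have e : \sum_(a | inner G U0 a) (#|nbr a| - 1) + #|deg| = #|inn0| * k'.
  have -> : #|deg| = \sum_(a | inner G U0 a) (#|nbr a| == k').
    rewrite -sum1_card (eq_bigl (fun a => inner G U0 a && (#|nbr a| == k'))) ?big_mkcondr //.
    by move=> a; rewrite inE.
  rewrite -big_split /= -sum_nat_const.
  rewrite [RHS](eq_bigl (inner G U0)); last by move=> a; rewrite inE.
  apply: eq_bigr => a _; move: k'_gt0 (nbr_ge a) (nbr_le a); case: eqP; card_lia.
have degi : #|deg| <= #|inn0|.
  by apply: subset_leq_card; apply/subsetP => a; rewrite !inE => /andP[].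
have lr : \sum_(a | inner G U0 a) (#|nbr a| - 1) = l - r by clear -fo; lia.
rewrite lr in e.
have Dd : D <= #|deg|.
  rewrite /D; have : N * k' <= #|inn0| * k' by rewrite leq_mul2r hN' orbT.
  by clear -e; lia.
have DN : D <= N.
  have : N * k'.-1 <= #|inn0| * k'.-1 by rewrite leq_mul2r hN' orbT.
  have e2 x : x * k' = x * k'.-1 + x by rewrite -{1}(prednK k'_gt0) mulnS addnC.
  by rewrite /D; move: e Nge; rewrite !e2; clear -degi; lia.
split=> //; have [A As Ac] := subset_card Dd; exists A; split=> // a /(subsetP As).
by rewrite inE => /andP[_ /eqP].
Qed.
End Build.

(** * Double counting of the cavities built in this way *)

Section Count.
Variables (k' : nat) (I : finType).
Hypothesis k'_gt0 : (0 < k')%N.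
Local Notation k := k'.+1.
Variables (n m : nat) (G : factor_graph k I n m).
Local Notation nbr := (nbr G).

Definition iso : {set 'I_n} := [set x | [forall a, x \notin nbr a]].
Definition thetas N : {set {ffun option ('I_N * 'I_k') -> 'I_n}} :=
  [set th | [exists io : {ffun 'I_N -> 'I_m}, star G io th]].

Lemma Xs_thetas N : Xs N G = #|thetas N|%:R.
Proof.
rewrite /Xs (sum_indic (fun x : {ffun 'I_N -> 'I_m} * {ffun option ('I_N * 'I_k') -> 'I_n} =>
  star G x.1 x.2)); congr _%:R.
rewrite -(card_in_imset (f := snd)); last first.
  move=> [a th1] [b th2]; rewrite !unfold_in /= => s1 s2 e.
  by move: s1; rewrite e => s1; rewrite (star_iota_unique k'_gt0 s1 s2).
apply: eq_card => th; rewrite inE; apply/imsetP/existsP => [[[io th1]]|[io st]].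
  by rewrite unfold_in /= => st ->; exists io.
by exists (io, th).
Qed.

(** A star with no constraints is a single isolated vertex, so linearly many isolated vertices are a
    special case of linearly many stars. *)
Lemma Xs_iso : Xs 0 G <= #|iso|%:R.
Proof.
rewrite Xs_thetas ler_nat.
rewrite -(card_in_imset (f := fun th : {ffun option ('I_0 * 'I_k') -> 'I_n} => th None)); last first.
  move=> t1 t2 _ _ e; apply/ffunP => -[[[j hj] i]|] //.
apply: subset_leq_card; apply/subsetP => x /imsetP[th].
rewrite inE => /existsP[io st] ->; rewrite inE; apply/forallP => a; apply/negP => xa.
by have /codomP[[]] := star_touch st xa (imset_f th isT).
Qed.

(** With A fixed, each star and each injective choice of p isolated vertices off it yield a cavity.
    Conversely U contains all v + p chosen vertices, so it arises from at most l^(v+p) choices. *)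
Lemma count_cavities (K0 N p r : nat) (A : {set 'I_m}) : (4 <= K0)%N -> spans K0 G ->
  (forall a, a \in A -> #|nbr a| = k') -> A = set0 \/ (1 < k')%N ->
  let l := (#|A| * k' + (N * k').+1 + p)%N in
  (#|A| * k'.-1 + N * k' + r = l)%N ->
  (#|thetas N| * (#|iso| - (N * k').+1) ^_ p <= #|Cset G l r| * l ^ ((N * k').+1 + p))%N.
Proof.
move=> K4 sp Ak hA l lr.
pose tht : finType := {ffun option ('I_N * 'I_k') -> 'I_n}.
pose ft : finType := {ffun 'I_p -> 'I_n}.
pose PQ := [set x : tht * ft | [&& x.1 \in thetas N, injectiveb x.2 &
   [forall i, x.2 i \in iso :\: im x.1]]].
have low : (#|thetas N| * (#|iso| - (N * k').+1) ^_ p <= #|PQ|)%N.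
  rewrite -sum_nat_const -[#|PQ|]sum1_card.
  rewrite (eq_bigl (fun x : tht * ft => (x.1 \in thetas N) && (injectiveb x.2 &&
    [forall i, x.2 i \in iso :\: im x.1]))); last by move=> x; rewrite inE.
  rewrite -(pair_big_dep (fun th : tht => th \in thetas N) (fun (th : tht) (f : ft) => injectiveb f &&
    [forall i, f i \in iso :\: im th]) (fun _ _ => 1%N)) /=.
  apply: leq_sum => th; rewrite inE => /existsP[io st].
  rewrite sum1_card.
  have -> : #|[pred f : ft | injectiveb f && [forall i, f i \in iso :\: im th]]| =
     (#|iso :\: im th| ^_ p)%N.
    have := card_inj_ffuns_on 'I_p (fun x => x \in iso :\: im th); rewrite card_ord => <-.
    apply: eq_card => f; rewrite [RHS]in_set [LHS]unfold_in /=.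
    have -> : [forall i, f i \in iso :\: im th] = (f \in ffun_on (fun x => x \in iso :\: im th)).
      by apply/forallP/ffun_onP => h i; exact: h.
    exact: andbC.
  apply: leq_trans (_ : (#|iso| - (N * k').+1) ^_ p <= #|iso :\: im th| ^_ p)%N => //.
  have : (#|iso| - (N * k').+1 <= #|iso :\: im th|)%N.
    rewrite cardsD leq_sub2l // -(card_J k' N) -(star_card_im st).
    exact: subset_leq_card (subsetIr _ _).
  by move: (_ - _)%N => x hx; elim: (p) => // j IH; rewrite !ffactnSr leq_mul // leq_sub2r.
apply: leq_trans low _.
pose UU (x : tht * ft) := Ub G A x.1 x.2.
have inC x : x \in PQ -> UU x \in Cset G l r /\ #|UU x| = l.
  rewrite inE => /and3P[]; rewrite inE => /existsP[io st] /injectiveP fI /forallP hf.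
  have f_iso i a : x.2 i \notin nbr a.
    by have := hf i; rewrite in_setD => /andP[_]; rewrite inE => /forallP.
  have f_th i : x.2 i \notin im x.1 by have := hf i; rewrite in_setD => /andP[].
  have cU : #|UU x| = l := card_Ub k'_gt0 K4 sp Ak st fI f_iso f_th hA.
  have lr' : (#|A| * k'.-1 + N * k' + r = #|Ub G A x.1 x.2|)%N by rewrite lr -cU.
  split=> //; rewrite -[in Cset G l r]cU.
  exact: (Ub_Cset k'_gt0 K4 sp Ak st f_iso hA lr').
rewrite -[#|PQ|]sum1_card (partition_big UU (mem (Cset G l r))) /=; last by move=> x /inC[].
rewrite -sum_nat_const; apply: leq_sum => U UC.
rewrite sum1_card.
have cU : #|U| = l by move: UC; rewrite inE => /andP[/andP[_ /eqP]].
apply: (@leq_trans #|setX [set th : tht | th \in ffun_on (mem U)] [set f : ft | f \in ffun_on (mem U)]|).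
  apply: subset_leq_card; apply/subsetP => -[th f]; rewrite inE => /andP[_ /eqP <-].
  rewrite !inE /=; apply/andP; split; apply/ffun_onP => i.
    by rewrite !in_setU (imset_f th) ?orbT.
  by rewrite !in_setU (imset_f f) ?orbT.
rewrite cardsX !cardsE !card_ffun_on -expnD.
have -> : #|{: option ('I_N * 'I_k')}| = (N * k').+1 by exact: card_J.
by rewrite card_ord (eq_card (B := U)) // cU.
Qed.
End Count.

(** * Many cavities whenever there is one *)

Section LowerBound.
Variables (k' : nat) (I : finType) (P : I -> R).
Hypothesis k'_gt0 : (0 < k')%N.
Hypothesis P0 : forall i, 0 <= P i.
Hypothesis P1 : \sum_i P i = 1.
Local Notation k := k'.+1.
Variables (M l r : nat) (c0 : R).
Hypothesis c00 : 0 < c0.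
Hypothesis rl : (1 <= r <= l)%N.

(** D constraints are reused degenerate ones, so the star gets N' = N - D. Then D k' + (N' k' + 1) +
    p = l fixes p when N k' < l. In [K0], the 4 serves the construction of cavities and l the
    analysis of the given one. *)
Let N := cdiv (l - r) k'.
Let D := (N * k' - (l - r))%N.
Let N' := (N - D)%N.
Let p := (l - N * k').-1.
Let v := (N' * k').+1.
Let K0 := (4 + l)%N.

(** The degenerate constraints of the given cavity are combined with the order n stars and order n^p
    choices of isolated vertices; n^(p+1) = n^(l - N k') is [scale]. *)
Lemma Cset_lower n m (G : factor_graph k I n m) (ca cb : R) :
  (0 < n)%N -> 0 < ca -> 0 < cb -> (2 * (v + p))%:R <= cb * n%:R ->
  spans K0 G -> Cset G l r != set0 ->
  ca * n%:R <= Xs N' G -> cb * n%:R <= Xs 0 G ->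
  Num.min 1 (ca * (cb / 2%:R) ^+ p / (l ^ (v + p))%:R) * scale k n l r <= #|Cset G l r|%:R.
Proof.
move=> n0 ca0 cb0 vpn sp C0 hX hI; have [U0 hU0] := set0Pn _ C0.
have nR : 0 < n%:R :> R by rewrite ltr0n.
have K4 : (4 <= K0)%N by rewrite /K0 leq_addr.
have lK : (l <= K0)%N by rewrite /K0 leq_addl.
have [h1 DN [A [AD Ak]]] := Cset_degenerate k'_gt0 K4 sp hU0 lK.
rewrite -/N -/D in h1 DN AD.
have sE : scale k n l r = n%:R ^+ (l - N * k').
  rewrite /scale -[k.-1]/k' -/N mulnC -{1}(subnK h1) exprD mulfK // expf_neq0 // gt_eqF //.
have cge1 : 1 <= #|Cset G l r|%:R :> R by rewrite ler1n card_gt0.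
(* Here [scale] is 1 and the given cavity suffices; this is why the constant is a minimum with 1. *)
have [le|lt] := leqP l (N * k').
  have -> : scale k n l r = 1 by rewrite sE (eqP le) expr0.
  by rewrite mulr1; apply: le_trans cge1; rewrite ge_min lexx.
have pE : (l - N * k' = p.+1)%N by rewrite /p prednK // subn_gt0.
have Nge : (l - r <= N * k')%N := cdiv_ge _ k'_gt0.
have DE : (D + (l - r) = N * k')%N by rewrite /D subnK.
have NE : (D * k' + N' * k' = N * k')%N by rewrite -mulnDl /N' subnKC.
(* Rounding up gives D < k', so for k = 2 no degenerate constraint is used. *)
have hA : A = set0 \/ (1 < k')%N.
  have Dk : (D < k')%N.
    have := cdiv_lt (l - r) k'_gt0; rewrite -/N -DE addnC ltn_add2l //.
  have [//|k1] := ltnP 1 k'; [by right | left].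
  by apply/eqP; rewrite -cards_eq0 AD -leqn0 -ltnS; apply: leq_trans Dk k1.
have lE : (#|A| * k' + (N' * k').+1 + p = l)%N.
  rewrite AD addnS NE addSnnS -pE subnKC //.
have rE : (#|A| * k'.-1 + N' * k' + r = #|A| * k' + (N' * k').+1 + p)%N.
  rewrite lE AD; have e : (D * k'.-1 + D = D * k')%N by rewrite -{2}(prednK k'_gt0) mulnS addnC.
  have /andP[_ rl'] := rl.
  have arith (d dk dk1 nk nk' : nat) : (d + (l - r) = nk -> dk + nk' = nk -> dk1 + d = dk ->
     r <= l -> dk1 + nk' + r = l)%N by lia.
  exact: arith DE NE e rl'.
have cnt := count_cavities k'_gt0 K4 sp Ak hA rE.
rewrite lE -/v in cnt.
have isoB : (cb * n%:R / 2%:R) ^+ p <= ((#|iso G| - v) ^_ p)%:R.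
  have hi : cb * n%:R <= #|iso G|%:R by apply: le_trans hI _; exact: Xs_iso.
  have vi : (v + p <= #|iso G|)%N.
    rewrite -(ler_nat R); apply: le_trans hi; apply: le_trans vpn.
    by rewrite ler_nat leq_pmull.
  apply: (@le_trans _ _ ((#|iso G| - v - p)%N%:R ^+ p)); last by rewrite -natrX ler_nat ffact_lower.
  rewrite lerXn2r ?nnegrE //; first by nneg.
  rewrite -subnDA natrB //; move: vpn hi; rewrite natrM => hv hi; lra.
have hth : ca * n%:R <= #|thetas G N'|%:R by rewrite -Xs_thetas.
have l0 : 0 < (l ^ (v + p))%:R :> R.
  by rewrite ltr0n expn_gt0; apply/orP; left; apply: leq_trans lt.
apply: (@le_trans _ _ (ca * (cb / 2%:R) ^+ p / (l ^ (v + p))%:R * scale k n l r)).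
  rewrite ler_wpM2r ?ge_min ?lexx ?orbT // sE exprn_ge0 //.
rewrite mulrAC ler_pdivrMr // sE pE.
have -> : ca * (cb / 2%:R) ^+ p * n%:R ^+ p.+1 = (ca * n%:R) * (cb * n%:R / 2%:R) ^+ p.
  rewrite exprS; have -> : cb * n%:R / 2%:R = cb / 2%:R * n%:R by rewrite mulrAC.
  by rewrite [(cb / 2%:R * n%:R) ^+ p]exprMn; ring.
rewrite -natrM; apply: le_trans (_ : (#|thetas G N'| * (#|iso G| - v) ^_ p)%:R <= _); last first.
  by rewrite ler_nat.
by rewrite natrM ler_pM //; nneg.
Qed.

(** A union bound over three exceptional events. The constant c precedes [del], since the target for
    the expected error is later chosen in terms of c. *)
Lemma lower_bound : exists2 c : R, 0 < c & forall del : R, 0 < del -> exists n0 : nat,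
  forall n m : nat, (n0 <= n)%N -> c0 * n%:R <= m%:R -> (m <= M * n)%N ->
  prob_event P (fun G : factor_graph k I n m =>
    ~ (Cset G l r != set0 -> c * scale k n l r <= #|Cset G l r|%:R)) <= del.
Proof.
pose ca := cstar k' N' M c0; pose cb := cstar k' 0 M c0.
have ca0 : 0 < ca := cstar_gt0 _ _ _ c00.
have cb0 : 0 < cb := cstar_gt0 _ _ _ c00.
have l0 : 0 < (l ^ (v + p))%:R :> R.
  rewrite ltr0n expn_gt0; apply/orP; left.
  by case/andP: rl => h1 h2; apply: leq_trans h2.
exists (Num.min 1 (ca * (cb / 2%:R) ^+ p / (l ^ (v + p))%:R)).
  by rewrite lt_min ltr01 /= divr_gt0 // mulr_gt0 // exprn_gt0 // divr_gt0.
move=> del del0; pose d3 := del / 3%:R; have d30 : 0 < d3 by rewrite divr_gt0.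
have [n1 h1] := spans_whp (ltn0Sn k') P0 P1 M K0 d30.
have [n2 h2] := stars_whp P0 P1 N' M k'_gt0 c00 d30.
have [n3 h3] := stars_whp P0 P1 0 M k'_gt0 c00 d30.
have [n4 h4] := ex_nat_ge ((2 * (v + p))%:R / cb).
exists (n1 + n2 + n3 + n4).+1 => n m hn hc hM.
have [n0 hn1 hn2 hn3 hn4] : [/\ 0 < n, n1 <= n, n2 <= n, n3 <= n & n4 <= n]%N.
  by split; lia.
have vpn : (2 * (v + p))%:R <= cb * n%:R.
  by rewrite [leRHS]mulrC -ler_pdivrMr //; apply: le_trans h4 _; rewrite ler_nat.
apply: (@le_trans _ _ (d3 + (d3 + d3))); last first.
  by rewrite le_eqVlt /d3; apply/orP; left; apply/eqP; field.
apply: le_trans (lerD (h1 n m hn1 hM) (lerD (h2 n m hn2 hc hM) (h3 n m hn3 hc hM))).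
apply: le_trans (_ : _ <= prob_event P (fun G : factor_graph k I n m => ~ spans K0 G) +
  prob_event P (fun G : factor_graph k I n m => ~ (ca * n%:R <= Xs N' G) \/ ~ (cb * n%:R <= Xs 0 G))) _.
  apply: (prob_event_union P0 n0) => G h.
  case: (pbP (spans K0 G)) => [sp|]; last by left.
  right; have [ha|ha] := boolP (ca * n%:R <= Xs N' G); last by left; apply/negP.
  have [hb|hb] := boolP (cb * n%:R <= Xs 0 G); last by right; apply/negP.
  by case: h => C0; apply: Cset_lower.
rewrite lerD2l; exact: (prob_event_union P0 n0).
Qed.
End LowerBound.

(** * Decomposition at fixed precision *)

Lemma fun_choice (T X : Type) (Q : T -> X -> Prop) :
  (forall t, exists x, Q t x) -> exists f, forall t, Q t (f t).
Proof.
move=> h; exists (fun t => proj1_sig (ClassicalEpsilon.constructive_indefinite_description _ (h t))).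
by move=> t; exact: proj2_sig.
Qed.

Lemma fin_nat_bound (T : finType) (Q : T -> nat -> Prop) :
  (forall t, exists n0 : nat, forall n, (n0 <= n)%N -> Q t n) ->
  exists n0 : nat, forall n, (n0 <= n)%N -> forall t, Q t n.
Proof.
move=> /fun_choice[f hf]; exists (\max_t f t)%N => n hn t; apply: hf.
exact: leq_trans (leq_bigmax t) hn.
Qed.

(** The inverse of 1 plus the sum of all 1 / f t stands in for the minimum of the f t; the 1 covers
    an empty type. *)
Lemma fin_pos_bound (T : finType) (Q : T -> R -> Prop) :
  (forall t c c', c' <= c -> Q t c -> Q t c') ->
  (forall t, exists2 c, 0 < c & Q t c) -> exists2 c, 0 < c & forall t, Q t c.
Proof.
move=> mon h; have [|f hf] := @fun_choice T R (fun t c => 0 < c /\ Q t c).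
  by move=> t; have [c c0 hc] := h t; exists c.
have s0 : 0 <= \sum_t (f t)^-1 by apply: sumr_ge0 => t _; rewrite invr_ge0 ltW //; case: (hf t).
exists (1 + \sum_t (f t)^-1)^-1; first by rewrite invr_gt0 ltr_pwDl.
move=> t; have [f0 Qf] := hf t; apply: (mon t (f t)) => //.
rewrite -[leRHS]invrK lef_pV2 ?posrE ?invr_gt0 ?ltr_pwDl //.
rewrite (bigD1 t) //= addrCA lerDl addr_ge0 ?ler01 //.
by apply: sumr_ge0 => u _; rewrite invr_ge0 ltW //; case: (hf u).
Qed.

Section Finite.
Variables (Omega : finType) (w0 : Omega) (k' : nat) (I : finType).
Local Notation k := k'.+1.
Variable psi : I -> k.-tuple Omega -> R.
Hypothesis k'_gt0 : (0 < k')%N.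
Variable C : R.
Hypothesis C1 : 1 <= C.
Hypothesis psiC : forall i t, C^-1 <= psi i t <= C.
Variable P : I -> R.
Hypothesis P0 : forall i, 0 <= P i.
Hypothesis P1 : \sum_i P i = 1.

Definition decomposes n m (eps : R) (K L0 : nat) (G : factor_graph k I n m) : Prop :=
  exists l, (1 <= l <= L0)%N /\
    exists S : 'I_l -> {set config Omega n},
      (forall j, S j != set0) /\
      (forall i j, i != j -> [disjoint S i & S j]) /\
      (1 - eps <= \big[Rplus/R0]_(j < l) muS psi G (S j))%Re /\
      (forall j ell, (1 <= ell <= K)%N -> bethe_state psi G w0 eps ell (S j)).

Section Deterministic.
Variables (n m : nat) (G : factor_graph k I n m) (K : nat) (eps : R).
Hypothesis eps0 : 0 < eps.
Hypothesis eps1 : eps < 1.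
Local Notation pairs := ('I_K.+1 * 'I_K.+1)%type.

Definition okp (x : pairs) : bool := (1 <= x.2 <= x.1)%N.

(** A sum over all pairs (l, r) up to K, so that one inequality yields the Bethe property for all
    [ell <= K]. *)
Definition defect (S : {set config Omega n}) : R :=
  \sum_(x : pairs | okp x && (Cset G x.1 x.2 != set0))
    (\sum_(U in Cset G x.1 x.2) err w0 psi G U S) / #|Cset G x.1 x.2|%:R.

Lemma defect_ge0 S : 0 <= defect S.
Proof. by apply: sumr_ge0 => x _; rewrite divr_ge0 // sumr_ge0 // => U _; exact: err_ge0. Qed.

Lemma defect_bethe S ell : defect S < eps -> (ell <= K)%N -> bethe_state psi G w0 eps ell S.
Proof.
move=> hS hl l r r1 rl lell C0; apply/RltP.
have lK : (l < K.+1)%N by rewrite ltnS; exact: leq_trans lell hl.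
have rK : (r < K.+1)%N by exact: leq_ltn_trans rl lK.
have c0 : 0 < #|Cset G l r|%:R :> R by rewrite ltr0n card_gt0.
have := hS; rewrite /defect (bigD1 (Ordinal lK, Ordinal rK)) /=; last by rewrite /okp /= r1 rl.
set rest := (X in _ + X < _) => hd.
have rest0 : 0 <= rest.
  by apply: sumr_ge0 => x _; apply: divr_ge0 => //; apply: sumr_ge0 => U _; exact: err_ge0.
have : (\sum_(U in Cset G l r) err w0 psi G U S) / #|Cset G l r|%:R < eps.
  by apply: le_lt_trans hd; rewrite lerDl.
rewrite ltr_pdivrMr // RmultE INRE => h.
apply: le_lt_trans h; apply: eq_ler.
by apply: eq_bigr => U _; apply: eq_bigr => tau _; rewrite RabsE.
Qed.

Lemma card_pins (T : seq 'I_n) : (#|[set pin T s | s : config Omega n]| <= #|Omega| ^ size T)%N.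
Proof.
rewrite -(card_tuple (size T) Omega).
pose h (u : (size T).-tuple Omega) : {set config Omega n} := [set s' | mp T s' == u].
apply: leq_trans (_ : #|[set h u | u : (size T).-tuple Omega]| <= _)%N; last first.
  by apply: leq_trans (leq_imset_card _ _) _; exact: max_card.
apply: subset_leq_card; apply/subsetP => S /imsetP[s _ ->].
have sz : size (mp T s) == size T by rewrite size_map.
by apply/imsetP; exists (Tuple sz).
Qed.

(** Keep the cylinder sets of defect below eps. A mean defect of at most eps^2 leaves mass at most
    eps to the others by Markov, and eps < 1 ensures that something is kept. *)
Lemma decomposes_of_pin (T : seq 'I_n) (Th : nat) : (size T <= Th)%N ->
  \sum_s muw psi G s * defect (pin T s) <= eps ^+ 2 ->
  decomposes eps K (#|Omega| ^ Th) G.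
Proof.
move=> sT hd; pose good := [set S in [set pin T s | s : config Omega n] | defect S < eps].
have O1 : (0 < #|Omega|)%N by apply/card_gt0P; exists w0.
have mass : 1 - eps <= \sum_(S in good) muS psi G S.
  have -> : \sum_(S in good) muS psi G S = \sum_(s | defect (pin T s) < eps) muw psi G s.
    rewrite (partition_big (pin T) (mem good)) /=; last first.
      by move=> s hs; rewrite inE hs imset_f.
    apply: eq_bigr => S; rewrite inE => /andP[/imsetP[s0 _ ->] hS].
    rewrite muS_muw; apply: eq_bigl => s; rewrite inE.
    apply/eqP/andP => [e|[_ /eqP e]].
      by have -> : pin T s = pin T s0 by apply/setP => s'; rewrite !inE e.
    by have : s \in pin T s; [rewrite inE | rewrite e inE => /eqP].
  have := muw_sum w0 C1 psiC G; rewrite (bigID (fun s => defect (pin T s) < eps)) /=.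
  set a := \sum_(s | _) _; set b := \sum_(s | _) _ => ab.
  have : b * eps <= eps ^+ 2.
    apply: le_trans hd; rewrite mulr_suml [leRHS](bigID (fun s => defect (pin T s) < eps)) /=.
    rewrite -[leLHS]add0r lerD //.
      by apply: sumr_ge0 => s _; rewrite mulr_ge0 ?defect_ge0 // (muw_ge0 C1 psiC).
    apply: ler_sum => s; rewrite -leNgt => hs.
    by rewrite ler_wpM2l ?(muw_ge0 C1 psiC).
  by rewrite expr2 ler_pM2r // => hb; lra.
exists #|good|; split.
  apply/andP; split.
    rewrite card_gt0; apply/eqP => g0; move: mass.
    by rewrite g0 big_set0 subr_le0 leNgt eps1.
  apply: leq_trans (subset_leq_card _) (leq_trans (card_pins T) _).
    by apply/subsetP => S; rewrite inE => /andP[].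
  by rewrite leq_pexp2l.
have gp (j : 'I_#|good|) : exists s, enum_val j = pin T s /\ defect (enum_val j) < eps.
  by have := enum_valP j; rewrite inE => /andP[/imsetP[s _ e] h]; exists s.
exists (fun j => enum_val j); split; [|split; [|split]].
- by move=> j; have [s [-> _]] := gp j; apply/set0Pn; exists s; rewrite inE.
- move=> i j ij; have [s [es _]] := gp i; have [t [et _]] := gp j.
  rewrite -setI_eq0; apply/eqP/setP => x; rewrite !inE; apply/negP => /andP[xs xt].
  move: ij; rewrite -(inj_eq enum_val_inj) es et => /eqP; apply.
  move: xs xt; rewrite es et !inE => /eqP e1 /eqP e2.
  by apply/setP => y; rewrite !inE -e1 -e2.
- apply/RleP; apply: le_trans mass _; apply: eq_ler.
  by rewrite [LHS]big_enum_val.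
- by move=> j ell /andP[_ hl]; have [s [_ h]] := gp j; exact: defect_bethe.
Qed.

Variable c : R.
Hypothesis c0 : 0 < c.
Hypothesis n_gt0 : (0 < n)%N.
Hypothesis lower : forall x : pairs, okp x -> Cset G x.1 x.2 != set0 ->
  c * scale k n x.1 x.2 <= #|Cset G x.1 x.2|%:R.

Lemma scale_gt0 l r : 0 < scale k n l r.
Proof. by rewrite divr_gt0 ?exprn_gt0 // ltr0n. Qed.

(** Some t < Th and some list of length t do at least as well as the average; the hypothesis [lower]
    then replaces [scale] by the true number of cavities at the cost of c. *)
Lemma decomposes_of_avg (Th : nat) : (0 < Th)%N ->
  \sum_(x : pairs | okp x) (scale k n x.1 x.2)^-1 *
     (\sum_(U in Cset G x.1 x.2) Ftot w0 psi Th G U) <= Th%:R * (c * eps ^+ 2) ->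
  decomposes eps K (#|Omega| ^ Th) G.
Proof.
move=> Th0 h.
have T0 : [set: 'I_n] != set0 by apply/set0Pn; exists (Ordinal n_gt0); rewrite inE.
pose H (T : seq 'I_n) := \sum_(x : pairs | okp x) (scale k n x.1 x.2)^-1 *
   (\sum_(U in Cset G x.1 x.2) \sum_s muw psi G s * err w0 psi G U (pin T s)).
have e : \sum_(x : pairs | okp x) (scale k n x.1 x.2)^-1 *
     (\sum_(U in Cset G x.1 x.2) Ftot w0 psi Th G U) = \sum_(t < Th) avgl [set: 'I_n] t H.
  rewrite /H; under [RHS]eq_bigr do rewrite avgl_sum.
  rewrite exchange_big /=; apply: eq_bigr => x _.
  under [RHS]eq_bigr do rewrite avglZ // avgl_sum.
  by rewrite -mulr_sumr; congr (_ * _); rewrite exchange_big.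
rewrite e in h.
have [t ht] : exists t : 'I_Th, avgl [set: 'I_n] t H <= c * eps ^+ 2.
  apply/existsP; apply: contraTT h; rewrite negb_exists => /forallP h; rewrite -ltNge.
  rewrite mulr_natl -[X in _ *+ X]card_ord -sumr_const.
  rewrite (bigD1 (Ordinal Th0)) // [X in _ < X](bigD1 (Ordinal Th0)) //.
  rewrite ltr_leD //; first by rewrite ltNge h.
  by apply: ler_sum => b _; rewrite ltW // ltNge h.
have [T sT HT] := avgl_ex T0 ht.
apply: (@decomposes_of_pin T); first by rewrite sT ltnW.
have -> : \sum_s muw psi G s * defect (pin T s) =
  \sum_(x : pairs | okp x && (Cset G x.1 x.2 != set0))
   (\sum_(U in Cset G x.1 x.2) \sum_s muw psi G s * err w0 psi G U (pin T s)) / #|Cset G x.1 x.2|%:R.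
  rewrite /defect; under eq_bigr do rewrite mulr_sumr.
  rewrite exchange_big /=; apply: eq_bigr => x _.
  under eq_bigr do rewrite mulrA mulr_sumr.
  by rewrite -mulr_suml exchange_big.
rewrite -(ler_pM2l c0); apply: le_trans HT; rewrite /H mulr_sumr big_mkcondr /=.
have V0 (x : pairs) : 0 <= \sum_(U in Cset G x.1 x.2) \sum_s muw psi G s * err w0 psi G U (pin T s).
  apply: sumr_ge0 => U _; apply: sumr_ge0 => s _.
  by rewrite mulr_ge0 ?(muw_ge0 C1 psiC) // err_ge0.
apply: ler_sum => x okx; case: ifP => [C0|_]; last first.
  by apply: mulr_ge0; [rewrite invr_ge0 ltW // scale_gt0|exact: V0].
have Cp : 0 < #|Cset G x.1 x.2|%:R :> R by rewrite ltr0n card_gt0.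
rewrite mulrCA [leRHS]mulrC ler_wpM2l // ler_pdivrMr // mulrC ler_pdivlMr ?scale_gt0 //.
exact: lower.
Qed.
End Deterministic.

(** The constant c comes from the lower bound, [del] from c, Th from [del], and n from Th. Both L0 =
    |Omega|^Th and the threshold n0 are uniform in m. *)
Lemma finite_version (eps : R) (K M : nat) (c0 : R) : 0 < eps < 1 -> 0 < c0 ->
  exists L0 n0 : nat, forall n m : nat, (n0 <= n)%N -> c0 * n%:R <= m%:R -> (m <= M * n)%N ->
  prob_event P (fun G : factor_graph k I n m => ~ decomposes eps K L0 G) <= eps.
Proof.
move=> /andP[eps0 eps1] c00.
pose pairs : finType := ('I_K.+1 * 'I_K.+1)%type.
pose Np : R := #|{: pairs}|%:R.
have Np0 : 0 < Np by rewrite ltr0n; apply/card_gt0P; exists (ord0, ord0).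
pose d2 := eps / (2%:R * Np); have d20 : 0 < d2 by rewrite divr_gt0 // mulr_gt0.
pose okx (x : pairs) := (1 <= x.2 <= x.1)%N.
pose few (c : R) n m (x : pairs) (G : factor_graph k I n m) : Prop :=
  ~ (Cset G x.1 x.2 != set0 -> c * scale k n x.1 x.2 <= #|Cset G x.1 x.2|%:R).
have [c cp hc] : exists2 c : R, 0 < c & forall x : pairs, okx x -> exists n0 : nat,
  forall n m : nat, (n0 <= n)%N -> c0 * n%:R <= m%:R -> (m <= M * n)%N ->
  prob_event P (few c n m x) <= d2.
  apply: fin_pos_bound.
    move=> x c c' cc' h okxx; have [n1 h1] := h okxx; exists n1.+1 => n m hn hm hM.
    have n0 : (0 < n)%N by apply: leq_trans hn.
    apply: le_trans (h1 n m (ltnW hn) hm hM).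
    rewrite !prob_eventE; apply: (Ex_le P0 n0) => G; case: pbP => [ng|_]; last exact: ler0n.
    case: pbP => // g; case: g => g; case: ng => C0; apply: le_trans (g C0).
    by rewrite ler_wpM2r // ltW // scale_gt0.
  move=> x; have [okxx|nok] := boolP (okx x); last by exists 1 => // h; rewrite h in nok.
  have [c cp h] := lower_bound k'_gt0 P0 P1 M c00 okxx.
  by exists c => // _; exact: h.
(* Markov at level Th c eps^2, summed over Np pairs, then costs eps / 2; the other eps / 2 is Np
   [d2]. *)
pose del := c * eps ^+ 3 / (2%:R * Np); have del0 : 0 < del.
  by rewrite divr_gt0 // mulr_gt0 // exprn_gt0.
pose small Th n (x : pairs) := forall m : nat, (m <= M * n)%N ->
  @Ex k I P n m (fun G => \sum_(U in Cset G x.1 x.2) Ftot w0 psi Th G U) <=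
    Th%:R * del * scale k n x.1 x.2.
have [Th Th0 hTh] : exists2 Th : nat, (0 < Th)%N & forall x : pairs, exists n0 : nat,
  forall n, (n0 <= n)%N -> small Th n x.
  have [|Th h] := @fin_nat_bound pairs (fun x Th => exists n0 : nat,
    forall n, (n0 <= n)%N -> small Th n x).
    move=> x; have [Th0 _ h] := upper_bound w0 (k'_gt0 : (1 < k)%N) C1 psiC P0 P1 M x.1 x.2 del0.
    by exists Th0 => Th /h[n0 h0]; exists n0 => n hn m; exact: h0.
  by exists Th.+1 => // x; exact: h.
have [n1 hn1] : exists n1 : nat, forall n, (n1 <= n)%N -> forall x : pairs, small Th n x.
  exact: fin_nat_bound.
have [n2 hn2] : exists n2 : nat, forall n, (n2 <= n)%N -> forall x : pairs, okx x -> forall m : nat,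
    c0 * n%:R <= m%:R -> (m <= M * n)%N ->
  prob_event P (few c n m x) <= d2.
  apply: fin_nat_bound => x; have [okxx|nok] := boolP (okx x); last by exists 0%N => n _ h.
  by have [n2 h2] := hc x okxx; exists n2 => n hn _ m; exact: h2.
exists (#|Omega| ^ Th)%N, (n1 + n2).+1 => n m hn hm hM.
have n0 : (0 < n)%N by apply: leq_trans hn.
have hn1' : (n1 <= n)%N by apply: leq_trans (ltnW hn); exact: leq_addr.
have hn2' : (n2 <= n)%N by apply: leq_trans (ltnW hn); exact: leq_addl.
pose bad x G : R := (pb (few c n m x G))%:R.
pose FG (G : factor_graph k I n m) : R := \sum_(x : pairs | okx x) (scale k n x.1 x.2)^-1 *
     (\sum_(U in Cset G x.1 x.2) Ftot w0 psi Th G U).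
have Th0R : 0 < Th%:R :> R by rewrite ltr0n.
have Q0 : 0 < Th%:R * (c * eps ^+ 2) by rewrite mulr_gt0 // mulr_gt0 // exprn_gt0.
have FG0 G : 0 <= FG G.
  apply: sumr_ge0 => x _; apply: mulr_ge0; first by rewrite invr_ge0 ltW // scale_gt0.
  by apply: sumr_ge0 => U _; exact: (Ftot_ge0 w0 C1 psiC n0).
apply: (@le_trans _ _ (Ex P (fun G => \sum_(x : pairs | okx x) bad x G +
   (Th%:R * (c * eps ^+ 2))^-1 * FG G))).
  apply: (Ex_prob_le P0 n0) => G.
    rewrite addr_ge0 ?sumr_ge0 // ?mulr_ge0 ?invr_ge0 ?(ltW Q0) // => x _; exact: ler0n.
  move=> nd; have b0 : 0 <= \sum_(x : pairs | okx x) bad x G by apply: sumr_ge0 => x _; exact: ler0n.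
  have [hF|hF] := lerP (FG G) (Th%:R * (c * eps ^+ 2)); last first.
    by rewrite -[leLHS]add0r lerD // mulrC ler_pdivlMr // mul1r ltW.
  rewrite -[leLHS]addr0 lerD ?mulr_ge0 ?invr_ge0 ?(ltW Q0) //.
  have [/existsP[x /andP[okxx bx]]|] := boolP [exists x : pairs, okx x && pb (few c n m x G)].
    rewrite (bigD1 x) //= {1}/bad bx lerDl; apply: sumr_ge0 => y _; exact: ler0n.
  rewrite negb_exists => /forallP h; case: nd.
  apply: (decomposes_of_avg eps0 eps1 cp n0 _ Th0 hF) => x okxx C0.
  have := h x; rewrite -[okx x]/(okp x) okxx /=; case: pbP => // hh _.
  have [//|nle] := boolP (c * scale k n x.1 x.2 <= #|Cset G x.1 x.2|%:R).
  by case: hh => /(_ C0); apply/negP.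
rewrite ExD ExZ Ex_sum.
have e1 : \sum_(x : pairs | okx x) Ex P (bad x) <= Np * d2.
  apply: (@le_trans _ _ (\sum_(x : pairs) d2)).
    rewrite [leLHS]big_mkcond; apply: ler_sum => x _; case: ifP => [okxx|_]; last exact: ltW.
    by have := hn2 n hn2' x okxx m hm hM; rewrite prob_eventE.
  by rewrite sumr_const mulr_natl.
have e2 : Ex P FG <= Np * (Th%:R * del).
  rewrite /FG Ex_sum; apply: (@le_trans _ _ (\sum_(x : pairs) Th%:R * del)).
    rewrite [leLHS]big_mkcond; apply: ler_sum => x _; case: ifP => [okxx|_]; last first.
      by rewrite mulr_ge0 // ltW.
    by rewrite ExZ mulrC ler_pdivrMr ?scale_gt0 //; exact: hn1.
  by rewrite sumr_const -[leLHS]mulr_natl.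
apply: (@le_trans _ _ (Np * d2 + (Th%:R * (c * eps ^+ 2))^-1 * (Np * (Th%:R * del)))).
  by rewrite lerD // ler_wpM2l // invr_ge0 ltW.
apply: eq_ler; rewrite /d2 /del; field.
by rewrite !gt_eqF.
Qed.
End Finite.

(** * The limit *)

Section Limit.
Variables (Omega : finType) (w0 : Omega) (k' : nat) (I : finType).
Local Notation k := k'.+1.
Variable psi : I -> k.-tuple Omega -> R.
Hypothesis k'_gt0 : (0 < k')%N.
Variable C : R.
Hypothesis C1 : 1 <= C.
Hypothesis psiC : forall i t, C^-1 <= psi i t <= C.
Variable P : I -> R.
Hypothesis P0 : forall i, 0 <= P i.
Hypothesis P1 : \sum_i P i = 1.

(** For n = 0 there is no graph when m > 0, and exactly one, of weight 1, when m = 0. *)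
Lemma prob_event01 n m (E : factor_graph k I n m -> Prop) : 0 <= prob_event P E <= 1.
Proof.
case: n E => [|n] E; last by rewrite (prob_event_ge0 P0) ?(prob_event_le1 P0 P1).
case: m E => [|m] E; last first.
  rewrite /prob_event big1 ?lexx ?ler01 // => G _.
  by have [] := tnth (G ord0).1 ord0.
have gp G : graph_prob P (G : factor_graph k I 0 0) = 1 by rewrite /graph_prob big_ord0.
apply/andP; split; first by apply: sumr_ge0 => G _; rewrite gp; case: (pb _); rewrite ?ler01.
apply: (@le_trans _ _ (\sum_(G : factor_graph k I 0 0) 1)).
  by apply: ler_sum => G _; rewrite gp; case: (pb _); rewrite ?ler01.
by rewrite sumr_const card_ffun card_ord expn0.
Qed.

Variable d : R.
Hypothesis d0 : 0 < d.
Let mean n : R := (d * INR n / INR k)%Re.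

Lemma decomposes_aas (L : nat -> nat) : tends_to_infty L ->
  exists eps : nat -> R, Un_cv eps 0%Re /\
  exists K : nat -> nat, tends_to_infty K /\
  aas P d (fun n m (G : factor_graph k I n m) => decomposes w0 psi (eps n) (K n) (L n) G).
Proof.
move=> hL.
have k0 : 0 < k%:R :> R by rewrite ltr0n.
(* A quarter of the mean per vertex, so that the lower tail exponent c0 n - mean / 2 equals - c0
   n. *)
pose c0 : R := (d / INR k * / 4)%Re.
have c0R : (0 < c0)%Re.
  apply: Rmult_lt_0_compat; last by Lra.lra.
  apply: Rmult_lt_0_compat; first exact/RltP.
  by apply: Rinv_0_lt_compat; apply: lt_0_INR; apply/ssrnat.leP.
have c00 : 0 < c0 by apply/RltP.
(* Makes the upper tail exponent mean (e - 1) - M n at most - n. *)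
have [M hM] := ex_nat_ge (d / k%:R * (exp 1%Re - 1) + 1).
have hMR : (d / INR k * (exp 1%Re - 1) + 1 <= INR M)%Re by apply/RleP; rewrite !INRE.
pose ej (j : nat) : R := (j.+2%:R)^-1.
have ej0 j : 0 < ej j by rewrite invr_gt0 ltr0n.
have ej1 j : ej j < 1 by rewrite invf_lt1 ?ltr0n // ltr1n.
have ejsmall e : 0 < e -> exists J, forall j, (J <= j)%N -> ej j < e.
  move=> e0; have [J hJ] := ex_nat_ge e^-1; exists J => j hj.
  rewrite -[ltRHS]invrK ltf_pV2 ?posrE ?invr_gt0 ?ltr0n //.
  by apply: (le_lt_trans hJ); rewrite ltr_nat ltnS leqW.
have ejR j : (0 < ej j)%Re by apply/RltP.
have [f hf] : exists f : nat -> nat * nat, forall j n m, ((f j).2 <= n)%N ->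
    c0 * n%:R <= m%:R -> (m <= M * n)%N ->
    prob_event P (fun G : factor_graph k I n m => ~ decomposes w0 psi (ej j) j (f j).1 G) <= ej j.
  apply: (@fun_choice nat (nat * nat)%type (fun j x => forall n m, (x.2 <= n)%N ->
    c0 * n%:R <= m%:R -> (m <= M * n)%N -> prob_event P (fun G : factor_graph k I n m =>
     ~ decomposes w0 psi (ej j) j x.1 G) <= ej j)) => j.
  have [|L0 [n0 h]] := finite_version w0 k'_gt0 C1 psiC P0 P1 (eps := ej j) j M _ c00.
    by rewrite ej0 ej1.
  by exists (L0, n0).
have [t ht] : exists t : nat -> nat, forall j n, (t j <= n)%N ->
    (exp (- (c0 * INR n))%Re <= ej j /\ exp (- (1 * INR n))%Re <= ej j)%Re.
  apply: (@fun_choice nat nat (fun j x => forall n, (x <= n)%N ->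
    (exp (- (c0 * INR n))%Re <= ej j /\ exp (- (1 * INR n))%Re <= ej j)%Re)) => j.
  have [N1 h1] := exp_tail_cv0 c0R (ejR j).
  have [N2 h2] := exp_tail_cv0 Rlt_0_1 (ejR j).
  by exists (maxn N1 N2) => n; rewrite geq_max => /andP[/h1 ? /h2 ?].
have [g hg] : exists g : nat -> nat, forall j n, (g j <= n)%N -> ((f j).1 <= L n)%N.
  by apply: (@fun_choice nat nat (fun j x => forall n, (x <= n)%N -> ((f j).1 <= L n)%N)) => j; exact: hL.
(* From here on precision j is available: the fixed-precision result holds, both Poisson tails are
   below [ej j], and L admits the pieces. The successor ensures n > 0. *)
pose N j := (maxn (f j).2 (maxn (t j) (g j))).+1.
have [jn [jinf hj]] := diagonal_index N.
exists (fun n => ej (jn n)); split.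
  move=> e /RltP/ejsmall[J hJ]; have [n0 h0] := jinf J; exists n0 => n /ssrnat.leP/h0/hJ/RltP h.
  by rewrite /Rdist Rminus_0_r Rabs_pos_eq //; exact/Rlt_le/ejR.
exists jn; split => //.
set E := fun n m (G : factor_graph k I n m) => _.
have q01 n m : (0 <= prob_event P (@E n m) <= 1)%Re.
  by have /andP[/RleP ? /RleP ?] := prob_event01 (@E n m).
have mean0 n : (0 <= mean n)%Re.
  apply: Rmult_le_pos; last by apply/Rlt_le/Rinv_0_lt_compat/lt_0_INR/ssrnat.leP.
  by apply: Rmult_le_pos; [apply/Rlt_le/RltP | exact: pos_INR].
have [p hp] : exists p : nat -> R, forall n,
  infinite_sum (fun m => poisson (mean n) m * prob_event P (@E n m))%Re (p n) /\ (p n <= 1)%Re.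
  apply: (@fun_choice nat R (fun n x => 
    infinite_sum (fun m => poisson (mean n) m * prob_event P (@E n m))%Re x /\ (x <= 1)%Re)) => n.
  by have [x hx x1] := poisson_mixture_ex (mean0 n) (q01 n); exists x.
exists p; split; first by move=> n; have [] := hp n.
(* One [ej] for the graph and one for each Poisson tail. *)
have lowp n : (N 0 <= n)%N -> (1 - 3 * ej (jn n) <= p n)%Re.
  move=> /hj; set j := jn n; rewrite /N => hn.
  have n0 : (0 < n)%N by apply: leq_trans hn.
  move: (ltnW hn); rewrite !geq_max => /and3P[hfn /ht[t1 t2] hgn].
  have [ps _] := hp n.
  have low := poisson_mixture_ge (a := (c0 * INR n)%Re) (b := (INR M * INR n)%Re)
     (mean0 n) (q01 n) (Rlt_le _ _ (ejR j)) ps.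
  have win m : (c0 * INR n <= INR m <= INR M * INR n -> 1 - ej j <= prob_event P (@E n m))%Re.
    move=> [/RleP a1 /RleP a2]; apply/RleP.
    apply: (prob_event_compl P0 P1 n0) (hf j n m hfn _ _).
    - move=> G; rewrite /E -/j => nE.
      case: (pbP (decomposes w0 psi (ej j) j (f j).1 G)) => [|nd]; last by case: nE.
      move=> [l [/andP[l1 lf] h]]; exists l; split=> //.
      by rewrite l1 (leq_trans lf) // hg.

    - by move: a1; rewrite -!INRE.
    - by move: a2; rewrite RmultE !INRE -natrM ler_nat.
  have := low win; set e1 := exp _; set e2 := exp _ => h.
  have le_exp x y : (x <= y -> exp x <= exp y)%Re.
    by case=> [/exp_increasing/Rlt_le|->] //; exact: Rle_refl.
  have nR := pos_INR n.
  have h1 : (e1 <= exp (- (1 * INR n))%Re)%Re.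
    apply: le_exp.
    have := Rmult_le_compat_r _ _ _ nR hMR; rewrite /mean.
    rewrite /Rdiv; Lra.lra.
  have h2 : (e2 <= exp (- (c0 * INR n))%Re)%Re.
    by apply: le_exp; rewrite /c0 /mean /Rdiv; Lra.lra.
  Lra.lra.
move=> e e0; have e3 : (0 < e / 3)%Re by Lra.lra.
have [J hJ] := ejsmall _ (introT RltP e3).
have [n0 h0] := jinf J; exists (maxn n0 (N 0)) => n /ssrnat.leP; rewrite geq_max => /andP[/h0/hJ/RltP h /lowp hl].
have [_ hu] := hp n.
rewrite /Rdist Rabs_minus_sym Rabs_pos_eq; Lra.lra.
Qed.
End Limit.

Lemma two_sided_bound (T : finType) (f : T -> R) : (forall t, 0 < f t) ->
  exists2 C, 1 <= C & forall t, C^-1 <= f t <= C.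
Proof.
move=> f0; have g0 t : 0 <= f t + (f t)^-1 by apply: addr_ge0; [exact: ltW | rewrite invr_ge0 ltW].
have C1 : 1 <= 1 + \sum_t (f t + (f t)^-1) by rewrite lerDl sumr_ge0.
exists (1 + \sum_t (f t + (f t)^-1)) => // t.
have le : f t + (f t)^-1 <= 1 + \sum_t (f t + (f t)^-1).
  rewrite (bigD1 t) //= addrCA lerDl addr_ge0 // sumr_ge0 // => i _; exact: g0.
apply/andP; split; last by apply: le_trans le; rewrite lerDl invr_ge0 ltW.
rewrite -[leRHS]invrK lef_pV2 ?posrE ?invr_gt0 //; last exact: lt_le_trans C1.
by apply: le_trans le; rewrite lerDr ltW.
Qed.

Local Close Scope ring_scope.

Theorem theorem3p3 (Omega : finType) (w0 : Omega) (k : nat) (I : finType)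
    (psi : I -> k.-tuple Omega -> R) (P : I -> R) (d : R) :
  2 <= k ->
  injective psi ->
  (forall i t, 0 < psi i t)%Re ->
  (forall i, 0 <= P i)%Re ->
  \big[Rplus/R0]_(i : I) P i = 1%Re ->
  (0 < d)%Re ->
  forall L : nat -> nat, tends_to_infty L ->
  exists eps : nat -> R, Un_cv eps 0%Re /\
  exists K : nat -> nat, tends_to_infty K /\
  aas P d (fun n m (G : factor_graph k I n m) =>
    exists l, 1 <= l <= L n /\
    exists S : 'I_l -> {set config Omega n},
      (forall j, S j != set0) /\
      (forall i j, i != j -> [disjoint S i & S j]) /\
      (1 - eps n <= \big[Rplus/R0]_(j < l) muS psi G (S j))%Re /\
      (forall j ell, 1 <= ell <= K n -> bethe_state psi G w0 (eps n) ell (S j))).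
Proof.
move=> k2 _ psi0 P0 P1 d0 L hL; case: k k2 psi psi0 => [|[|k']] // _ psi psi0.
have [|C C1 psiC] := @two_sided_bound _ (fun x : I * k'.+2.-tuple Omega => psi x.1 x.2).
  by move=> x; apply/RltP.
have P0' i : Order.le 0%R (P i) by apply/RleP.
apply: (decomposes_aas w0 (isT : 0 < k'.+1) C1 _ P0' P1 _ hL); last exact/RltP.
by move=> i t; exact: (psiC (i, t)).
Qed.
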